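(* Consider the online configuration selection and admission control problem and the algorithm SP-UCB--OLP (denoted $\pi_1$) described in the context, under the assumptions listed there (stationarity and independence, boundedness, budget scaling $\mathbf B=T\mathbf b$, continuous valuation). Run the algorithm with $\varepsilon=\sqrt{\log T/T}$, confidence level $\delta=T^{-2}$ and exploration parameter $\alpha\ge1$. Then $$\mathrm{Reg}^{\mathrm{mix}}_{\pi_1}(T):=T\cdot V^{\mathrm{mix}}(\mathbf b)-\mathbb E[R_T^{\pi_1}]\ \le\ C_1\,\alpha\sqrt{KT\cdot d\log T}+C_2\sqrt{T\log T}+KR_{\max},$$ where the constants $C_1,C_2>0$ depend only on $(d,R_{\max},A_{\max},\mathbf b)$. In particular, for fixed $d$, $\mathrm{Reg}^{\mathrm{mix}}_{\pi_1}(T)=\tilde O(\alpha\sqrt{KT})$.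
   Context: Problem. There are $T$ periods, $d$ resource types, a total budget $\mathbf B\in\mathbb R_+^d$, and $K$ configurations $\Theta=\{1,\dots,K\}$; configuration $\theta$ has an unknown distribution $\mathcal D_\theta$ of reward–resource pairs $(r,\mathbf a)\in\mathbb R_+\times\mathbb R_+^d$. In each period $t$ the decision maker selects $\theta_t\in\Theta$, observes $(r_t,\mathbf a_t)\sim\mathcal D_{\theta_t}$, then irrevocably chooses $x_t\in\{0,1\}$, subject to $\sum_{t=1}^T\mathbf a_tx_t\le\mathbf B$ componentwise a.s. The total reward of policy $\pi$ is $R_T^\pi=\sum_{t=1}^Tr_tx_t$. Assumptions. (Stationarity and independence) When $\theta$ is selected, the pair is drawn independently from the time-invariant $\mathcal D_\theta$. (Boundedness) There are $R_{\max},A_{\max}>0$ with $0\le r\le R_{\max}$, $\|\mathbf a\|_\infty\le A_{\max}$ a.s. under every $\mathcal D_\theta$. (Budget scaling) $\mathbf B=T\mathbf b$ for a fixed $\mathbf b\in\mathbb R_+^d$, with $b_{\min}:=\min_ib_i>0$. (Continuous valuation) For every $\theta$, under $\mathcal D_\theta$ the conditional distribution of $r$ given $\mathbf a=\boldsymbol\alpha$ is continuous (no atoms) for every $\boldsymbol\alpha$ in the support of $\mathbf a$; in particular $\mathbb P_\theta(r=\langle\mathbf p,\mathbf a\rangle)=0$ for every $\mathbf p\in\mathbb R^d$. Benchmark. With $\mathbb E_\theta$ the expectation under $\mathcal D_\theta$ and $\Delta_K$ the probability simplex, $V^{\mathrm{mix}}(\mathbf b):=\max_{\mathbf w\in\Delta_K}\max_{\{x_\theta\}}\{\sum_\theta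 w_\theta\mathbb E_\theta[r\,x_\theta(r,\mathbf a)]:\sum_\theta w_\theta\mathbb E_\theta[\mathbf a\,x_\theta(r,\mathbf a)]\le\mathbf b\}$, the inner maximum being over measurable $x_\theta:\mathbb R_+\times\mathbb R_+^d\to[0,1]$. Notation. $P_{\max}=2R_{\max}/b_{\min}$, $\mathcal P=[0,P_{\max}]^d$, $\mathbf b^{\mathrm{safe}}=(1-\varepsilon)\mathbf b$, $g_\theta(\mathbf p)=\mathbb E_\theta[(r-\langle\mathbf p,\mathbf a\rangle)_+]$, $x\vee y=\max\{x,y\}$. For each $\theta$, $\mathcal S_\theta$ is the collection of all pairs observed so far when $\theta$ was selected (whether accepted or not), $N_\theta=|\mathcal S_\theta|$, and at the start of round $t$ $$\widehat g_{\theta,t}(\mathbf p)=\frac1{N_\theta\vee1}\sum_{(r,\mathbf a)\in\mathcal S_\theta}(r-\langle\mathbf p,\mathbf a\rangle)_+,\qquad \beta_{\alpha,\theta}(t)=\alpha\,c_gR_{\max}\sqrt{\frac{d\log\big(\frac{c_0\,d\,P_{\max}A_{\max}T}{R_{\max}}\big)+\log(KT/\delta)}{N_\theta\vee1}}.$$ Here $c_g,c_0>0$ are absolute constants coming from a uniform concentration bound: they are such that for any $\alpha\ge1$, $\delta\in(0,1)$, with probability at least $1-\delta$, $\sup_{\mathbf p\in\mathcal P}|g_\theta(\mathbf p)-\widehat g_{\theta,t}(\mathbf p)|\le\beta_{\alpha,\theta}(t)$ simultaneously for all $\theta\in\Theta$ and $t\le T$. Algorithm SP-UCB--OLP. Initialize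 the remaining budget $\mathbf B^{\mathrm{rem}}=\mathbf B$ and all $\mathcal S_\theta=\emptyset$. In rounds $t\le K$: set $\theta_t=t$, observe $(r_t,\mathbf a_t)\sim\mathcal D_{\theta_t}$, add it to $\mathcal S_{\theta_t}$, and set $x_t=0$. In rounds $t>K$: compute a solution $$(\mathbf w_t,\mathbf p_t)\in\arg\max_{\mathbf w\in\Delta_K}\arg\min_{\mathbf p\ge0}\Big\{\langle\mathbf p,\mathbf b^{\mathrm{safe}}\rangle+\sum_\theta w_\theta\big(\widehat g_{\theta,t}(\mathbf p)+\beta_{\alpha,\theta}(t)\big)\Big\}$$ (a saddle point of the bracketed function; the paper treats the problem over $\mathbf p\ge0$ and over $\mathbf p\in\mathcal P$ as equivalent); draw $\theta_t\sim\mathbf w_t$; observe $(r_t,\mathbf a_t)\sim\mathcal D_{\theta_t}$ and add it to $\mathcal S_{\theta_t}$; if $\mathbf a_t\le\mathbf B^{\mathrm{rem}}$ componentwise and $r_t>\langle\mathbf p_t,\mathbf a_t\rangle$, set $x_t=1$ and replace $\mathbf B^{\mathrm{rem}}$ by $\mathbf B^{\mathrm{rem}}-\mathbf a_t$; otherwise set $x_t=0$. *)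

(* Defs.v *)
From HB Require Import structures.
From mathcomp Require Import all_boot all_order all_algebra.
From mathcomp Require Import all_classical all_reals all_analysis.

Set Implicit Arguments.
Unset Strict Implicit.
Unset Printing Implicit Defensive.

Import Order.TTheory GRing.Theory Num.Theory.
Import numFieldNormedType.Exports.

Local Open Scope classical_set_scope.
Local Open Scope ring_scope.

(* Reward-resource pairs (r, a).  Vectors of R^d are d-tuples, because these
   carry the product Borel sigma-algebra in the library. *)
Notation pair_type R d := (R * d.-tuple R)%type.

(* Conventions.  Rounds are numbered from 0: "round t" below is the (t+1)-st
   round, "t < T" ranges over all T rounds, the initial exploration consists of
   the rounds t < K, and "at the start of round t" refers to the data of the
   rounds s < t. *)

(* Real-valued expectation; it is only taken of almost surely bounded random variables. *)
Definition expect {disp : measure_display} {T : measurableType disp}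
    {R : realType} (P : probability T R) (X : T -> R) : R := fine ('E_P[X])%E.

Section Problem.
Context {R : realType} {d : nat}.
Implicit Types (p a b : d.-tuple R) (z : pair_type R d).

Definition dot p a : R := \sum_(i < d) tnth p i * tnth a i.

(* (r - <p, a>)_+ *)
Definition surplus p z : R := Num.max (z.1 - dot p z.2) 0.

(* For d > 0 the range is finite and nonempty, and its infimum is min_i b_i. *)
Definition bmin b : R := inf (range (tnth b)).

Definition Pmax (Rmax : R) b : R := 2 * Rmax / bmin b.

Definition simplex K : set ('I_K -> R) :=
  [set w | (forall th, 0 <= w th) /\ \sum_(th < K) w th = 1].

Definition bounded_laws K (D : 'I_K -> probability (pair_type R d) R)
    (Rmax Amax : R) : Prop :=
  forall th, {ae D th, forall z, 0 <= z.1 <= Rmax /\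
                              forall i, 0 <= tnth z.2 i <= Amax}.

(* [alpha] is in the topological support of the law of a. *)
Definition in_support (mu : probability (pair_type R d) R)
    (alpha : d.-tuple R) : Prop :=
  forall e : R, 0 < e ->
    (0 < mu [set z : pair_type R d |
                 forall i, (`|tnth z.2 i - tnth alpha i| < e)%R])%E.

(* There is a regular version kappa of the conditional law of r given a which
   has no atom at any point of the support of a. *)
Definition continuous_valuation K
    (D : 'I_K -> probability (pair_type R d) R) : Prop :=
  forall th, exists kappa : R.-pker (d.-tuple R) ~> R,
    (forall (A : set R) (B : set (d.-tuple R)), measurable A -> measurable B ->
       D th (A `*` B) = (\int[D th]_(z in snd @^-1` B) kappa z.2 A)%E) /\
    (forall alpha, in_support (D th) alpha ->
       forall r : R, kappa alpha [set r] = 0%E).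

(* The values of the mixture program at its feasible points.  The pair (r, a)
   is almost surely nonnegative, so that acceptance rules may be taken as
   functions on all of R * R^d. *)
Definition mix_values K (D : 'I_K -> probability (pair_type R d) R) b : set R :=
  [set v | exists (w : 'I_K -> R) (x : 'I_K -> pair_type R d -> R),
    [/\ simplex w,
        forall th, measurable_fun setT (x th) /\ forall z, 0 <= x th z <= 1,
        forall i, \sum_(th < K) w th *
          expect (D th) (fun z => tnth z.2 i * x th z) <= tnth b i &
        v = \sum_(th < K) w th * expect (D th) (fun z => z.1 * x th z)]].

Definition Vmix K (D : 'I_K -> probability (pair_type R d) R) b : R :=
  sup (mix_values D b).

Definition g K (D : 'I_K -> probability (pair_type R d) R) (th : 'I_K) p : R :=
  expect (D th) (surplus p).

End Problem.

(* One sample path: [th s] is the configuration selected and [z s] the pair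
   observed in round s. *)
Section Path.
Context {R : realType} {d K : nat}.
Implicit Types (th : nat -> 'I_K) (z : nat -> pair_type R d) (p b : d.-tuple R).

Definition nsel th (t : nat) (k : 'I_K) : nat := \sum_(s < t) (th s == k).

Definition ghat th z (t : nat) (k : 'I_K) p : R :=
  (maxn (nsel th t k) 1)%:R^-1 * \sum_(s < t | th s == k) surplus p (z s).

Definition beta (c_g c_0 Rmax Amax : R) b (T : nat) (delta alpha : R)
    th (t : nat) (k : 'I_K) : R :=
  alpha * c_g * Rmax *
  Num.sqrt ((d%:R * ln (c_0 * d%:R * Pmax Rmax b * Amax * T%:R / Rmax)
             + ln (K%:R * T%:R / delta)) / (maxn (nsel th t k) 1)%:R).

Definition bsafe (eps : R) b : d.-tuple R := [tuple (1 - eps) * tnth b i | i < d].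

Definition saddle_objective (c_g c_0 Rmax Amax : R) b (T : nat)
    (eps delta alpha : R) th z (t : nat) (w : 'I_K -> R) p : R :=
  dot p (bsafe eps b) +
  \sum_(k < K) w k * (ghat th z t k p +
                      beta c_g c_0 Rmax Amax b T delta alpha th t k).

Definition saddle_point (L : ('I_K -> R) -> d.-tuple R -> R)
    (w : 'I_K -> R) p : Prop :=
  [/\ simplex w,
      forall i, 0 <= tnth p i,
      forall w', simplex w' -> L w' p <= L w p &
      forall p', (forall i, 0 <= tnth p' i) -> L w p <= L w p'].

(* The decision x_t when the remaining budget is [rem], the price is [p] and
   the pair observed is [zt]. *)
Definition accept (t : nat) (rem : d.-tuple R) p (zt : pair_type R d) : bool :=
  [&& (K <= t)%N, [forall i, tnth zt.2 i <= tnth rem i] & dot p zt.2 < zt.1].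

(* The remaining budget at the start of round t. *)
Fixpoint remaining (T : nat) b (p : nat -> d.-tuple R) z (t : nat) :
    d.-tuple R :=
  if t is s.+1 then
    let rem := remaining T b p z s in
    [tuple tnth rem i - (accept s rem (p s) (z s))%:R * tnth (z s).2 i | i < d]
  else [tuple T%:R * tnth b i | i < d].

Definition total_reward (T : nat) b (p : nat -> d.-tuple R) z : R :=
  \sum_(t < T) (z t).1 * (accept t (remaining T b p z t) (p t) (z t))%:R.

End Path.
Arguments accept {R d} K t rem p zt.
Arguments remaining {R d} K T b p z t.
Arguments total_reward {R d} K T b p z.

Section Run.
Context {R : realType} {d K : nat}.
Context {disp : measure_display} {Om : measurableType disp}.
Implicit Types (Pr : probability Om R) (F : nat -> set (set Om)).

Definition filtration F : Prop :=
  [/\ forall t, sigma_algebra setT (F t),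
      forall t, F t `<=` measurable &
      forall t, F t `<=` F t.+1].

(* The algorithm with parameters eps, delta, alpha over T rounds, on the
   problem (D, T b).  F t is the information at the start of round t.  It
   contains the past configurations and observations, and may be larger, so
   that any (possibly randomized) rule for selecting a saddle point is allowed.
   For t < K the values of w t and p t are irrelevant. *)
Record sp_ucb_olp (c_g c_0 Rmax Amax : R) (b : d.-tuple R)
    (D : 'I_K -> probability (pair_type R d) R) (T : nat)
    (eps delta alpha : R) Pr F
    (theta : nat -> Om -> 'I_K) (z : nat -> Om -> pair_type R d)
    (w : nat -> Om -> 'I_K -> R) (p : nat -> Om -> d.-tuple R) : Prop := {
  run_filtration : filtration F ;
  run_theta_adapted : forall t, (t < T)%N -> forall k,
    F t.+1 (theta t @^-1` [set k]) ;
  run_z_adapted : forall t, (t < T)%N -> forall A, measurable A ->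
    F t.+1 (z t @^-1` A) ;
  run_w_predictable : forall t, (K <= t < T)%N -> forall k (A : set R),
    measurable A -> F t ((fun om => w t om k) @^-1` A) ;
  run_p_predictable : forall t, (K <= t < T)%N ->
    forall A, measurable A -> F t (p t @^-1` A) ;
  run_explore : forall t, (t < T)%N -> (t < K)%N -> forall om,
    theta t om = t :> nat ;
  run_saddle : forall t, (K <= t < T)%N -> forall om,
    saddle_point
      (saddle_objective c_g c_0 Rmax Amax b T eps delta alpha
         (theta ^~ om) (z ^~ om) t) (w t om) (p t om) ;
  (* given F t, theta_t is distributed according to w_t *)
  run_draw : forall t, (K <= t < T)%N -> forall E k, F t E ->
    Pr (E `&` theta t @^-1` [set k]) = (\int[Pr]_(om in E) (w t om k)%:E)%E ;
  (* given F t and theta_t = k, the pair z_t is distributed according to D k *)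
  run_observe : forall t, (t < T)%N -> forall E k A, F t E -> measurable A ->
    Pr (E `&` theta t @^-1` [set k] `&` z t @^-1` A) =
    (Pr (E `&` theta t @^-1` [set k]) * D k A)%E }.

(* With probability at least 1 - delta, simultaneously for all configurations
   and all rounds, sup_{p in [0, Pmax]^d} |g(p) - ghat_t(p)| <= beta(t). *)
Definition ucb_concentration (c_g c_0 Rmax Amax : R) (b : d.-tuple R)
    (D : 'I_K -> probability (pair_type R d) R) (T : nat) (delta alpha : R) Pr
    (theta : nat -> Om -> 'I_K) (z : nat -> Om -> pair_type R d) : Prop :=
  exists E : set Om,
    [/\ measurable E, ((1 - delta)%:E <= Pr E)%E &
        forall om, E om -> forall t k, (t < T)%N ->
        forall p : d.-tuple R, (forall i, 0 <= tnth p i <= Pmax Rmax b) ->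
          `|g D k p - ghat (theta ^~ om) (z ^~ om) t k p|
            <= beta c_g c_0 Rmax Amax b T delta alpha (theta ^~ om) t k].

Definition mix_regret (b : d.-tuple R)
    (D : 'I_K -> probability (pair_type R d) R) (T : nat) Pr
    (z : nat -> Om -> pair_type R d) (p : nat -> Om -> d.-tuple R) : R :=
  T%:R * Vmix D b
  - expect Pr (fun om => total_reward K T b (p ^~ om) (z ^~ om)).

End Run.

(* Main.v *)
(* The saddle point only controls the empirical laws, so the main issue is to
   pass to the true laws uniformly over prices.  Concentration of the surplus
   [g_k] does not suffice: the budget is governed by its gradient, the expected
   consumption [E_k[a 1(r > <p, a>)]].  Since [{(r, a) | r > <p, a>}] is a
   half-space, all prices are described up to measure [1/T] under [D k] by
   [T^q] prices, with [q] depending only on [d], and an exponential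
   supermartingale with a union bound gives deviations
   [O(sqrt (ln T / N_k))] uniformly over prices.  The net replaces [r > <p, a>]
   by [r >= <p, a>] at no cost because ties have probability zero.

   First-order optimality of [p_t] for the empirical problem bounds the
   empirical consumption by the safe budget and gives complementary slackness;
   together with weak duality, the mean reward of a round is at least
   [(1 - eps) V] and its mean consumption at most [b], up to a multiple of
   [W_t = sum_k w_{t,k} / sqrt N_k(t)].  As [theta_t] is drawn from [w_t], the
   expectation of [sum_t W_t] is that of [sum_t 1 / sqrt N_{theta_t}(t)], which
   is at most [3 sqrt (K T)].

   Call a round alive if every remaining budget is at least [Amax].  While the
   run is alive nothing is rejected for lack of budget, and the number of later
   rounds is bounded by [sum_t W_t] and by a martingale whose second moment is
   at most [Amax^2 T].

   Pairs are bounded only almost surely; they are therefore replaced by their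
   clipped versions, which changes neither the laws nor, almost surely, the
   run. *)

(* The price net may not rely on any regularity of the laws. It comes from cutting price space by
   the random hyperplanes [r = <p, a>], by induction on the number of coordinates: over a cell of
   the first coordinates the hyperplanes are graphs of roots in the last one, and the order of two
   roots is the sign of an affine form attached to a pair of samples. The induction hypothesis is
   thus needed for a product law and for new affine forms, so the cutting is stated for arbitrary
   ones.

   Saddle points range over all [p >= 0], while the confidence bound covers only [[0, Pmax]^d]. The
   two meet when [eps <= 1/2]: a saddle price costs at most [Rmax] against the safe budget, so no
   coordinate exceeds [2 * Rmax / bmin b]. If [eps > 1/2], the trivial bound [T * Rmax] is already
   of order [sqrt (T ln T)].

   The event on which all estimates hold depends on the whole path, and conditioning on it would
   destroy the martingale structure. Rewards and consumption are therefore compared with their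
   conditional means on the whole space, and the event enters only pathwise. *)
From HB Require Import structures.
Require Import Defs.
From mathcomp Require Import all_boot all_order all_algebra.
From mathcomp Require Import all_classical all_reals all_analysis.
From mathcomp Require Import measurable_realfun ring lra zify.

Set Implicit Arguments.
Unset Strict Implicit.
Unset Printing Implicit Defensive.

Import Order.TTheory GRing.Theory Num.Theory.
Import numFieldNormedType.Exports.

Local Open Scope classical_set_scope.
Local Open Scope ring_scope.

(** * Bounded random variables *)

Section BoundedMeasurable.
Context {disp : measure_display} {T : measurableType disp} {R : realType}.
Implicit Types (f h : T -> R).

(** Such functions are integrable under every probability, so [expect], the finite part of an
    integral, is linear and monotone on them without side conditions. *)
Definition bdm f := measurable_fun setT f /\ exists M : R, forall x, `|f x| <= M.

Lemma bdm_cst (c : R) : bdm (fun=> c).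
Proof. by split => //; exists `|c|. Qed.

Lemma bdmD f h : bdm f -> bdm h -> bdm (fun x => f x + h x).
Proof.
move=> [mf [M fM]] [mh [N hN]]; split; first exact: measurable_funD.
by exists (M + N) => x; rewrite (le_trans (ler_normD _ _))// lerD.
Qed.

Lemma bdmM f h : bdm f -> bdm h -> bdm (fun x => f x * h x).
Proof.
move=> [mf [M fM]] [mh [N hN]]; split; first exact: measurable_funM.
by exists (M * N) => x; rewrite normrM ler_pM.
Qed.

Lemma bdmZ (c : R) f : bdm f -> bdm (fun x => c * f x).
Proof. by move=> bf; apply: bdmM => //; exact: bdm_cst. Qed.

Lemma bdmN f : bdm f -> bdm (fun x => - f x).
Proof.
move=> bf; have -> : (fun x => - f x) = (fun x => -1 * f x).
  by apply/funext => x; rewrite mulN1r.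
exact: bdmZ.
Qed.

Lemma bdmB f h : bdm f -> bdm h -> bdm (fun x => f x - h x).
Proof. by move=> bf bh; apply: bdmD => //; exact: bdmN. Qed.

Lemma bdm_sum (I : Type) (r : seq I) (P : pred I) (F : I -> T -> R) :
  (forall i, P i -> bdm (F i)) -> bdm (fun x => \sum_(i <- r | P i) F i x).
Proof.
move=> bF; elim: r => [|i r IH].
  have -> : (fun x => \sum_(i <- [::] | P i) F i x) = (fun=> 0).
    by apply/funext => x; rewrite big_nil.
  exact: bdm_cst.
have -> : (fun x => \sum_(i <- i :: r | P i) F i x) =
    (fun x => if P i then F i x + \sum_(i <- r | P i) F i x
              else \sum_(i <- r | P i) F i x).
  by apply/funext => x; rewrite big_cons.
by case: (boolP (P i)) => // Pi; apply: bdmD => //; exact: bF.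
Qed.

Lemma bdm_bool (c : T -> bool) : measurable_fun setT c ->
  bdm (fun x => (c x)%:R).
Proof.
move=> mc; split.
  rewrite [X in measurable_fun _ X](_ : _ = fun x => if c x then 1 else 0).
    by apply: measurable_fun_ifT.
  by apply/funext => x; case: (c x).
by exists 1 => x; case: (c x); rewrite ?normr1 ?normr0.
Qed.

Lemma bdm_indic (A : set T) : measurable A -> bdm (\1_A).
Proof.
move=> mA; split; first exact: measurable_indic.
by exists 1 => x; rewrite indicE; case: (_ \in _); rewrite ?normr1 ?normr0.
Qed.

Lemma bdmX n f : bdm f -> bdm (fun x => f x ^+ n).
Proof.
move=> bf; elim: n => [|n IH]; first by under eq_fun do rewrite expr0; exact: bdm_cst.
by under eq_fun do rewrite exprS; exact: bdmM.
Qed.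

Lemma bdm_norm f : bdm f -> bdm (fun x => `|f x|).
Proof.
move=> [mf [M fM]]; split; first exact: measurableT_comp.
by exists M => x; rewrite normr_id.
Qed.

Context (P : probability T R).

Lemma expectE f : expect P f = fine (\int[P]_x (f x)%:E)%E.
Proof. by rewrite /expect unlock. Qed.

Lemma expect_Rintegral f : expect P f = Rintegral P setT f.
Proof. exact: expectE. Qed.

Lemma bdm_integrable f : bdm f -> P.-integrable setT (EFin \o f).
Proof.
move=> [mf [M fM]]; apply: measurable_bounded_integrable => //.
  by rewrite (le_lt_trans (probability_le1 P measurableT)) ?ltry.
by exists M; split=> [|x Mx y _ /=]; rewrite ?num_real// (le_trans (fM y))// ltW.
Qed.

Lemma EFin_expect f : bdm f -> (expect P f)%:E = (\int[P]_x (f x)%:E)%E.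
Proof.
by move=> /bdm_integrable bf; rewrite expectE fineK//; exact: integrable_fin_num.
Qed.

Lemma eq_expect f h : f =1 h -> expect P f = expect P h.
Proof. by move=> /funext ->. Qed.

Lemma expectD f h : bdm f -> bdm h ->
  expect P (fun x => f x + h x) = expect P f + expect P h.
Proof.
by move=> bf bh; rewrite !expect_Rintegral RintegralD//; exact: bdm_integrable.
Qed.

Lemma expectZ (c : R) f : bdm f -> expect P (fun x => c * f x) = c * expect P f.
Proof.
by move=> bf; rewrite !expect_Rintegral RintegralZl//; exact: bdm_integrable.
Qed.

Lemma expectN f : bdm f -> expect P (fun x => - f x) = - expect P f.
Proof.
move=> bf; rewrite -mulN1r -expectZ//.
by apply: eq_expect => x; rewrite mulN1r.
Qed.

Lemma expectB f h : bdm f -> bdm h ->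
  expect P (fun x => f x - h x) = expect P f - expect P h.
Proof. by move=> bf bh; rewrite expectD ?expectN//; exact: bdmN. Qed.

Lemma expect_cst (c : R) : expect P (fun=> c) = c.
Proof. by rewrite /expect expectation_cst. Qed.

Lemma expect_sum (I : Type) (r : seq I) (Q : pred I) (F : I -> T -> R) :
  (forall i, Q i -> bdm (F i)) ->
  expect P (fun x => \sum_(i <- r | Q i) F i x) = \sum_(i <- r | Q i) expect P (F i).
Proof.
move=> bF; elim: r => [|i r IH].
  by under eq_fun do rewrite big_nil; rewrite expect_cst big_nil.
under eq_fun do rewrite big_cons.
rewrite big_cons; case: ifPn => // Qi.
by rewrite expectD ?IH//; [exact: bF | exact: bdm_sum].
Qed.

Lemma expect_le f h : bdm f -> bdm h -> (forall x, f x <= h x) ->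
  expect P f <= expect P h.
Proof.
move=> bf bh fh; rewrite !expect_Rintegral.
by apply: le_Rintegral => // *; exact: bdm_integrable.
Qed.

Lemma expect_ge0 f : (forall x, 0 <= f x) -> 0 <= expect P f.
Proof.
by move=> f0; rewrite expectE fine_ge0// integral_ge0// => x _; rewrite lee_fin.
Qed.

Lemma expect_norm_le f (M : R) : bdm f -> (forall x, `|f x| <= M) ->
  `|expect P f| <= M.
Proof.
move=> bf fM; rewrite ler_norml -(expect_cst M) -expectN; last exact: bdm_cst.
apply/andP; split; apply: expect_le => //; try exact: bdm_cst;
  by [apply: bdmN; exact: bdm_cst | move=> x; have := fM x; rewrite ler_norml => /andP[]].
Qed.

Lemma expect_indic (A : set T) : measurable A -> expect P (\1_A) = fine (P A).
Proof. by move=> mA; rewrite /expect expectation_indic. Qed.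

Lemma expect_bool (c : T -> bool) : measurable_fun setT c ->
  expect P (fun x => (c x)%:R) = fine (P [set x | c x]).
Proof.
move=> mc; rewrite -expect_indic.
  by apply: eq_expect => x; rewrite indicE mem_setE.
by have := mc measurableT [set true] I; rewrite setTI.
Qed.

Lemma ae_eq_expect f h : measurable_fun setT f -> measurable_fun setT h ->
  {ae P, forall x, f x = h x} -> expect P f = expect P h.
Proof.
move=> mf mh fh; rewrite !expectE; congr fine.
apply: ae_eq_integral => //; try exact/measurable_EFinP.
by apply: filterS fh => x ->.
Qed.

(* Step functions with steps of height 1/n approximate a bounded function
   uniformly. *)
Lemma linear_form_eq0 (L : (T -> R) -> R) (C : R) :
  (forall f h, bdm f -> bdm h -> L (fun x => f x + h x) = L f + L h) ->
  (forall c f, bdm f -> L (fun x => c * f x) = c * L f) ->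
  (forall A, measurable A -> L (\1_A) = 0) ->
  (forall f (M : R), bdm f -> (forall x, `|f x| <= M) -> `|L f| <= C * M) ->
  forall f, bdm f -> L f = 0.
Proof.
move=> LD LZ L1 LC.
have Lpos f : bdm f -> (forall x, 0 <= f x) -> L f = 0.
  move=> bf f0; have [mf [M fM]] := bf.
  have Lsum (r : seq nat) (F : nat -> T -> R) : (forall i, bdm (F i)) ->
      L (fun x => \sum_(i <- r) F i x) = \sum_(i <- r) L (F i).
    move=> bF; elim: r => [|i r IH].
      have := LZ 0 _ (bdm_cst 0); rewrite !mul0r => L0; rewrite big_nil -[RHS]L0.
      by congr L; apply/funext => x; rewrite big_nil.
    rewrite big_cons -IH -LD//; last exact: bdm_sum.
    by congr L; apply/funext => x; rewrite big_cons.
  have C0 : 0 <= C.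
    by have := LC _ 1 (bdm_cst 0); rewrite mulr1 normr0 => /(_ (fun=> ler01)); apply: le_trans.
  have key n : `|L f| <= C / n.+1%:R.
    pose A i := [set x | i.+1%:R / n.+1%:R <= f x].
    have mA i : measurable (A i).
      have := @measurable_fun_ler _ _ _ setT (fun=> i.+1%:R / n.+1%:R) f (measurable_cst _) mf.
      by move=> /(_ measurableT [set true] I); rewrite setTI.
    pose N := Num.truncn (M * n.+1%:R).
    pose fn x : R := \sum_(0 <= i < N) n.+1%:R^-1 * \1_(A i) x.
    have bfn : bdm fn by apply: bdm_sum => i _; apply: bdmZ; exact: bdm_indic.
    have Lfn : L fn = 0.
      rewrite Lsum => [|i]; last by apply: bdmZ; exact: bdm_indic.
      by rewrite big1// => i _; rewrite LZ ?L1 ?mulr0//; exact: bdm_indic.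
    have -> : L f = L (fun x => f x - fn x).
      rewrite LD//; last exact: bdmN.
      rewrite (_ : (fun x => - fn x) = (fun x => -1 * fn x)) ?LZ ?Lfn ?mulr0 ?addr0//.
      by apply/funext => x; rewrite mulN1r.
    apply: LC => [|x]; first exact: bdmB.
    have n0 : (0 : R) < n.+1%:R by [].
    have M0 : 0 <= M * n.+1%:R by rewrite mulr_ge0// (le_trans _ (fM x)).
    have -> : fn x = n.+1%:R^-1 * (Num.truncn (f x * n.+1%:R))%:R.
      rewrite /fn -mulr_sumr; congr (_ * _).
      have tN : (Num.truncn (f x * n.+1%:R) <= N)%N.
        apply: le_truncn; rewrite ler_pM2r//.
        by rewrite (le_trans _ (fM x))// ler_norm.
      rewrite (big_cat_nat _ tN)//= [X in _ + X]big1_seq ?addr0.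
        rewrite (eq_big_nat _ _ (F2 := fun=> 1)) ?sumr_const_nat ?subn0//.
        move=> i /andP[_ it]; rewrite indicE mem_set// /A/=.
        rewrite ler_pdivrMr// -truncn_ge_nat//; exact: mulr_ge0.
      move=> i /andP[_]; rewrite mem_index_iota => /andP[ti _].
      rewrite indicE memNset// /A/= ler_pdivrMr// -truncn_ge_nat ?mulr_ge0//.
      by apply/negP; rewrite -ltnNge ltnS.
    have /truncn_itv : 0 <= f x * n.+1%:R by exact: mulr_ge0.
    move=> /andP[t1 t2].
    move: t2; rewrite -[X in _ < X]natr1; move: n0 t1.
    set v := n.+1%:R; set k := _%:R => n0 t1 t2.
    have -> : f x - v^-1 * k = (f x * v - k) / v by field; rewrite gt_eqF.
    rewrite ger0_norm; last by rewrite divr_ge0 ?subr_ge0// ltW.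
    by rewrite ler_pdivrMr// mulVf ?gt_eqF//; lra.
  apply/normr0_eq0/le_anti; rewrite normr_ge0 andbT.
  apply/ler_addgt0Pl => e e0; rewrite addr0.
  have Ce : 0 <= C / e by rewrite divr_ge0// ltW.
  apply: (le_trans (key (Num.truncn (C / e)))).
  rewrite ler_pdivrMr// mulrC -ler_pdivrMr//.
  by apply: ltW; have /truncn_itv/andP[] := Ce.
move=> f bf; have [mf [M fM]] := bf.
have := Lpos (fun x => f x + M) (bdmD bf (bdm_cst _)).
rewrite LD//; last exact: bdm_cst.
have M0 : forall x, 0 <= f x + M.
  by move=> x; have := fM x; rewrite ler_norml => /andP[]; lra.
move=> /(_ M0).
have -> : L (fun=> M) = 0.
  have := LZ M _ (bdm_indic measurableT); rewrite L1// mulr0 => <-.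
  by congr L; apply/funext => x; rewrite indicT mulr1.
by rewrite addr0.
Qed.

End BoundedMeasurable.

(** * Conditioning on the past *)

Section FinitePushforward.
Context {d1 d2 : measure_display} {T1 : measurableType d1}
  {T2 : measurableType d2} {R : realType}.
Variables (mu : {finite_measure set T1 -> \bar R}) (f : T1 -> T2).

(** The measurability proof is an argument so that the structure of a finite measure can be attached
    to this name; product measures require it. *)
Definition fpushforward of measurable_fun setT f := pushforward mu f.

Hypothesis mf : measurable_fun setT f.

Local Notation map := (fpushforward mf).

Let mpre A : measurable A -> measurable (f @^-1` A).
Proof. by move=> mA; rewrite -[X in measurable X]setTI; exact: mf. Qed.

Let map0 : map set0 = 0%E.
Proof. by rewrite /fpushforward /pushforward preimage_set0 measure0. Qed.

Let map_ge0 A : (0 <= map A)%E.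
Proof. by rewrite /fpushforward /pushforward; exact: measure_ge0. Qed.

Let map_sigma_additive : semi_sigma_additive map.
Proof.
move=> F mF tF mUF; rewrite /fpushforward /pushforward preimage_bigcup.
apply: measure_semi_sigma_additive.
- by move=> n; exact: mpre.
- apply/trivIsetP => /= i j _ _ ij; rewrite -preimage_setI.
  by move/trivIsetP : tF => /(_ _ _ _ _ ij) ->//; rewrite preimage_set0.
- by rewrite -preimage_bigcup; exact: mpre.
Qed.

HB.instance Definition _ := isMeasure.Build _ _ _ map
  map0 map_ge0 map_sigma_additive.

Let map_fin : fin_num_fun map.
Proof. by move=> A mA; exact/fin_num_measure/mpre. Qed.

HB.instance Definition _ := Measure_isFinite.Build _ _ _ map map_fin.

Lemma ge0_integral_fpushforward (h : T2 -> \bar R) :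
  measurable_fun setT h -> (forall y, 0 <= h y)%E ->
  (\int[map]_y h y = \int[mu]_x h (f x))%E.
Proof.
move=> mh h0; transitivity (\int[pushforward mu f]_y h y)%E; last first.
  by rewrite ge0_integral_pushforward.
by apply: eq_measure_integral.
Qed.

End FinitePushforward.

Lemma ge0_integral_mrestr {disp : measure_display} {T : measurableType disp}
    {R : realType} (mu : {measure set T -> \bar R}) (A : set T)
    (mA : measurable A) (h : T -> \bar R) :
  measurable_fun setT h -> (forall y, 0 <= h y)%E ->
  (\int[mrestr mu mA]_x h x = \int[mu]_(x in A) h x)%E.
Proof.
move=> mh h0; rewrite -(setUv A) ge0_integral_setU//; first last.
- by apply/disj_setPCl.
- by rewrite setUv.
- exact: measurableC.
rewrite [X in (_ + X)%E]null_set_integral ?adde0//; first last.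
- by rewrite /= /mrestr setICl measure0.
- exact: measurable_funS mh.
- exact: measurableC.
by apply: eq_measure_integral => B mB BA; rewrite /= /mrestr setIidl.
Qed.

Section Freezing.
Context {disp : measure_display} {Om : measurableType disp} {R : realType}.
Context (Pr : probability Om R) (G : set (set Om)).
Hypotheses (sG : sigma_algebra setT G) (Gm : G `<=` measurable).

(** [Om] equipped with the smaller sigma-algebra [G]. Being determined by the past becomes ordinary
    measurability out of this space, with all its closure properties. *)
Local Notation GT := (g_sigma_algebraType G).

Lemma measurable_GTE (A : set Om) : measurable (A : set GT) = G A.
Proof. by rewrite /measurable/= sigma_algebra_id. Qed.

Lemma measurable_fun_GT {d'} {U : measurableType d'} (f : Om -> U) :
  (forall A, measurable A -> G (f @^-1` A)) -> measurable_fun setT (f : GT -> U).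
Proof. by move=> fG _ A mA; rewrite setTI measurable_GTE; exact: fG. Qed.

Lemma measurable_fun_from_GT {d'} {U : measurableType d'} (f : Om -> U) :
  measurable_fun setT (f : GT -> U) -> measurable_fun setT f.
Proof.
move=> mf mT A mA; rewrite setTI; apply: Gm; rewrite -measurable_GTE.
by rewrite -[X in measurable X]setTI; exact: mf.
Qed.

Lemma bdm_from_GT (f : Om -> R) : @bdm _ GT R f -> bdm f.
Proof. by move=> [mf bf]; split => //; exact: measurable_fun_from_GT. Qed.

(** The difference of the two sides is a linear form in [Y]. It vanishes on indicators of events of
    [G] by hypothesis and is bounded by [1 + M] times the sup norm, so [linear_form_eq0] applies. *)
Lemma draw_expect (A : set Om) (w : Om -> R) : measurable A ->
  @bdm _ GT R w -> (forall om, 0 <= w om) ->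
  (forall E, G E -> Pr (E `&` A) = (\int[Pr]_(om in E) (w om)%:E)%E) ->
  forall Y : Om -> R, @bdm _ GT R Y ->
  expect Pr (fun om => \1_A om * Y om) = expect Pr (fun om => w om * Y om).
Proof.
move=> mA bw w0 AE; have bw' := bdm_from_GT bw; have bA := @bdm_indic _ _ R _ mA.
have [_ [M wM]] := bw.
pose L (Y : GT -> R) := expect Pr (fun om => \1_A om * Y om) -
  expect Pr (fun om => w om * Y om).
have bM (Y : Om -> R) : @bdm _ GT R Y -> bdm (fun om => \1_A om * Y om).
  by move=> /bdm_from_GT; exact: bdmM.
have bwM (Y : Om -> R) : @bdm _ GT R Y -> bdm (fun om => w om * Y om).
  by move=> /bdm_from_GT; exact: bdmM.
suff L0 : forall Y, bdm Y -> L Y = 0.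
  by move=> Y bY; apply/eqP; rewrite -subr_eq0; apply/eqP; exact: L0.
apply: (@linear_form_eq0 _ GT R L (1 + M)).
- move=> f h bf bh; rewrite /L.
  under eq_expect do rewrite mulrDr.
  under [X in _ - X]eq_expect do rewrite mulrDr.
  rewrite !expectD; [ring|exact: bwM|exact: bwM|exact: bM|exact: bM].
- move=> c f bf; rewrite /L.
  under eq_expect do rewrite mulrCA.
  under [X in _ - X]eq_expect do rewrite mulrCA.
  rewrite !expectZ; [ring|exact: bwM|exact: bM].
- move=> E; rewrite measurable_GTE => GE; rewrite /L.
  have -> : expect Pr (fun om => \1_A om * \1_E om) = fine (Pr (E `&` A)).
    rewrite -expect_indic; last by apply: measurableI => //; exact: Gm.
    by apply: eq_expect => om; rewrite indicI mulrC.
  rewrite AE// expectE integral_mkcond; apply/eqP; rewrite subr_eq0; apply/eqP.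
  congr fine; apply: eq_integral => om _; rewrite patchE indicE.
  by case: ifPn => _; rewrite ?mulr1 ?mulr0.
- move=> f N bf fN; rewrite /L.
  have ? := bM _ bf; have ? := bwM _ bf.
  rewrite -expectB//; apply: expect_norm_le => [|om]; first exact: bdmB.
  rewrite -mulrBl normrM; apply: ler_pM => //.
  rewrite (le_trans (ler_normB _ _))// lerD//.
  by rewrite indicE; case: (_ \in _); rewrite ?normr1 ?normr0.
Qed.

Context {dU : measure_display} {U : measurableType dU} (D : probability U R).

Lemma bdm_section (h : GT * U -> R) (om : GT) : bdm h -> bdm (fun u => h (om, u)).
Proof.
move=> [mh [M hM]]; split; last by exists M.
by apply: measurableT_comp => //; exact: measurable_pair1.
Qed.

Lemma bdm_expect_section (h : GT * U -> R) : bdm h ->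
  bdm (fun om : GT => expect D (fun u => h (om, u))).
Proof.
move=> bh; have [mh [M hM]] := bh; split; last first.
  by exists M => om; apply: expect_norm_le => //; exact: bdm_section.
pose hp x := h x + M.
have bhp : bdm hp by apply: bdmD => //; exact: bdm_cst.
have hp0 x : 0 <= hp x by have := hM x; rewrite ler_norml /hp => /andP[]; lra.
have -> : (fun om : GT => expect D (fun u => h (om, u))) =
    (fun om => fine (fubini_F D (EFin \o hp) om) - M).
  apply/funext => om.
  rewrite -/(expect _ _) /fubini_F/= -expectE expectD ?expect_cst ?addrK//.
    exact: bdm_section.
  exact: bdm_cst.
apply: measurable_funB => //; apply: measurableT_comp => //.
by apply: measurable_fun_fubini_tonelli_F => //; apply/measurable_EFinP; case: bhp.
Qed.

(** On [A] the variable [z] is independent of [G] with law [D]. The image of [Pr] restricted to [A]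
    under [om |-> (om, z om)], on [GT * U], agrees with a product measure on rectangles, hence
    everywhere, and Fubini integrates [z] out with the past frozen. Adding a constant to [h] reduces
    to nonnegative functions. *)
Lemma freeze_expect (A : set Om) (z : Om -> U) : measurable A ->
  measurable_fun setT z ->
  (forall E B, G E -> measurable B ->
     Pr (E `&` A `&` z @^-1` B) = (Pr (E `&` A) * D B)%E) ->
  forall h : GT * U -> R, bdm h ->
  expect Pr (fun om => \1_A om * h (om, z om)) =
  expect Pr (fun om => \1_A om * expect D (fun u => h (om, u))).
Proof.
move=> mA mz ind h bh.
have mid : measurable_fun setT (id : Om -> GT).
  by move=> _ B; rewrite setTI measurable_GTE; exact: Gm.
have mpr : @measurable_fun _ _ Om (GT * U)%type setT (fun om => (om, z om)).
  exact: (measurable_fun_pair mid mz).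
pose m1 := fpushforward (mrestr Pr mA) mid.
pose m2 := fpushforward (mrestr Pr mA) mpr.
have prodE X : measurable X -> (m1 \x D)%E X = m2 X.
  apply: product_measure_unique => E B mE mB.
  rewrite /m2 /m1 /fpushforward /pushforward /mrestr/=.
  have GE : G E by rewrite -measurable_GTE.
  rewrite preimage_id -ind//; congr (Pr _).
  by apply/seteqP; split => om /=; tauto.
have pos (k : GT * U -> R) : bdm k -> (forall x, 0 <= k x) ->
  expect Pr (fun om => \1_A om * k (om, z om)) =
  expect Pr (fun om => \1_A om * expect D (fun u => k (om, u))).
  move=> bk k0; have [mk _] := bk.
  have mk' : measurable_fun setT (EFin \o k) by exact/measurable_EFinP.
  have k0' x : (0 <= (EFin \o k) x)%E by rewrite lee_fin.
  rewrite !expectE; congr fine.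
  transitivity (\int[m2]_x (k x)%:E)%E.
    rewrite ge0_integral_fpushforward// ge0_integral_mrestr//; first last.
    - by move=> y; rewrite lee_fin.
    - exact: (measurableT_comp mk' mpr).
    rewrite [RHS]integral_mkcond; apply: eq_integral => om _.
    by rewrite patchE indicE; case: ifPn => _; rewrite ?mul1r ?mul0r.
  transitivity (\int[(m1 \x D)%E]_x (k x)%:E)%E.
    by apply: eq_measure_integral => X mX _; apply/esym/prodE.
  rewrite fubini_tonelli1// ge0_integral_fpushforward//; first last.
  - by move=> y; apply: integral_ge0 => u _; rewrite lee_fin.
  - exact: measurable_fun_fubini_tonelli_F.
  have bek := bdm_from_GT (bdm_expect_section bk).
  transitivity (\int[mrestr Pr mA]_x (expect D (fun u => k (x, u)))%:E)%E.
    apply: eq_integral => om _; rewrite EFin_expect//.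
    exact: (bdm_section om bk).
  rewrite ge0_integral_mrestr//; first last.
  - by move=> om; rewrite lee_fin expect_ge0.
  - by apply/measurable_EFinP; case: bek.
  rewrite integral_mkcond; apply: eq_integral => om _.
  by rewrite patchE indicE; case: ifPn => _; rewrite ?mul1r ?mul0r.
have [_ [M hM]] := bh.
have bA := @bdm_indic _ _ R _ mA.
have hp0 x : 0 <= h x + M by have := hM x; rewrite ler_norml => /andP[]; lra.
have := pos (fun x => h x + M) (bdmD bh (bdm_cst _)) hp0.
have bhz : bdm (fun om => h (om, z om)).
  case: bh => mh [N hN]; split; last by exists N.
  exact: (measurableT_comp mh mpr).
under eq_expect do rewrite mulrDr.
under [X in _ = X -> _]eq_expect => om.
  rewrite expectD; [|exact: (bdm_section (om : GT) bh)|exact: bdm_cst].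
  rewrite expect_cst mulrDr; over.
rewrite !expectD; first by move/addIr.
- by apply: bdmM => //; exact: bdm_from_GT (bdm_expect_section bh).
- by apply: bdmM => //; exact: bdm_cst.
- exact: bdmM.
- by apply: bdmM => //; exact: bdm_cst.
Qed.

End Freezing.

(** * Quantiles *)

Lemma measurable_setr {disp : measure_display} {T : measurableType disp}
    {c : T -> bool} : measurable_fun setT c -> measurable [set x | c x].
Proof. by move=> mc; have := mc measurableT [set true] I; rewrite setTI. Qed.

Lemma measurable_invr {R : realType} {disp : measure_display}
    {T : measurableType disp} (f : T -> R) :
  measurable_fun setT f -> measurable_fun setT (fun x => (f x)^-1).
Proof.
move=> mf.
(* On each sign the inverse is an exponential of a logarithm; the convention [0^-1 = 0] covers the
   remaining points. *)
have -> : (fun x => (f x)^-1) = (fun x => if 0 < f x then expR (- ln (f x))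
    else if f x < 0 then - expR (- ln (- f x)) else 0).
  apply/funext => x; case: ltgtP => [fx|fx|<-]; last by rewrite invr0.
  - by rewrite expRN lnK.
  - by rewrite expRN lnK ?posrE ?oppr_gt0// invrN opprK.
have mNf : measurable_fun setT (fun x => - f x) by exact: measurable_funN.
have mexp (h : T -> R) : measurable_fun setT h ->
    measurable_fun setT (fun x => expR (- ln (h x))).
  move=> mh; apply: (measurableT_comp (@measurable_expR R)).
  by apply: measurable_funN; exact: (measurableT_comp (@measurable_ln R)).
apply: measurable_fun_ifT; [exact: measurable_fun_ltr|exact: mexp|].
apply: measurable_fun_ifT; [exact: measurable_fun_ltr| |exact: measurable_cst].
by apply: measurable_funN; exact: mexp.
Qed.

Section Quantiles.
Context {disp : measure_display} {Z : measurableType disp} {R : realType}.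
Implicit Types (mu : {finite_measure set Z -> \bar R}) (y : Z -> R).

(** If [A] has a greatest element, one interval covers it. Otherwise [A] is exhausted by an
    increasing sequence [t n], each term lying below some point of [A], and the bound passes to the
    union by continuity from below. *)
Lemma measure_below_sup mu y (A : set R) (u delta : R) :
  measurable_fun setT y -> measurable (y @^-1` A) ->
  (forall x, A x -> u < x) ->
  (forall x, A x -> (mu [set z | (u < y z <= x)%R] <= delta%:E)%E) ->
  (0 <= delta) -> (mu (y @^-1` A) <= delta%:E)%E.
Proof.
move=> my mA uA Adelta delta0.
have mint (a b : R) : measurable [set z | a < y z <= b].
  apply: measurable_setr; apply: measurable_and.
    exact: measurable_fun_ltr.
  exact: measurable_fun_ler.
have [[x [Ax xmax]]|nomax] := pselect (exists x, A x /\ forall x', A x' -> x' <= x).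
  apply: le_trans (Adelta _ Ax); apply: le_measure; rewrite ?inE// => z /= Az.
  by rewrite uA// xmax.
have [->|/set0P[z0 Az0]] := eqVneq (y @^-1` A) set0.
  by rewrite measure0 lee_fin.
have [t [t_nd tA At]] : exists t : nat -> R, [/\ {homo t : n m / (n <= m)%N >-> n <= m},
    forall n, exists2 x, A x & t n <= x & forall x, A x -> exists n, x <= t n].
  have [ubA|nubA] := pselect (has_ubound A).
    exists (fun n => sup A - n.+1%:R^-1); split.
    - by move=> n m nm; rewrite lerB// lef_pV2 ?posrE// ler_nat.
    - move=> n; have hs : has_sup A by split => //; exists (y z0).
      have n0 : 0 < n.+1%:R^-1 :> R by rewrite invr_gt0.
      have [x Ax xs] := sup_adherent n0 hs.
      by exists x => //; exact: ltW.
    - move=> x Ax; have xs : x < sup A.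
        rewrite lt_neqAle ub_le_sup// andbT; apply/eqP => xs.
        by apply: nomax; exists x; split => // x' Ax'; rewrite xs ub_le_sup.
      pose e := sup A - x.
      exists (Num.truncn e^-1); rewrite lerBrDl -lerBrDr -/e.
      have e0 : 0 < e by rewrite subr_gt0.
      rewrite -[leRHS]invrK lef_pV2 ?posrE ?invr_gt0//.
      by apply: ltW; have /truncn_itv/andP[] : 0 <= e^-1 by rewrite invr_ge0 ltW.
  exists (fun n => n%:R); split.
  - by move=> n m; rewrite ler_nat.
  - by move=> n; have /has_ubPn/(_ n%:R)[x Ax /ltW ?] := nubA; exists x.
  - move=> x Ax; exists (Num.truncn `|x|).+1.
    rewrite (le_trans (ler_norm x))//.
    by apply: ltW; have /truncn_itv/andP[] := normr_ge0 x.
pose E n := [set z | u < y z <= t n].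
have mE n : measurable (E n) by exact: mint.
have cvE := @nondecreasing_cvg_mu _ _ _ mu E mE (bigcupT_measurable _ mE).
have /cvE cvE' : nondecreasing_seq E.
  move=> n m nm; apply/subsetPset => z /= /andP[uz zt]; apply/andP; split => //.
  by rewrite (le_trans zt)// t_nd.
apply: (@le_trans _ _ (mu (\bigcup_n E n))).
  apply: le_measure; rewrite ?inE//; first exact: bigcupT_measurable.
  move=> z /= Az; have [n zn] := At _ Az; exists n => //=.
  by rewrite /E/= zn andbT uA.
rewrite -(cvg_lim _ cvE')//; apply: lime_le; first by apply/cvg_ex; eexists; exact: cvE'.
apply: nearW => n /=; have [x Ax tx] := tA n; apply: le_trans (Adelta _ Ax).
apply: le_measure; rewrite ?inE// => z /= /andP[uz zt].
by rewrite uz (le_trans zt).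
Qed.

Lemma measure_above_inf mu y (A : set R) (u delta : R) :
  measurable_fun setT y -> measurable (y @^-1` A) ->
  (forall x, A x -> x < u) ->
  (forall x, A x -> (mu [set z | (x <= y z < u)%R] <= delta%:E)%E) ->
  (0 <= delta) -> (mu (y @^-1` A) <= delta%:E)%E.
Proof.
move=> my mA uA Adelta delta0.
have := @measure_below_sup mu (fun z => - y z) [set x | A (- x)] (- u) delta.
have -> : (fun z => - y z) @^-1` [set x | A (- x)] = y @^-1` A.
  by apply/seteqP; split => z /=; rewrite opprK.
apply => //; first exact: measurable_funN.
- by move=> x /= /uA; rewrite ltrNl.
- move=> x /= /Adelta; congr (mu _ <= _)%E; apply/seteqP; split => z /=.
    by move=> /andP[h1 h2]; rewrite ltrN2 h2/= lerNl.
  by move=> /andP[]; rewrite ltrN2 lerNl => -> ->.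
Qed.

(* The level of [x] counts the thresholds [j / M] passed at [x] by the
   distribution function of [y] and by its left limit; the net consists of one
   representative per level. *)
Lemma quantile_net mu y (B : set Z) (M : nat) (z0 : Z) :
  (0 < M)%N -> measurable_fun setT y -> measurable B -> (mu B <= 1)%E ->
  exists (J : {set 'I_(M.*2.+1)}) (s : 'I_(M.*2.+1) -> Z),
  (forall j, j \in J -> B (s j)) /\
  forall I : set R, is_interval I -> (forall j, j \in J -> ~ I (y (s j))) ->
  (mu (B `&` y @^-1` I) <= (2 / M%:R)%:E)%E.
Proof.
move=> M0 my mB muB1.
pose nu : {finite_measure set Z -> \bar R} := mrestr mu mB.
have nuE X : nu X = mu (X `&` B) by [].
have mle (x : R) : measurable [set z | y z <= x].
  by apply: measurable_setr; exact: measurable_fun_ler.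
have mlt (x : R) : measurable [set z | y z < x].
  by apply: measurable_setr; exact: measurable_fun_ltr.
have nu1 X : measurable X -> (nu X <= 1)%E.
  move=> mX; rewrite nuE (le_trans _ muB1)// le_measure ?inE//.
  exact: measurableI.
(* Both versions of the distribution function are needed because [y] may have atoms: [F] measures
   the half-open intervals to the right of a representative, [Fl] those to its left, and each
   excludes the representative itself. *)
pose F (x : R) := fine (nu [set z | y z <= x]).
pose Fl (x : R) := fine (nu [set z | y z < x]).
have fE X : measurable X -> (fine (nu X))%:E = nu X.
  by move=> mX; rewrite fineK// fin_num_measure.
have fine01 X : measurable X -> 0 <= fine (nu X) <= 1.
  by move=> mX; rewrite fine_ge0//= -lee_fin fE// nu1.
have Fnd (a b : R) : a <= b -> F a <= F b.
  by move=> ab; rewrite -lee_fin !fE// le_measure ?inE// => z /= /le_trans; exact.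
have Flnd (a b : R) : a <= b -> Fl a <= Fl b.
  by move=> ab; rewrite -lee_fin !fE// le_measure ?inE// => z /= /lt_le_trans; exact.
pose l1 x := Num.truncn (M%:R * F x).
pose l2 x := Num.truncn (M%:R * Fl x).
have M0' : (0 : R) < M%:R by rewrite ltr0n.
have l1nd a b : a <= b -> (l1 a <= l1 b)%N.
  by move=> ab; apply: le_truncn; rewrite ler_pM2l// Fnd.
have l2nd a b : a <= b -> (l2 a <= l2 b)%N.
  by move=> ab; apply: le_truncn; rewrite ler_pM2l// Flnd.
have tM (v : R) : 0 <= v <= 1 -> (Num.truncn (M%:R * v)%R <= M)%N.
  move=> /andP[v0 v1]; rewrite -ltnS truncn_lt_nat; last by rewrite mulr_ge0// ltW.
  by rewrite (@le_lt_trans _ _ M%:R) ?ltr_nat// ler_piMr// ltW.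
have lM x : (l1 x + l2 x < M.*2.+1)%N.
  by rewrite ltnS -addnn leq_add// tM// fine01.
have [l lE] : exists l : R -> 'I_(M.*2.+1), forall x, l x = (l1 x + l2 x)%N :> nat.
  by exists (fun x => Ordinal (lM x)).
have l_eq a b : a <= b -> l a = l b -> l1 a = l1 b /\ l2 a = l2 b.
  move=> ab /(congr1 val)/=; rewrite !lE => lab.
  by have := l1nd _ _ ab; have := l2nd _ _ ab; lia.
have lnd a b : a <= b -> (l a <= l b)%N by move=> ab; rewrite !lE leq_add ?l1nd ?l2nd.
have trunc_close (v w : R) : 0 <= v -> 0 <= w ->
    Num.truncn (M%:R * v) = Num.truncn (M%:R * w) -> w - v <= M%:R^-1.
  move=> v0 w0 vw.
  have /truncn_itv/andP[h1 h2] : 0 <= M%:R * v by rewrite mulr_ge0// ltW.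
  have /truncn_itv/andP[h3 h4] : 0 <= M%:R * w by rewrite mulr_ge0// ltW.
  rewrite -vw in h3 h4; rewrite -[leRHS]mul1r ler_pdivlMr// mulrBl.
  by move: h2 h4; rewrite -natr1; lra.
pose J := [set j | `[< exists2 z, B z & l (y z) = j >]]%SET.
have lJ z : B z -> l (y z) \in J by move=> Bz; rewrite inE; apply/asboolP; exists z.
have /choice[s sP] : forall j, exists z, j \in J -> B z /\ l (y z) = j.
  move=> j; have [|jJ] := boolP (j \in J); last by exists z0.
  by rewrite inE => /asboolP[z Bz zj]; exists z.
exists J, s; split; first by move=> j /sP[].
have ls j : j \in J -> l (y (s j)) = j by move=> /sP[].
move=> I Iconv IJ.
(* An interval missing the value of a representative lies entirely on one side of it. *)
have side j x : j \in J -> I x -> (forall x', I x' -> y (s j) < x') \/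
    (forall x', I x' -> x' < y (s j)).
  move=> jJ Ix; have nI := IJ _ jJ.
  case: (ltgtP (y (s j)) x) => sx; last by rewrite sx in nI.
    left => x' Ix'; rewrite ltNge; apply/negP => x's; apply: nI.
    by apply: (Iconv x' x) => //; rewrite x's ltW.
  right => x' Ix'; rewrite ltNge; apply/negP => x's; apply: nI.
  by apply: (Iconv x x') => //; rewrite x's ltW.
(* Points of [I] to the right of the representatives of their levels all share one level, since the
   representative of the larger level lies to the left of all of [I]; similarly on the left. Each
   side therefore carries mass at most [1 / M]. *)
pose A1 := [set x | I x /\ l x \in J /\ forall x', I x' -> y (s (l x)) < x'].
pose A2 := [set x | I x /\ l x \in J /\ forall x', I x' -> x' < y (s (l x))].
have mlev A : (forall x x', A x -> A x' -> l x = l x') ->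
    (forall x x', A x -> I x' -> l x = l x' -> A x') -> A `<=` I ->
    measurable (y @^-1` A).
  move=> A_eq A_sat AI; rewrite -[X in measurable X]setTI; apply: my => //.
  apply: is_interval_measurable => a c Aa Ac b /andP[ab bc].
  apply: (A_sat a) => //; first by apply: (Iconv a c); rewrite ?ab//; exact: AI.
  apply: val_inj; apply/eqP; rewrite eqn_leq lnd//=.
  by rewrite (A_eq a c)// lnd.
have A1_eq x x' : A1 x -> A1 x' -> l x = l x'.
  wlog : x x' / (l x <= l x')%N.
    by move=> H a1 a2; case/orP: (leq_total (l x) (l x')) => h; [|apply/esym]; exact: H.
  move=> lxx' [Ix [lx sx]] [Ix' [lx' sx']]; apply/val_inj/eqP; rewrite eqn_leq lxx'/=.
  by rewrite -[in leqLHS](ls _ lx') lnd// ltW// sx'.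
have A2_eq x x' : A2 x -> A2 x' -> l x = l x'.
  wlog : x x' / (l x <= l x')%N.
    by move=> H a1 a2; case/orP: (leq_total (l x) (l x')) => h; [|apply/esym]; exact: H.
  move=> lxx' [Ix [lx sx]] [Ix' [lx' sx']]; apply/val_inj/eqP; rewrite eqn_leq lxx'/=.
  by rewrite -[in leqRHS](ls _ lx) lnd// ltW// sx.
have mA1 : measurable (y @^-1` A1).
  apply: mlev => //; last by move=> x [].
  by move=> x x' [Ix [lx sx]] Ix' lxx'; split => //; rewrite -lxx'.
have mA2 : measurable (y @^-1` A2).
  apply: mlev => //; last by move=> x [].
  by move=> x x' [Ix [lx sx]] Ix' lxx'; split => //; rewrite -lxx'.
have M1_ge0 : (0 : R) <= M%:R^-1 by rewrite invr_ge0 ltW.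
have mI : measurable (y @^-1` I).
  by rewrite -[X in measurable X]setTI; apply: my => //; exact: is_interval_measurable.
have b1 : (nu (y @^-1` A1) <= (M%:R^-1)%:E)%E.
  have [->|/set0P[w A1w]] := eqVneq (y @^-1` A1) set0; first by rewrite measure0 lee_fin.
  have [_ [lw sw]] : A1 (y w) := A1w.
  apply: (@measure_below_sup nu y A1 (y (s (l (y w))))) => // [x [Ix _]|x A1x]; first exact: sw.
  have lxw : l x = l (y w) by exact: A1_eq.
  have sx : y (s (l (y w))) < x by apply: sw; case: A1x.
  have [eq1 _] : l1 (y (s (l (y w)))) = l1 x /\ l2 (y (s (l (y w)))) = l2 x.
    by apply: l_eq; [exact: ltW | rewrite ls].
  have := trunc_close _ _ _ _ eq1; rewrite !fine_ge0// => /(_ isT isT) Fx.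
  have -> : [set z | (y (s (l (y w))) < y z <= x)%R] =
      [set z | y z <= x] `\` [set z | y z <= y (s (l (y w)))].
    apply/seteqP; split => z /=.
      by move=> /andP[h ->]; split => //; apply/negP; rewrite -ltNge.
    by move=> [-> /negP]; rewrite -ltNge => ->.
  rewrite measureD// ?ltry//; last by rewrite (le_lt_trans (nu1 _ _))// ltry.
  rewrite setIidr; last by move=> z /= h; rewrite (le_trans h)// ltW.
  by move: Fx; rewrite -lee_fin EFinB /F /Fl !fE.
have b2 : (nu (y @^-1` A2) <= (M%:R^-1)%:E)%E.
  have [->|/set0P[w A2w]] := eqVneq (y @^-1` A2) set0; first by rewrite measure0 lee_fin.
  have [_ [lw sw]] : A2 (y w) := A2w.
  apply: (@measure_above_inf nu y A2 (y (s (l (y w))))) => // [x [Ix _]|x A2x]; first exact: sw.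
  have lxw : l x = l (y w) by exact: A2_eq.
  have sx : x < y (s (l (y w))) by apply: sw; case: A2x.
  have [_ eq2] : l1 x = l1 (y (s (l (y w)))) /\ l2 x = l2 (y (s (l (y w)))).
    by apply: l_eq; [exact: ltW | rewrite ls].
  have := trunc_close _ _ _ _ eq2; rewrite !fine_ge0// => /(_ isT isT) Fx.
  have -> : [set z | (x <= y z < y (s (l (y w))))%R] =
      [set z | y z < y (s (l (y w)))] `\` [set z | y z < x].
    apply/seteqP; split => z /=.
      by move=> /andP[h ->]; split => //; apply/negP; rewrite -leNgt.
    by move=> [-> /negP]; rewrite -leNgt => ->.
  rewrite measureD// ?ltry//; last by rewrite (le_lt_trans (nu1 _ _))// ltry.
  rewrite setIidr; last by move=> z /= h; rewrite (lt_trans h).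
  by move: Fx; rewrite -lee_fin EFinB /F /Fl !fE.
have -> : (2 / M%:R)%:E = ((M%:R^-1)%:E + (M%:R^-1)%:E)%E :> \bar R.
  by rewrite -EFinD; congr EFin; lra.
apply: le_trans (leeD b1 b2); apply: le_trans (measureU2 _ mA1 mA2).
have -> : mu (B `&` y @^-1` I) = nu (B `&` y @^-1` I).
  by rewrite nuE setIAC setIid.
apply: le_measure; rewrite ?inE//; [exact: measurableI|exact: measurableU|].
move=> z [Bz Iz]; have jJ := lJ _ Bz.
by have [h|h] := side _ _ jJ Iz; [left|right].
Qed.

End Quantiles.

(** * A polynomial-size cutting of price space *)

Section AffineFunctions.
Context {R : realType}.

(** Coefficients and arguments are sequences on [nat], so that lowering the dimension only drops the
    last term and no tuple has to be reindexed. *)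
Definition aff (d : nat) (c0 : R) (c : nat -> R) (p : nat -> R) : R :=
  c0 + \sum_(i < d) c i * p i.

Lemma aff_recr d c0 c p : aff d.+1 c0 c p = aff d c0 c p + c d * p d.
Proof. by rewrite /aff big_ord_recr addrA. Qed.

(** With [a] and [b] the last coefficients of two hyperplanes, this is the form in the remaining
    coordinates whose sign, up to the sign of [a * b], orders their roots in the last coordinate. *)
Lemma aff_comb d (a b c0 c0' : R) (c c' p : nat -> R) :
  aff d (a * c0' - b * c0) (fun i => a * c' i - b * c i) p =
  a * aff d c0' c' p - b * aff d c0 c p.
Proof.
rewrite /aff !mulrDr opprD !mulr_sumr addrACA; congr (_ + _).
by rewrite -sumrN -big_split/=; apply: eq_bigr => i _; ring.
Qed.

Lemma measurable_aff {disp : measure_display} {Z : measurableType disp} d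
    (c0 : Z -> R) (c : nat -> Z -> R) p :
  measurable_fun setT c0 -> (forall i, measurable_fun setT (c i)) ->
  measurable_fun setT (fun z => aff d (c0 z) (c ^~ z) p).
Proof.
move=> m0 mc; apply: measurable_funD => //; apply: measurable_sum => i.
exact: measurable_funM.
Qed.

Lemma finite_argmin (I : finType) (P : pred I) (F : I -> R) :
  (exists2 i, P i & forall j, P j -> F i <= F j) \/ (forall i, ~~ P i).
Proof.
case: (pickP P) => [i0 Pi0|P0]; [left|by right => i; rewrite P0].
by case: (Order.TotalTheory.arg_minP F Pi0) => i Pi Fi; exists i.
Qed.

End AffineFunctions.

Lemma leq_expr (a b q : nat) : (a <= b)%N -> (a ^ q <= b ^ q)%N.
Proof. by move=> ab; case: q => [|q]; rewrite ?expn0 ?leq_exp2r. Qed.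

(** [inl (l, l')] stands for the open slab between the graphs [l] and [l'], with [None] for an
    unbounded side, and [inr j] for the graph [j] itself. The graphs are indexed by a quantile net
    with [M = 16 * m]. *)
Definition slab_index (m : nat) : finType :=
  ((option 'I_((16 * m).*2.+1) * option 'I_((16 * m).*2.+1)) +
   'I_((16 * m).*2.+1))%type.

Lemma card_slab_index m : (2 <= m)%N -> (#|slab_index m| <= m ^ 15)%N.
Proof.
move=> m2; rewrite card_sum card_prod !card_option !card_ord.
have h7 : (64 * m <= m ^ 7)%N.
  by rewrite expnS mulnC leq_mul2l (leq_exp2r 2 m (isT : (0 < 6)%N)) m2 orbT.
have h : ((16 * m).*2.+2 <= m ^ 7)%N by apply: leq_trans h7; lia.
apply: (@leq_trans (m ^ 7 * m ^ 7 + m ^ 7 * m ^ 7)).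
  rewrite leq_add//; first exact: leq_mul.
  by rewrite -[leqLHS]muln1 leq_mul// ?expn_gt0 ?(leq_trans _ m2)// ltnW.
by rewrite addnn -mul2n -expnD (expnS m 14) leq_mul2r m2 orbT.
Qed.

Section Slab.
Context {R : realType} {disp : measure_display} {Z : measurableType disp}.
Context (D : probability Z R) (c0 : Z -> R) (c : nat -> Z -> R) (d m : nat).
Hypotheses (mc0 : measurable_fun setT c0)
  (mc : forall i, measurable_fun setT (c i)) (m_ge2 : (2 <= m)%N).
Context (C : set (nat -> R)) (G1 : set (Z * Z)) (G2 : set Z).
Hypotheses (mG1 : measurable G1) (mG2 : measurable G2).
Hypothesis G1_le : ((D \x D) G1 <= ((64 * m * m)%:R^-1)%:E)%E.
Hypothesis G2_le : (D G2 <= ((8 * m)%:R^-1)%:E)%E.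

Let A z p := aff d (c0 z) (c ^~ z) p.

Hypothesis G1P : forall z z' p p', ~ G1 (z, z') -> C p -> C p' ->
  Num.sg (c d z * A z' p - c d z' * A z p) =
  Num.sg (c d z * A z' p' - c d z' * A z p').
Hypothesis G2P : forall z p p', ~ G2 z -> C p -> C p' ->
  Num.sg (A z p) = Num.sg (A z p').

(* The slab over the cell [C] is cut along the graphs of a quantile net of the
   roots of the affine functions in the last coordinate.  By Fubini most [z]
   have a root whose order relative to most other roots is constant on [C];
   only such [z] enter the net. *)
Lemma slab_cutting (p0 : nat -> R) : C p0 ->
  exists (C' : slab_index m -> set (nat -> R)) (B : slab_index m -> set Z),
  [/\ forall p, C p -> exists k, C' k p,
      forall k, measurable (B k),
      forall k, (D (B k) <= (m%:R^-1)%:E)%E &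
      forall k z p p', ~ B k z -> C' k p -> C' k p' ->
        Num.sg (aff d.+1 (c0 z) (c ^~ z) p) =
        Num.sg (aff d.+1 (c0 z) (c ^~ z) p')].
Proof.
move=> Cp0.
have m0 : (0 : R) < m%:R by rewrite ltr0n (leq_trans _ m_ge2).
pose root p z : R := - A z p / c d z.
have mroot p : measurable_fun setT (root p).
  apply: measurable_funM; last exact: measurable_invr.
  by apply: measurable_funN; exact: measurable_aff.
pose y := root p0.
pose gf z := fine (D (xsection G1 z)).
have gfE z : D (xsection G1 z) = (gf z)%:E.
  by rewrite fineK// fin_num_measure//; exact: measurable_xsection.
have mgf : measurable_fun setT gf.
  by apply: measurableT_comp => //; exact: measurable_fun_xsection.
have gf01 z : 0 <= gf z <= 1.
  rewrite -!lee_fin -gfE measure_ge0/= probability_le1//.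
  exact: measurable_xsection.
have bgf : bdm gf.
  by split => //; exists 1 => z; rewrite ger0_norm; have /andP[] := gf01 z.
(* A slab has five exceptional sets, each of measure at most [a]: [G2], two sections of [G1], the
   complement of [Good], and the gap of the quantile net, of measure [2 / (16 m)]. Their union has
   measure at most [5 a <= 1 / m]. *)
pose a : R := (8 * m)%:R^-1.
have aE : a = 8^-1 / m%:R by rewrite /a natrM invfM.
have a0 : 0 < a by rewrite aE divr_gt0.
pose Good := [set z | gf z <= a].
have mGood : measurable Good by apply: measurable_setr; exact: measurable_fun_ler.
(* Markov's inequality for the measure of the sections of [G1], whose mean is the product measure of
   [G1], at most [a ^+ 2]. *)
have GoodC : (D (~` Good) <= a%:E)%E.
  have mb : measurable_fun setT (fun z => a < gf z) by exact: measurable_fun_ltr.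
  have : a * expect D (fun z => (a < gf z)%R%:R : R) <= expect D gf.
    rewrite -expectZ; last exact: bdm_bool.
    apply: expect_le => //; first by apply: bdmZ; exact: bdm_bool.
    move=> z; case: ltP; first by rewrite mulr1 => /ltW.
    by rewrite mulr0; have /andP[] := gf01 z.
  have -> : expect D gf = fine ((D \x D)%E G1).
    by rewrite expectE; congr fine; apply: eq_integral => z _ /=; rewrite -gfE.
  have G1r : fine ((D \x D)%E G1) <= (64 * m * m)%:R^-1.
    rewrite -lee_fin fineK// ge0_fin_numE; last exact: measure_ge0.
    by rewrite (le_lt_trans G1_le)// ltry.
  move=> /le_trans/(_ G1r); rewrite expect_bool// => h.
  rewrite -[X in (D X <= _)%E](_ : [set z | a < gf z] = ~` Good); last first.
    by apply/seteqP; split => z /=; rewrite ltNge => /negP.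
  rewrite -[X in (X <= _)%E]fineK; last by rewrite fin_num_measure//; exact: measurable_setr.
  rewrite lee_fin -(ler_pM2l a0) (le_trans h)// aE !natrM !invfM.
  by rewrite le_eqVlt; apply/orP; left; apply/eqP; field; rewrite gt_eqF.
(* Where the last coefficient vanishes the hyperplane has no root in the last coordinate; its sign
   is then controlled by [G2] alone. *)
pose Bg := Good `&` [set z | c d z != 0].
have mnz : measurable [set z | c d z != 0].
  apply: measurable_setr; apply: measurable_neg.
  by apply: measurable_fun_eqr => //.
have mBg : measurable Bg by exact: measurableI.
have M0 : (0 < 16 * m)%N by rewrite muln_gt0 (leq_trans _ m_ge2).
have [z0 _] : exists z0 : Z, True.
  apply: contrapT => nZ; have : D setT = 0%E.
    rewrite (_ : setT = set0) ?measure0//.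
    by apply/seteqP; split => // z _; apply: nZ; exists z.
  by rewrite probability_setT => /eqP; rewrite onee_eq0.
have [J [s [sB sgap]]] :=
  quantile_net z0 M0 (mroot p0) mBg (probability_le1 D mBg).
have sG j : j \in J -> (D (xsection G1 (s j)) <= a%:E)%E.
  by move=> /sB[]; rewrite /Good/= gfE lee_fin.
have snz j : j \in J -> c d (s j) != 0 by move=> /sB[].
have order z1 z2 p p' : c d z1 != 0 -> c d z2 != 0 -> ~ xsection G1 z1 z2 ->
    C p -> C p' ->
    Num.sg (root p z2 - root p z1) = Num.sg (root p' z2 - root p' z1).
  move=> n1 n2 nG Cp Cp'.
  have rE q : root q z2 - root q z1 =
      - (c d z1 * A z2 q - c d z2 * A z1 q) * (c d z1 * c d z2)^-1.
    by rewrite /root; field; rewrite n1 n2.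
  rewrite !rE !sgrM !sgrN (@G1P _ _ p p')//.
  by move=> G; apply: nG; rewrite /xsection/= inE.
have signE z p : c d z != 0 ->
    Num.sg (aff d.+1 (c0 z) (c ^~ z) p) = Num.sg (c d z) * Num.sg (p d - root p z).
  move=> nz; rewrite -sgrM aff_recr -/(A z p); congr Num.sg.
  by rewrite /root; field.
have sign0 z p : c d z = 0 -> aff d.+1 (c0 z) (c ^~ z) p = A z p.
  by move=> cz; rewrite aff_recr cz mul0r addr0.
pose N := (16 * m).*2.+1.
pose below p (l : option 'I_N) (x : R) :=
  if l is Some j then root p (s j) < x else true.
pose above p (l : option 'I_N) (x : R) :=
  if l is Some j then x < root p (s j) else true.
pose valid (l : option 'I_N) := if l is Some j then j \in J else true.
pose gap l l' := [set x | below p0 l x && above p0 l' x].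
pose ok l l' := [&& valid l, valid l' &
  [forall j in J, ~~ (below p0 l (y (s j)) && above p0 l' (y (s j)))]].
pose X (l : option 'I_N) := if l is Some j then xsection G1 (s j) else set0.
have mX l : measurable (X l) by case: l => [j|] //=; exact: measurable_xsection.
have X_le l : valid l -> (D (X l) <= a%:E)%E.
  by case: l => [j /sG//|_]; rewrite measure0 lee_fin ltW.
have gap_itv l l' : is_interval (gap l l').
  move=> x x' /andP[h1 h2] /andP[h3 h4] w /andP[xw wx']; apply/andP; split.
    by case: l h1 {h3} => //= j h1; exact: lt_le_trans xw.
  by case: l' h4 {h2} => //= j h4; exact: le_lt_trans h4.
have mgap l l' : measurable (y @^-1` gap l l').
  rewrite -[X in measurable X]setTI; apply: mroot => //.
  exact: is_interval_measurable.
pose C' (k : slab_index m) : set (nat -> R) := match k with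
  | inl (l, l') => [set p | C p /\ [&& ok l l', below p l (p d) & above p l' (p d)]]
  | inr j => [set p | C p /\ j \in J /\ p d = root p (s j)] end.
pose B (k : slab_index m) : set Z := match k with
  | inl (l, l') => if ok l l' then G2 `|` (X l `|` X l') `|` ~` Good
       `|` (Bg `&` y @^-1` gap l l') else set0
  | inr j => if j \in J then G2 `|` xsection G1 (s j) else set0 end.
have U2 (S T : set Z) (u v : R) : measurable S -> measurable T ->
    (D S <= u%:E)%E -> (D T <= v%:E)%E -> (D (S `|` T) <= (u + v)%:E)%E.
  move=> mS mT DS DT; rewrite EFinD.
  by apply: le_trans (leeD DS DT); exact: measureU2.
exists C', B; split.
- move=> p Cp.
  have [[j [jJ pj]]|noeq] := pselect (exists j, j \in J /\ p d = root p (s j)).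
    by exists (inr j).
  (* The order of the net roots among themselves may vary over the cell, so the neighbours are
     chosen by the order at [p0]: [l'] is least there among the graphs passing above [p], and [l] is
     greatest among those below [l'] at [p0]. By minimality of [l'] the graph [l] does pass below
     [p]. *)
  have [l' l'P] : exists l', [/\ valid l', above p l' (p d) &
      forall j, j \in J -> above p0 l' (y (s j)) -> root p (s j) < p d].
    have [[j /andP[jJ pj] jmin]|no] :=
        finite_argmin [pred j | (j \in J) && (p d < root p (s j))] (fun j => y (s j)).
      exists (Some j); split => // i iJ /= yi.
      case: (ltgtP (root p (s i)) (p d)) => // [pi|pi].
        have := jmin i; rewrite inE iJ pi => /(_ isT).
        by rewrite leNgt yi.
      by exfalso; apply: noeq; exists i.
    exists None; split => // i iJ _.
    case: (ltgtP (root p (s i)) (p d)) => // [pi|pi].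
      by have := no i; rewrite inE iJ pi.
    by exfalso; apply: noeq; exists i.
  have [vl' al' l'max] := l'P.
  have [l [vl bl lP]] : exists l, [/\ valid l, below p l (p d) &
      forall j, j \in J -> ~~ (below p0 l (y (s j)) && above p0 l' (y (s j)))].
    have [[j /andP[jJ pj] jmin]|no] := finite_argmin
        [pred j | (j \in J) && above p0 l' (y (s j))] (fun j => - y (s j)).
      exists (Some j); split => //; first by rewrite /= l'max.
      move=> i iJ /=; apply/negP => /andP[yi ai].
      have := jmin i; rewrite inE iJ ai => /(_ isT).
      by rewrite lerN2 leNgt yi.
    by exists None; split => // i iJ; have := no i; rewrite inE iJ.
  exists (inl (l, l')); split => //; rewrite bl al' /ok vl vl' !andbT.
  by apply/forall_inP.
- case=> [[l l']|j] /=; case: ifP => // _.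
    apply: measurableU; last exact: measurableI.
    apply: measurableU; last exact: measurableC.
    by apply: measurableU => //; exact: measurableU.
  by apply: measurableU => //; exact: measurable_xsection.
- have m1E : m%:R^-1 = 8 * a by rewrite aE; field; rewrite gt_eqF.
  case=> [[l l']|j] /=; last first.
    case: ifP => jJ; last by rewrite measure0 lee_fin invr_ge0 ltW.
    apply: le_trans (U2 _ _ _ _ mG2 (measurable_xsection _ mG1) G2_le (sG _ jJ)) _.
    by rewrite lee_fin m1E -/a; lra.
  case: ifP => okl; last by rewrite measure0 lee_fin invr_ge0 ltW.
  have /and3P[vl vl' /forall_inP okl'] := okl.
  have gapb : (D (Bg `&` y @^-1` gap l l') <= a%:E)%E.
    apply: le_trans (sgap _ (gap_itv l l') _) _.
      by move=> j jJ /=; apply/negP; exact: okl'.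
    by rewrite lee_fin natrM aE le_eqVlt; apply/orP; left; apply/eqP;
      field; rewrite gt_eqF.
  have mU1 : measurable (X l `|` X l') by exact: measurableU.
  have mU2 : measurable (G2 `|` (X l `|` X l')) by exact: measurableU.
  have mU3 : measurable (G2 `|` (X l `|` X l') `|` ~` Good).
    by apply: measurableU => //; exact: measurableC.
  have h1 := U2 _ _ _ _ (mX l) (mX l') (X_le _ vl) (X_le _ vl').
  have h2 := U2 _ _ _ _ mG2 mU1 G2_le h1.
  have h3 := U2 _ _ _ _ mU2 (measurableC mGood) h2 GoodC.
  apply: le_trans (U2 _ _ _ _ mU3 (measurableI _ _ mBg (mgap l l')) h3 gapb) _.
  by rewrite lee_fin m1E -/a; lra.
- case=> [[l l']|j] z p p' /=; last first.
    move=> nB [Cp [jJ pj]] [Cp' [_ p'j]]; move: nB; rewrite jJ => nB.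
    have nG2 : ~ G2 z by move=> h; apply: nB; left.
    have [cz|cz] := eqVneq (c d z) 0; first by rewrite !sign0//; exact: G2P.
    rewrite !signE// pj p'j -[in LHS]opprB -[in RHS]opprB !sgrN; congr (_ * - _).
    by apply: order => //; [exact: snz | move=> h; apply: nB; right].
  move=> nB [Cp /and3P[okl bp ap]] [Cp' /and3P[_ bp' ap']]; move: nB; rewrite okl => nB.
  have nG2 : ~ G2 z by move=> h; apply: nB; do 3 left.
  have nX : ~ X l z by move=> h; apply: nB; do 2 left; right; left.
  have nX' : ~ X l' z by move=> h; apply: nB; do 2 left; right; right.
  have Gz : Good z by apply: contrapT => h; apply: nB; left; right.
  have [cz|cz] := eqVneq (c d z) 0; first by rewrite !sign0//; exact: G2P.
  have ngap : ~ gap l l' (y z) by move=> h; apply: nB; right; split.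
  have /and3P[vl vl' _] := okl.
  rewrite !signE//; congr (_ * _).
  (* Outside the gap, the root of [z] is at [p0] on the outer side of one bounding graph. Off the
     exceptional sets this order holds on the whole cell, so the last coordinate stays on one side
     of the root throughout the slab. *)
  have [nb|na] : ~~ below p0 l (y z) \/ ~~ above p0 l' (y z).
  + by apply/orP; rewrite -negb_and; apply/negP.
  + case: l vl bp bp' nb nX {ngap okl nB} => [j|]//= jJ bp bp'.
    rewrite -leNgt => yz nX.
    have key q : C q -> root q (s j) < q d -> Num.sg (q d - root q z) = 1.
      move=> Cq sq; apply: gtr0_sg; rewrite subr_gt0 (le_lt_trans _ sq)// -subr_le0.
      rewrite -(sgr_le0 (_ - _)) (order _ _ _ p0)//; last exact: snz.
      by rewrite sgr_le0 subr_le0.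
    by rewrite !key.
  + case: l' vl' ap ap' na nX' {ngap okl nB} => [j|]//= jJ ap ap'.
    rewrite -leNgt => yz nX'.
    have key q : C q -> q d < root q (s j) -> Num.sg (q d - root q z) = -1.
      move=> Cq sq; apply: ltr0_sg; rewrite subr_lt0 (lt_le_trans sq)// -subr_ge0.
      rewrite -(sgr_ge0 (_ - _)) (order _ _ _ p0)//; last exact: snz.
      by rewrite sgr_ge0 subr_ge0.
    by rewrite !key.
Qed.

End Slab.

(* A distribution-free cutting lemma: all but a fraction [1/m] of the
   hyperplanes [{p | aff d (c0 z) (c ^~ z) p = 0}] avoid a given cell, or
   contain it. *)
Lemma cutting (R : realType) (d : nat) : exists q : nat,
  forall (disp : measure_display) (Z : measurableType disp)
    (D : probability Z R) (c0 : Z -> R) (c : nat -> Z -> R),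
  measurable_fun setT c0 -> (forall i, measurable_fun setT (c i)) ->
  forall m, (2 <= m)%N ->
  exists (K : finType) (C : K -> set (nat -> R)) (B : K -> set Z),
  [/\ (#|K| <= m ^ q)%N, forall p, exists k, C k p,
      forall k, measurable (B k),
      forall k, (D (B k) <= (m%:R^-1)%:E)%E &
      forall k z p p', ~ B k z -> C k p -> C k p' ->
        Num.sg (aff d (c0 z) (c ^~ z) p) = Num.sg (aff d (c0 z) (c ^~ z) p')].
Proof.
elim: d => [|d [q IH]].
  exists 0%N => disp Z D c0 c mc0 mc m m2.
  exists unit, (fun=> setT), (fun=> set0); split => //.
  - by rewrite card_unit.
  - by move=> k; rewrite measure0 lee_fin.
  - by move=> k z p p' _ _ _; rewrite /aff !big_ord0.
(* For [m >= 2], the precisions satisfy [64 * m * m <= m ^ 8] and [8 * m <= m ^ 4], and a slab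
   decomposition has at most [m ^ 15] pieces. *)
exists (8 * q + 4 * q + 15)%N => disp Z D c0 c mc0 mc m m2.
have m1_ge2 : (2 <= 64 * m * m)%N by nia.
have m2_ge2 : (2 <= 8 * m)%N by lia.
(* [e0] and [e] are the coefficients of the form ordering the roots of two samples. The induction
   hypothesis under [D \x D] makes this order constant on cells; under [D] it handles the
   hyperplanes without a root. *)
pose e0 (u : Z * Z) := c d u.1 * c0 u.2 - c d u.2 * c0 u.1.
pose e i (u : Z * Z) := c d u.1 * c i u.2 - c d u.2 * c i u.1.
have mpr (f h : Z -> R) : measurable_fun setT f -> measurable_fun setT h ->
    measurable_fun setT (fun u : Z * Z => f u.1 * h u.2 - f u.2 * h u.1).
  move=> mf mh; apply: measurable_funB; apply: measurable_funM;
    by apply: measurableT_comp.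
have me0 : measurable_fun setT e0 by exact: mpr.
have me i : measurable_fun setT (e i) by exact: mpr.
have [K1 [C1 [B1 [K1c C1p mB1 B1_le C1s]]]] := IH _ _ (D \x D)%E e0 e me0 me _ m1_ge2.
have [K2 [C2 [B2 [K2c C2p mB2 B2_le C2s]]]] := IH _ _ D c0 c mc0 mc _ m2_ge2.
have slab (k : K1 * K2) : exists CB : (slab_index m -> set (nat -> R)) *
    (slab_index m -> set Z),
  [/\ forall p, C1 k.1 p -> C2 k.2 p -> exists j, CB.1 j p,
      forall j, measurable (CB.2 j),
      forall j, (D (CB.2 j) <= (m%:R^-1)%:E)%E &
      forall j z p p', ~ CB.2 j z -> CB.1 j p -> CB.1 j p' ->
        Num.sg (aff d.+1 (c0 z) (c ^~ z) p) =
        Num.sg (aff d.+1 (c0 z) (c ^~ z) p')].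
  have [[p0 [Cp1 Cp2]]|no] := pselect (exists p0, C1 k.1 p0 /\ C2 k.2 p0); last first.
    exists (fun=> set0, fun=> set0); split => //=.
      by move=> p h1 h2; exfalso; apply: no; exists p.
    by move=> _; rewrite measure0 lee_fin.
  have [||C' [B [h1 h2 h3 h4]]] := slab_cutting mc0 mc m2
    (mB1 k.1) (mB2 k.2) (B1_le k.1) (B2_le k.2)
     (C := C1 k.1 `&` C2 k.2) (d := d) _ _ (conj Cp1 Cp2).
  - move=> z z' p p' nB [C1p' _] [C1p'' _].
    have := C1s k.1 (z, z') p p' nB C1p' C1p''.
    by rewrite /e0 /e/= !aff_comb.
  - by move=> z p p' nB [_ C2p'] [_ C2p'']; exact: C2s nB C2p' C2p''.
  by exists (C', B); split => // p ? ?; exact: h1.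
have [f fP] := choice slab.
exists (K1 * K2 * slab_index m)%type, (fun k => (f k.1).1 k.2), (fun k => (f k.1).2 k.2).
split.
- have b1 : (#|K1| <= (m ^ 8) ^ q)%N.
    apply: (leq_trans K1c); apply: leq_expr.
    by rewrite -mulnA (expnD m 6 2) leq_mul// (leq_exp2r 2 m (isT : (0 < 6)%N)).
  have b2 : (#|K2| <= (m ^ 4) ^ q)%N.
    apply: (leq_trans K2c); apply: leq_expr.
    by rewrite expnSr leq_mul// (leq_exp2r 2 m (isT : (0 < 3)%N)).
  rewrite !card_prod !(expnD m _ 15) (expnD m (8 * q)) !(expnM m).
  by rewrite leq_mul ?leq_mul ?card_slab_index.
- move=> p; have [k1 h1] := C1p p; have [k2 h2] := C2p p.
  by have [+ _ _ _] := fP (k1, k2) => /(_ p h1 h2)[j jp]; exists (k1, k2, j).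
- by move=> k; have [_ + _ _] := fP k.1; exact.
- by move=> k; have [_ _ + _] := fP k.1; exact.
- by move=> k; have [_ _ _ +] := fP k.1; exact.
Qed.

(** * Absence of ties *)

Lemma measure_bigcup_series {R : realType} {disp : measure_display}
    {T : measurableType disp} (mu : {measure set T -> \bar R}) (H : (set T)^nat) :
  (forall n, measurable (H n)) -> trivIset setT H ->
  mu (\bigcup_k H k) = (\sum_(0 <= n <oo) mu (H n))%E.
Proof.
move=> mH tH; apply/esym/cvg_lim => //.
by apply: measure_semi_sigma_additive => //; exact: bigcupT_measurable.
Qed.

Section Disintegration.
Context {R : realType} {dx dy : measure_display} {X : measurableType dx}
  {Y : measurableType dy}.
Variables (D : probability (X * Y)%type R) (kappa : R.-pker Y ~> X).
Hypothesis kappaP : forall (A : set X) (B : set Y),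
  measurable A -> measurable B ->
  D (A `*` B) = (\int[D]_(z in snd @^-1` B) kappa z.2 A)%E.

Let sec (S : set (X * Y)) (y : Y) : set X := [set x | S (x, y)].

Let msec S y : measurable S -> measurable (sec S y).
Proof.
move=> mS; rewrite -[X in measurable X]setTI.
exact: (measurable_pair2 y measurableT mS).
Qed.

Lemma measurable_kernel_section S : measurable S ->
  measurable_fun setT (fun z : X * Y => kappa z.2 [set x | S (x, z.2)]).
Proof.
move=> mS; apply: (@measurableT_comp _ _ _ _ _ _ (fun y => kappa y (sec S y))) => //.
have mS' : measurable [set u : Y * X | S (u.2, u.1)].
  rewrite -[X in measurable X]setTI.
  exact: (measurable_fun_pair measurable_snd measurable_fst measurableT mS).
have := @measurable_fun_xsection_finite_kernel _ _ _ _ _ kappa _ (mem_set mS').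
congr (measurable_fun _ _); apply/funext => y; congr (kappa y _).
by apply/seteqP; split => x /=; rewrite /xsection/= inE.
Qed.

(** The kernel is given only through rectangles, and the set of ties is not one; Dynkin's theorem
    extends the formula to all measurable sets. *)
Lemma disintegration S : measurable S ->
  D S = (\int[D]_z kappa z.2 [set x | S (x, z.2)])%E.
Proof.
move=> mS; rewrite -[RHS]/(\int[D]_z kappa z.2 (sec S z.2))%E.
pose P := [set S | D S = (\int[D]_z kappa z.2 (sec S z.2))%E].
pose G := [set A `*` B | A in @measurable _ X & B in @measurable _ Y].
have GE : @measurable _ (X * Y)%type = <<s G >> by exact: measurable_prod_measurableType.
have int1 : (\int[D]_z 1 = 1)%E.
  by have := EFin_expect D (bdm_cst 1); rewrite expect_cst.
have kT y : kappa y setT = 1%E by exact: prob_kernel.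
rewrite -/(P S); apply: (@dynkin_induction _ (X * Y)%type G P) => //; last by rewrite -GE.
- move=> _ _ [A mA [B mB <-]] [A' mA' [B' mB' <-]].
  exists (A `&` A'); first exact: measurableI.
  by exists (B `&` B'); [exact: measurableI | rewrite setXI].
- rewrite /P/= probability_setT; under eq_integral => z _.
    rewrite (_ : sec setT z.2 = setT) ?prob_kernel; first over.
    by apply/seteqP; split.
  by rewrite int1.
- move=> _ [A mA [B mB <-]]; rewrite /P/= kappaP// integral_mkcond.
  apply: eq_integral => z _; rewrite patchE; case: ifPn => [/set_mem/= Bz|/negP nB].
    congr (kappa _ _); apply/seteqP; split => x /=; first by move=> ?; split.
    by case.
  rewrite (_ : sec _ _ = set0) ?measure0//.
  by apply/seteqP; split => x //= [_ Bz]; apply: nB; rewrite inE.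
- move=> A mA PA; rewrite /P/= probability_setC// PA.
  have kC (z : X * Y) : kappa z.2 (sec (~` A) z.2) = (1 - kappa z.2 (sec A z.2))%E.
    rewrite (_ : sec _ _ = setT `\` sec A z.2); last by rewrite setTD.
    have mA' := msec z.2 mA.
    have kD := @measureD _ _ _ (kappa z.2) setT (sec A z.2) measurableT mA'.
    have kfin : (kappa z.2 setT < +oo)%E by rewrite kT ltry.
    transitivity (kappa z.2 setT - kappa z.2 (sec A z.2))%E; last by rewrite kT.
    by rewrite -[in RHS](setTI (sec A z.2)); exact: kD kfin.
  under [RHS]eq_integral do rewrite kC.
  have k01 (z : X * Y) : (0 <= kappa z.2 (sec A z.2) <= 1)%E.
    by rewrite measure_ge0/= -(kT z.2) le_measure ?inE//; exact: msec.
  rewrite integralB//.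
  + by rewrite int1.
  + exact: finite_measure_integrable_cst.
  + apply/integrableP; split; first exact: measurable_kernel_section.
    apply: (@le_lt_trans _ _ (\int[D]_z (cst 1 z))%E).
      apply: ge0_le_integral => //.
        by apply: measurableT_comp => //; exact: measurable_kernel_section.
      by move=> z _; rewrite gee0_abs; have /andP[] := k01 z.
    by rewrite [X in (X < _)%E]int1 ltry.
- move=> F mF tF PF; rewrite /P/=.
  have PF' n : D (F n) = (\int[D]_z kappa z.2 (sec (F n) z.2))%E := PF n.
  rewrite measure_bigcup_series// (eq_eseriesr (fun n _ => PF' n)) -integral_nneseries//;
    last by move=> n; exact: measurable_kernel_section.
  apply: eq_integral => z _.
  rewrite (_ : sec (\bigcup_k F k) z.2 = \bigcup_k sec (F k) z.2).
    rewrite measure_bigcup_series//; first by move=> n; exact: msec.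
    apply/trivIsetP => i j _ _ ij; apply/seteqP; split => x //= [Fi Fj].
    by move/trivIsetP : tF => /(_ i j I I ij) /seteqP[+ _] => /(_ (x, z.2)); apply.
  by apply/seteqP; split.
Qed.

End Disintegration.

Lemma measurable_forall {disp : measure_display} {T : measurableType disp}
    (J : finType) (c : J -> T -> bool) : (forall j, measurable_fun setT (c j)) ->
  measurable_fun setT (fun x => [forall j, c j x]).
Proof.
move=> mc; have -> : (fun x => [forall j, c j x]) = (fun x => all (c ^~ x) (enum J)).
  apply/funext => x; apply/forallP/allP => [h j _|h j]; first exact: h.
  by apply: h; rewrite mem_enum.
elim: (enum J) => [|j s IH] /=; first exact: measurable_cst.
exact: measurable_and.
Qed.

Section Valuation.
Context {R : realType} {d : nat}.
Implicit Types (p : d.-tuple R) (mu : probability (pair_type R d) R).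

Lemma measurable_res (i : 'I_d) :
  measurable_fun setT (fun z : pair_type R d => tnth z.2 i).
Proof. by apply: (measurableT_comp (measurable_tnth i)). Qed.

Lemma measurable_dot_pair {disp : measure_display} {T : measurableType disp}
    (f h : T -> d.-tuple R) : measurable_fun setT f -> measurable_fun setT h ->
  measurable_fun setT (fun x => dot (f x) (h x)).
Proof.
move=> mf mh; apply: measurable_sum => i.
by apply: measurable_funM; [exact: (measurableT_comp (measurable_tnth i) mf)
  | exact: (measurableT_comp (measurable_tnth i) mh)].
Qed.

Lemma measurable_dot p : measurable_fun setT (fun z : pair_type R d => dot p z.2).
Proof. by apply: measurable_dot_pair. Qed.

Lemma measurable_near (a e : R) (i : 'I_d) :
  measurable_fun setT (fun z : pair_type R d => (`|tnth z.2 i - a| < e)%R).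
Proof.
apply: measurable_fun_ltr => //; apply: measurableT_comp => //.
by apply: measurable_funB => //; exact: measurable_res.
Qed.

(** A point outside the support has a null neighbourhood, hence lies in a null box with rational
    centre and radius [1 / n.+1]. There are countably many such boxes; [F] enumerates them through
    [unpickle], with the empty set in place of the boxes of positive measure. *)
Lemma negligible_out_of_support mu :
  mu.-negligible [set z | ~ in_support mu z.2].
Proof.
pose box (q : d.-tuple rat) (n : nat) := [set z : pair_type R d |
  [forall i, (`|tnth z.2 i - ratr (tnth q i)| < n.+1%:R^-1)%R]].
have mbox q n : measurable (box q n).
  apply: measurable_setr; apply: measurable_forall => i; exact: measurable_near.
pose F (k : nat) : set (pair_type R d) :=
  if (unpickle k : option (d.-tuple rat * nat)) is Some qn then
    if pselect (mu (box qn.1 qn.2) = 0%E) is left _ then box qn.1 qn.2 else set0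
  else set0.
apply: (@negligibleS _ _ _ _ (\bigcup_k F k)); last first.
  apply: negligible_bigcup => k; rewrite /F.
  case: unpickle => [[q n]|] /=; last exact: negligible_set0.
  case: pselect => [mu0|_]; last exact: negligible_set0.
  by apply/negligibleP.
move=> z /= nsupp.
have [e [e0 mue]] : exists e : R, 0 < e /\
    mu [set z' : pair_type R d | forall i, (`|tnth z'.2 i - tnth z.2 i| < e)%R] = 0%E.
  apply: contrapT => h; apply: nsupp => e e0; rewrite lt0e measure_ge0 andbT.
  by apply/eqP => mu0; apply: h; exists e.
pose n := Num.truncn (2 / e).
have ne : n.+1%:R^-1 *+ 2 <= e.
  have /truncn_itv/andP[_] : 0 <= 2 / e by rewrite divr_ge0// ltW.
  rewrite -/n ltr_pdivrMr// => h.
  have -> : n.+1%:R^-1 *+ 2 = 2 / n.+1%:R :> R by rewrite mulr2n; ring.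
  by rewrite ler_pdivrMr// mulrC ltW.
have n0 : 0 < n.+1%:R^-1 :> R by rewrite invr_gt0.
have /choice[q qP] (i : 'I_d) : exists q : rat, `|tnth z.2 i - ratr q| < n.+1%:R^-1.
  have [|q] := @rat_in_itvoo R (tnth z.2 i - n.+1%:R^-1) (tnth z.2 i + n.+1%:R^-1).
    by rewrite ltrD2l gtrN.
  rewrite in_itv/= => /andP[h1 h2]; exists q; rewrite ltr_norml.
  by apply/andP; split; [rewrite ltrNl opprB ltrBlDr addrC | rewrite ltrBlDr -ltrBlDl].
exists (pickle ([tuple q i | i < d], n)) => //; rewrite /F pickleK/=.
case: pselect => [_|[]].
  by apply/forallP => i; rewrite tnth_mktuple.
have sub : box [tuple q i | i < d] n `<=`
    [set z' : pair_type R d | forall i, (`|tnth z'.2 i - tnth z.2 i| < e)%R].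
  move=> z' /forallP h i; have := h i; rewrite tnth_mktuple => hi.
  rewrite (lt_le_trans _ ne)// mulr2n.
  rewrite -[X in `|X|](subrKA (ratr (q i))) (le_lt_trans (ler_normD _ _))// ltrD//.
  by rewrite distrC.
apply/eqP; rewrite -measure_le0 -mue le_measure ?inE//.
rewrite (_ : [set z' | _] = [set z' | [forall i, (`|tnth z'.2 i - tnth z.2 i| < e)%R]]).
  by apply: measurable_setr; apply: measurable_forall => i; exact: measurable_near.
by apply/seteqP; split => z' /=; [move=> h; exact/forallP | move=> /forallP].
Qed.

(** Given [a], a tie is the single value [dot p a], which is not an atom when [a] lies in the
    support, and almost every [a] does. *)
Lemma continuous_valuation_no_tie K (D : 'I_K -> probability (pair_type R d) R) :
  continuous_valuation D ->
  forall k p, D k [set z | z.1 == dot p z.2] = 0%E.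
Proof.
move=> cD k p; have [kappa [kP katom]] := cD k.
have mS : measurable [set z : pair_type R d | z.1 == dot p z.2].
  by apply: measurable_setr; apply: measurable_fun_eqr => //; exact: measurable_dot.
rewrite (disintegration kP mS)/=.
have kE (z : pair_type R d) : kappa z.2 [set x | x == dot p z.2] = kappa z.2 [set dot p z.2].
  by congr (kappa _ _); apply/seteqP; split => x /= => [/eqP|->].
under eq_integral do rewrite kE.
rewrite (ae_eq_integral (cst 0%E))//; first by rewrite integral0.
  apply: (eq_measurable_fun (fun z => kappa z.2 [set x | x == dot p z.2])) => //.
  exact: (measurable_kernel_section kappa mS).
have [N [mN N0 subN]] := negligible_out_of_support (D k).
exists N; split => // z nz; apply: subN => /= supp; apply: nz => _.
exact: katom.
Qed.

(** The cutting is applied to [p |-> r - <p, a>], with one price chosen per cell. Since even the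
    sign is constant off [B k], the strict and the non-strict acceptance rule both agree with those
    of the chosen price. *)
Lemma price_net : exists q : nat, forall mu (m : nat), (2 <= m)%N ->
  exists (K : finType) (pk : K -> d.-tuple R) (B : K -> set (pair_type R d)),
  [/\ (#|K| <= m ^ q)%N, forall k, measurable (B k),
      forall k, (mu (B k) <= (m%:R^-1)%:E)%E &
      forall p, exists k, forall z, ~ B k z ->
        (dot p z.2 < z.1) = (dot (pk k) z.2 < z.1) /\
        (dot p z.2 <= z.1) = (dot (pk k) z.2 <= z.1)].
Proof.
have [q qP] := cutting R d; exists q => mu m m2.
pose ext (p : d.-tuple R) (i : nat) : R := if insub i is Some j then tnth p j else 0.
have extE p (i : 'I_d) : ext p i = tnth p i by rewrite /ext valK.
pose c i (z : pair_type R d) := - ext z.2 i.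
have affE z p : aff d z.1 (c ^~ z) (ext p) = z.1 - dot p z.2.
  rewrite /aff /dot -sumrN; congr (_ + _); apply: eq_bigr => i _.
  by rewrite /c !extE mulNr mulrC.
have mc i : measurable_fun setT (c i).
  apply: measurable_funN; rewrite /ext; case: insub => [j|]; last exact: measurable_cst.
  exact: measurable_res.
have [K [C [B [Kc Cp mB B_le Cs]]]] := qP _ _ mu fst c measurable_fst mc _ m2.
have /choice[pk pkP] k : exists pk, (exists p, C k (ext p)) -> C k (ext pk).
  have [[p Cpk]|no] := pselect (exists p, C k (ext p)); first by exists p.
  by exists [tuple 0 | i < d].
exists K, pk, B; split => // p; have [k kp] := Cp (ext p); exists k => z nB.
have := Cs k z _ _ nB kp (pkP k (ex_intro _ p kp)); rewrite !affE => sE.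
by rewrite -subr_gt0 -[RHS in _ = RHS /\ _]subr_gt0 -subr_ge0
  -[RHS in _ /\ _ = RHS]subr_ge0 -sgr_gt0 sE sgr_gt0 -sgr_ge0 sE sgr_ge0.
Qed.

End Valuation.

(** * Concentration *)

(** From [1 - x <= expR (- x)] follows [expR x <= (1 - x)^-1], also for negative [x], and
    [(1 - x) * (1 + x + 2 * x ^+ 2) >= 1] up to [x = 1/2]. *)
Lemma expR_le_quadratic {R : realType} (x : R) :
  x <= 2^-1 -> expR x <= 1 + x + 2 * x ^+ 2.
Proof.
move=> x2; have x1 : 0 < 1 - x by lra.
have h : 1 - x <= expR (- x) by have := expR_ge1Dx (- x); rewrite addrC; lra.
have e0 := expR_gt0 x.
have h1 : (1 - x) * expR x <= 1.
  by rewrite -[leRHS](expRxMexpNx_1 x) mulrC ler_pM2l.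
rewrite -(ler_pM2l x1) (le_trans h1)//.
have -> : (1 - x) * (1 + x + 2 * x ^+ 2) = 1 + x ^+ 2 * (1 - 2 * x) by ring.
by rewrite lerDl mulr_ge0 ?sqr_ge0//; lra.
Qed.

Lemma bdm_comp {R : realType} {d1 d2 : measure_display} {U : measurableType d1}
    {V : measurableType d2} (h : V -> R) (phi : U -> V) :
  bdm h -> measurable_fun setT phi -> bdm (fun x => h (phi x)).
Proof.
move=> [mh [M hM]] mphi; split; last by exists M.
exact: (measurableT_comp mh mphi).
Qed.

Section UnionBound.
Context {disp : measure_display} {T : measurableType disp} {R : realType}.
Context (P : probability T R).

Lemma measurable_exists (J : finType) (c : J -> T -> bool) :
  (forall j, measurable_fun setT (c j)) ->
  measurable_fun setT (fun x => [exists j, c j x]).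
Proof.
move=> mc; have -> : (fun x => [exists j, c j x]) =
    (fun x => ~~ [forall j, ~~ c j x]) by apply/funext => x; rewrite negb_forall;
    apply: eq_existsb => j; rewrite negbK.
apply: measurable_neg; apply: measurable_forall => j; exact: measurable_neg.
Qed.

Lemma expect_exists_le (J : finType) (c : J -> T -> bool) :
  (forall j, measurable_fun setT (c j)) ->
  expect P (fun x => [exists j, c j x]%:R) <= \sum_j expect P (fun x => (c j x)%:R).
Proof.
move=> mc; rewrite -expect_sum => [|j _]; last exact: bdm_bool.
apply: expect_le => [||x].
- exact/bdm_bool/measurable_exists.
- by apply: bdm_sum => j _; exact: bdm_bool.
- case: existsP => [[j cj]|_]; last by apply: sumr_ge0 => j _; rewrite ler0n.
  by rewrite (bigD1 j)//= cj lerDl; apply: sumr_ge0 => i _; rewrite ler0n.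
Qed.

End UnionBound.

(** * Exponential supermartingales for the observations of one configuration *)

Section Observations.
Context {R : realType} {d K : nat} {disp : measure_display}
  {Om : measurableType disp}.
Variables (Pr : probability Om R) (F : nat -> set (set Om)).
Variables (theta : nat -> Om -> 'I_K) (z : nat -> Om -> pair_type R d).
Variables (D : 'I_K -> probability (pair_type R d) R) (T : nat).

(** Only the information structure and the conditional law of the pairs, independently of prices and
    saddle points: the original observations and the clipped ones both qualify. *)
Record observations : Prop := {
  obs_filtration : filtration F ;
  obs_theta : forall t, (t < T)%N -> forall k, F t.+1 (theta t @^-1` [set k]) ;
  obs_z : forall t, (t < T)%N -> forall A, measurable A -> F t.+1 (z t @^-1` A) ;
  obs_law : forall t, (t < T)%N -> forall E k A, F t E -> measurable A ->
    Pr (E `&` theta t @^-1` [set k] `&` z t @^-1` A) =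
    (Pr (E `&` theta t @^-1` [set k]) * D k A)%E }.

Hypothesis obs : observations.

Local Notation GT t := (g_sigma_algebraType (F t)).

Lemma obs_sigma t : sigma_algebra setT (F t).
Proof. by have [+ _ _] := obs_filtration obs; exact. Qed.

Lemma obs_measurable t : F t `<=` measurable.
Proof. by have [_ + _] := obs_filtration obs; exact. Qed.

Lemma obs_mono s t : (s <= t)%N -> F s `<=` F t.
Proof.
have [_ _ h] := obs_filtration obs.
elim: t => [|t IH]; first by rewrite leqn0 => /eqP ->.
rewrite leq_eqVlt ltnS => /orP[/eqP ->//|/IH st].
exact: subset_trans st (h t).
Qed.

Lemma adapted_mono {d'} {U : measurableType d'} s t (f : Om -> U) :
  (s <= t)%N -> measurable_fun setT (f : GT s -> U) ->
  measurable_fun setT (f : GT t -> U).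
Proof.
move=> st mf; apply: (measurable_fun_GT (obs_sigma t)) => A mA.
apply: (obs_mono st); rewrite -(measurable_GTE (obs_sigma s)).
by rewrite -[X in measurable X]setTI; exact: mf.
Qed.

Lemma adapted_z s t : (s < t <= T)%N -> measurable_fun setT (z s : GT t -> _).
Proof.
move=> /andP[st tT]; apply: (adapted_mono st).
apply: (measurable_fun_GT (obs_sigma s.+1)) => A mA.
by apply: (obs_z obs) => //; exact: leq_trans tT.
Qed.

Lemma adapted_theta s t k : (s < t <= T)%N ->
  measurable_fun setT ((fun om => theta s om == k) : GT t -> bool).
Proof.
move=> /andP[st tT]; apply: (adapted_mono st).
apply: (measurable_fun_bool true); rewrite setTI (measurable_GTE (obs_sigma s.+1)).
have := obs_theta obs (leq_trans st tT) k; congr (F s.+1 _).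
by apply/seteqP; split => om /=; [move=> ->; rewrite eqxx | move/eqP].
Qed.

Lemma measurable_z t : (t < T)%N -> measurable_fun setT (z t).
Proof.
move=> tT; apply: (measurable_fun_from_GT (obs_sigma t.+1) (@obs_measurable t.+1)).
by apply: adapted_z; rewrite ltnSn.
Qed.

Lemma measurable_theta t k : (t < T)%N -> measurable (theta t @^-1` [set k]).
Proof. by move=> tT; apply: (@obs_measurable t.+1); exact: (obs_theta obs). Qed.

Section Supermartingale.
Variables (k : 'I_K) (f : pair_type R d -> R).
Hypotheses (mf : measurable_fun setT f) (f01 : forall u, 0 <= f u <= 1).

Let mu := expect (D k) f.

Let bf : bdm f.
Proof.
split => //; exists 1 => u; rewrite ger0_norm; by have /andP[] := f01 u.
Qed.

Let mu01 : 0 <= mu <= 1.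
Proof.
apply/andP; split; first by apply: expect_ge0 => u; have /andP[] := f01 u.
rewrite -[leRHS](expect_cst (D k)); apply: expect_le => //; first exact: bdm_cst.
by move=> u; have /andP[] := f01 u.
Qed.

(** The term [2 * lam ^+ 2] compensates the quadratic term of [expR_le_quadratic], since [f - mu]
    has mean zero and absolute value at most 1. It brings the conditional mean of the exponential
    below 1 for [lam <= 1/2]. *)
Definition increment (lam : R) (u : pair_type R d) :=
  lam * (f u - mu) - 2 * lam ^+ 2.

Definition log_wealth (lam : R) t om :=
  \sum_(s < t) (theta s om == k)%:R * increment lam (z s om).

Let f_mu u : `|f u - mu| <= 1.
Proof.
by rewrite ler_norml; have /andP[? ?] := f01 u; have /andP[? ?] := mu01;
  apply/andP; split; lra.
Qed.

Lemma bdm_increment lam : bdm (increment lam).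
Proof. by apply: bdmB; [apply/bdmZ/bdmB => //|]; exact: bdm_cst. Qed.

Lemma bdm_expR {d'} {U : measurableType d'} (h : U -> R) :
  bdm h -> bdm (fun x => expR (h x)).
Proof.
move=> [mh [M hM]]; split; first exact: (measurableT_comp (@measurable_expR R)).
exists (expR M) => x; rewrite ger0_norm ?expR_ge0// ler_expR.
by rewrite (le_trans (ler_norm _)).
Qed.

Lemma bdm_log_wealth lam t : (t <= T)%N -> @bdm _ (GT t) R (log_wealth lam t).
Proof.
move=> tT; apply: bdm_sum => s _.
have st : (s < t <= T)%N by rewrite ltn_ord.
apply: bdmM; first by apply: bdm_bool; exact: (adapted_theta k st).
exact: (bdm_comp (bdm_increment lam) (adapted_z st)).
Qed.

Lemma mgf_le1 lam : 0 <= lam <= 2^-1 ->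
  expect (D k) (fun u => expR (increment lam u)) <= 1.
Proof.
move=> /andP[lam0 lam2].
pose e := expR (- (2 * lam ^+ 2)).
have bsq : bdm (fun u => (f u - mu) ^+ 2) by apply/bdmX/bdmB => //; exact: bdm_cst.
have blin : bdm (fun u => f u - mu) by apply: bdmB => //; exact: bdm_cst.
apply: (@le_trans _ _ (expect (D k)
    (fun u => e * (1 + lam * (f u - mu) + 2 * lam ^+ 2 * (f u - mu) ^+ 2)))).
  apply: expect_le.
  - exact/bdm_expR/bdm_increment.
  - apply: bdmZ; apply: bdmD; last exact: bdmZ.
    by apply: bdmD; [exact: bdm_cst | exact: bdmZ].
  - move=> u; rewrite /increment expRD mulrC ler_pM2l ?expR_gt0//.
    have -> : 2 * lam ^+ 2 * (f u - mu) ^+ 2 = 2 * (lam * (f u - mu)) ^+ 2 by ring.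
    apply: expR_le_quadratic; have := f_mu u; rewrite ler_norml => /andP[_ h].
    by rewrite (le_trans _ lam2)// ler_piMr.
rewrite expectZ; last first.
  by apply: bdmD; [apply: bdmD; [exact: bdm_cst | exact: bdmZ] | exact: bdmZ].
rewrite expectD; [|by apply: bdmD; [exact: bdm_cst | exact: bdmZ]|exact: bdmZ].
rewrite expectD; [|exact: bdm_cst|exact: bdmZ].
rewrite !expectZ// expectB//; last exact: bdm_cst.
rewrite !expect_cst subrr mulr0 addr0.
have sq1 : expect (D k) (fun u => (f u - mu) ^+ 2) <= 1.
  rewrite -[leRHS](expect_cst (D k)); apply: expect_le => //; first exact: bdm_cst.
  by move=> u; rewrite -real_normK ?num_real// expr_le1.
rewrite /e expRN mulrC ler_pdivrMr ?expR_gt0// mul1r.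
apply: le_trans (expR_ge1Dx _); rewrite lerD2l ler_piMr// mulr_ge0// sqr_ge0.
by [].
Qed.

(** When configuration [k] is drawn, the wealth is multiplied by a factor of conditional mean at
    most 1, the past being frozen; otherwise it is unchanged. *)
Lemma expect_wealth_le1 lam t : 0 <= lam <= 2^-1 -> (t <= T)%N ->
  expect Pr (fun om => expR (log_wealth lam t om)) <= 1.
Proof.
move=> lam01; elim: t => [|t IH] tT.
  by rewrite (eq_expect _ (h := fun=> 1)) ?expect_cst// => om; rewrite /log_wealth big_ord0 expR0.
apply: le_trans (IH (ltnW tT)).
pose W om := expR (log_wealth lam t om).
pose A := theta t @^-1` [set k].
have mA : measurable A by exact: measurable_theta.
have bW : @bdm _ (GT t) R W by apply/bdm_expR/bdm_log_wealth/ltnW.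
have bW' : bdm W by exact: bdm_from_GT (obs_sigma t) (@obs_measurable t) _ bW.
have bA := @bdm_indic _ _ R _ mA.
have be : bdm (fun u => expR (increment lam u)) by exact/bdm_expR/bdm_increment.
pose h (x : GT t * pair_type R d) : R := W x.1 * expR (increment lam x.2).
have bh : bdm h.
  apply: bdmM.
    exact: (bdm_comp bW measurable_fst).
  exact: (bdm_comp be measurable_snd).
have fr := freeze_expect (obs_sigma t) (@obs_measurable t) mA (measurable_z tT)
  (fun E B FE mB => obs_law obs tT k FE mB) bh.
have bhz : bdm (fun om => h (om, z t om)).
  by apply: bdmM => //; exact: (bdm_comp be (measurable_z tT)).
rewrite (eq_expect _ (h := fun om => W om - \1_A om * W om + \1_A om * h (om, z t om))).
  rewrite expectD; [|by apply: bdmB => //; exact: bdmM|exact: bdmM].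
  rewrite expectB//; last exact: bdmM.
  rewrite fr -addrA gerDl addrC subr_le0.
  apply: expect_le; [|exact: bdmM|].
    apply: bdmM => //.
    apply: (bdm_from_GT (obs_sigma t) (@obs_measurable t)).
    exact: bdm_expect_section.
  move=> om; rewrite ler_wpM2l//.
  rewrite /h/= expectZ// ler_piMr ?expR_ge0//.
  exact: mgf_le1.
move=> om; rewrite /h /W/= /log_wealth big_ord_recr/= expRD indicE /A/=.
case: eqVneq => thk.
  by rewrite mem_set//= !mul1r subrr add0r.
by rewrite memNset ?mul0r ?expR0 ?mulr1 ?subr0 ?addr0//= => /eqP; rewrite (negbTE thk).
Qed.

Lemma wealth_tail lam t L : 0 <= lam <= 2^-1 -> (t <= T)%N ->
  expect Pr (fun om => (expR L <= expR (log_wealth lam t om))%R%:R) <= expR (- L).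
Proof.
move=> lam01 tT.
have bW' := bdm_from_GT (obs_sigma t) (@obs_measurable t) (bdm_expR (bdm_log_wealth lam tT)).
have mc : measurable_fun setT (fun om => expR L <= expR (log_wealth lam t om)).
  by apply: measurable_fun_ler => //; case: bW'.
rewrite expRN -[leRHS]mul1r ler_pdivlMr ?expR_gt0// mulrC.
apply: le_trans (expect_wealth_le1 lam01 tT).
rewrite -expectZ; last exact: bdm_bool.
apply: expect_le => // [|om]; first by apply: bdmZ; exact: bdm_bool.
by case: (leP (expR L) (expR (log_wealth lam t om))) => h; rewrite ?mulr1 ?mulr0 ?expR_ge0.
Qed.

Lemma log_wealthE lam t om : log_wealth lam t om =
  lam * (\sum_(s < t | theta s om == k) (f (z s om) - mu))
  - 2 * lam ^+ 2 * (nsel (theta ^~ om) t k)%:R.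
Proof.
rewrite /log_wealth /nsel natr_sum [in RHS]big_mkcond/= !mulr_sumr -sumrB.
by apply: eq_bigr => s _; case: ifPn => _; rewrite /increment /=; ring.
Qed.

(** The best parameter [sqrt (L / N)] depends on the random number [N] of observations, hence a
    union bound over all rounds and all values of [N]. Outside the bad event, [lam] times the sum is
    at most [L + 2 * lam ^+ 2 * N = 3 * L]. If [lam > 1/2], the trivial bound [N] on the sum is
    below [3 * lam * N]. *)
Lemma deviation_bound (L : R) : 0 < L -> exists bad : Om -> bool,
  [/\ measurable_fun setT bad,
      expect Pr (fun om => (bad om)%:R) <= T%:R * T%:R * expR (- L) &
      forall om, ~~ bad om -> forall t, (t < T)%N -> (0 < nsel (theta ^~ om) t k)%N ->
      \sum_(s < t | theta s om == k) (f (z s om) - mu) <=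
        3 * Num.sqrt (L * (nsel (theta ^~ om) t k)%:R)].
Proof.
move=> L0.
pose lam n : R := Num.sqrt (L / n%:R).
(* The shift makes [tn.2.+1] range over the positive counts [1, ..., T]. *)
pose c (tn : 'I_T * 'I_T) om := (lam tn.2.+1 <= 2^-1) &&
  (expR L <= expR (log_wealth (lam tn.2.+1) tn.1 om)).
have mc tn : measurable_fun setT (c tn).
  apply: measurable_and; first exact: measurable_cst.
  apply: measurable_fun_ler => //.
  have tT : (tn.1 <= T)%N by exact: ltnW.
  by case: (bdm_from_GT (obs_sigma _) (@obs_measurable _)
    (bdm_expR (bdm_log_wealth (lam tn.2.+1) tT))).
exists (fun om => [exists tn, c tn om]); split.
- exact: measurable_exists.
- apply: le_trans (expect_exists_le Pr mc) _.
  apply: (@le_trans _ _ (\sum_(tn : 'I_T * 'I_T) expR (- L))).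
    apply: ler_sum => tn _; rewrite /c.
    have [l2|_] := boolP (lam tn.2.+1 <= 2^-1); last first.
      by rewrite (eq_expect _ (h := fun=> 0)) ?expect_cst ?expR_ge0.
    by apply: wealth_tail => //; [rewrite sqrtr_ge0 | exact: ltnW].
  by rewrite sumr_const card_prod !card_ord -natrM mulr_natl.
- move=> om; rewrite negb_exists => /forallP nc t tT.
  set N := nsel _ t k => N0.
  have NT : (N.-1 < T)%N.
    rewrite prednK// (leq_trans _ (ltnW tT))// /N /nsel.
    by rewrite -[leqRHS]card_ord -sum1_card leq_sum// => s _; case: eqP.
  have N0' : 0 < N%:R :> R by rewrite ltr0n.
  have sq : Num.sqrt (L * N%:R) = lam N * N%:R.
    have -> : L * N%:R = (L / N%:R) * N%:R ^+ 2 by field; rewrite gt_eqF.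
    by rewrite sqrtrM ?divr_ge0 ?ltW// sqrtr_sqr ger0_norm ?ltW.
  have lam2 : lam N ^+ 2 * N%:R = L.
    by rewrite /lam sqr_sqrtr ?divr_ge0 ?ltW// divfK// gt_eqF.
  have lam0 : 0 < lam N by rewrite sqrtr_gt0 divr_gt0.
  rewrite sq; have [l2|l2] := leP (lam N) 2^-1; last first.
    apply: (@le_trans _ _ N%:R).
      rewrite /N /nsel natr_sum big_mkcond/=; apply: ler_sum => s _.
      by case: ifP => _ //; have := f_mu (z s om); rewrite ler_norml => /andP[].
    by rewrite mulrA ler_peMl ?ltW//; lra.
  have := nc (Ordinal tT, Ordinal NT); rewrite /c/= prednK// l2/= -ltNge ltr_expR.
  rewrite log_wealthE -/N -mulrA lam2 => h.
  rewrite -(ler_pM2l lam0).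
  have -> : lam N * (3 * (lam N * N%:R)) = 3 * L by rewrite -lam2; ring.
  by lra.
Qed.

End Supermartingale.
End Observations.

Lemma ln_nat_ge {R : realType} (T : nat) : (2 <= T)%N -> 4^-1 <= ln T%:R :> R.
Proof.
move=> T2; have T0 : (0 : R) < T%:R by rewrite ltr0n (leq_trans _ T2).
rewrite -ler_expR lnK ?posrE// (@le_trans _ _ 2) ?ler_nat//.
by apply: le_trans (expR_le_quadratic _) _; rewrite ?expr2; lra.
Qed.

(** * Acceptance estimates that are uniform over prices *)

Section AcceptanceIndicators.
Context {R : realType} {d : nat}.
Implicit Types (p : d.-tuple R) (v : pair_type R d).

Definition accepts p v : R := (dot p v.2 < v.1)%R%:R.
(** Lowering the prices accepts ties too, so this is the rule that appears in complementary
    slackness. *)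
Definition accepts_tie p v : R := (dot p v.2 <= v.1)%R%:R.

Lemma bdm_accepts p : bdm (accepts p).
Proof. by apply: bdm_bool; apply: measurable_fun_ltr => //; exact: measurable_dot. Qed.

Lemma bdm_accepts_tie p : bdm (accepts_tie p).
Proof. by apply: bdm_bool; apply: measurable_fun_ler => //; exact: measurable_dot. Qed.

Lemma accepts01 p v : 0 <= accepts p v <= 1.
Proof. by rewrite /accepts; case: (_ < _); rewrite ?lexx ?ler01. Qed.

Lemma accepts_tie01 p v : 0 <= accepts_tie p v <= 1.
Proof. by rewrite /accepts_tie; case: (dot p v.2 <= v.1); rewrite ?lexx ?ler01. Qed.

Lemma expect_accepts_tie (mu : probability (pair_type R d) R)
    (u : pair_type R d -> R) p : measurable_fun setT u ->
  mu [set v | v.1 == dot p v.2] = 0%E ->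
  expect mu (fun v => u v * accepts_tie p v) = expect mu (fun v => u v * accepts p v).
Proof.
move=> mu_u tie0; apply: ae_eq_expect.
- by apply: measurable_funM => //; case: (bdm_accepts_tie p).
- by apply: measurable_funM => //; case: (bdm_accepts p).
- exists [set v | v.1 == dot p v.2]; split => //.
    by apply: measurable_setr; apply: measurable_fun_eqr => //; exact: measurable_dot.
  move=> v /= neq; rewrite eq_sym; apply: contra_notT neq => neq.
  by rewrite /accepts /accepts_tie le_eqVlt (negbTE neq).
Qed.

End AcceptanceIndicators.

Section UniformAcceptance.
Context {R : realType} {d K : nat} {disp : measure_display}
  {Om : measurableType disp}.
Variables (Pr : probability Om R) (F : nat -> set (set Om)).
Variables (theta : nat -> Om -> 'I_K) (z : nat -> Om -> pair_type R d).
Variables (D : 'I_K -> probability (pair_type R d) R) (T : nat).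
Hypotheses (obs : observations Pr F theta z D T) (T_ge2 : (2 <= T)%N).
Hypothesis no_tie : forall k p, D k [set v | v.1 == dot p v.2] = 0%E.
Variable u : 'I_d -> pair_type R d -> R.
Hypotheses (mu : forall i, measurable_fun setT (u i))
  (u01 : forall i v, 0 <= u i v <= 1).

(** The two one-sided bounds are those that the first-order conditions call for: true consumption
    bounded by empirical consumption for the budget, empirical consumption with ties bounded by true
    consumption for slackness. In the factor 4, the deviation bound contributes 3 and the error
    [1 / T] of the net contributes 1. *)
Definition acceptance_close (q : nat) (om : Om) (t : nat) (k : 'I_K) :=
  forall (p : d.-tuple R) (i : 'I_d), (0 < nsel (theta ^~ om) t k)%N ->
  let N : R := (nsel (theta ^~ om) t k)%:R in
  let c := expect (D k) (fun v => u i v * accepts p v) in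
  let err := 4 * Num.sqrt (q%:R * ln T%:R / N) in
  c <= N^-1 * (\sum_(s < t | theta s om == k) u i (z s om) * accepts p (z s om)) + err /\
  N^-1 * (\sum_(s < t | theta s om == k) u i (z s om) * accepts_tie p (z s om)) <= c + err.

Lemma nsel_le om t k : (nsel (theta ^~ om) t k <= t)%N.
Proof.
rewrite /nsel -[leqRHS]card_ord -sum1_card leq_sum// => s _.
by case: eqP.
Qed.

(** Acceptance at any price is sandwiched between functions of a net price: on the exceptional set
    [B j], [fl] is 0 and [fh] is 1. Only this finite family needs a deviation bound, and the
    sandwich costs the measure of [B j], at most [1 / T]. *)
Lemma acceptance_close_single (q : nat) (k : 'I_K) (I : finType)
    (pk : I -> d.-tuple R) (B : I -> set (pair_type R d)) :
  (#|I| <= T ^ q)%N -> (forall j, measurable (B j)) ->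
  (forall j, (D k (B j) <= (T%:R^-1)%:E)%E) ->
  (forall p, exists j, forall v, ~ B j v ->
        (dot p v.2 < v.1) = (dot (pk j) v.2 < v.1) /\
        (dot p v.2 <= v.1) = (dot (pk j) v.2 <= v.1)) ->
  exists bad : Om -> bool, [/\ measurable_fun setT bad,
    expect Pr (fun om => (bad om)%:R) <= d.*2%:R / T%:R ^+ 2 &
    forall om, ~~ bad om -> forall t, (t < T)%N -> acceptance_close (q + 4) om t k].
Proof.
move=> Ic mB B_le net.
have T0 : (0 : R) < T%:R by rewrite ltr0n (leq_trans _ T_ge2).
(* The union runs over at most [T ^ q] net prices, [d] functions [u i], two sides, and the factor
   [T ^ 2] of [deviation_bound]. Then [expR (- L) = T ^- (q + 4)] leaves [2 d / T ^ 2], enough for a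
   further union over [K <= T] configurations. *)
pose L : R := (q + 4)%:R * ln T%:R.
have lnT := @ln_nat_ge R _ T_ge2.
have L1 : 1 <= L.
  rewrite (@le_trans _ _ (4%:R * ln T%:R))//; first by lra.
  by rewrite ler_wpM2r ?ler_nat ?leq_addl//; lra.
have L0 : 0 < L by lra.
have expL : expR (- L) = T%:R ^- (q + 4).
  by rewrite expRN /L expRM_natl lnK.
pose iB j : pair_type R d -> R := \1_(B j).
have iB01 j v : 0 <= iB j v <= 1.
  by rewrite /iB indicE; case: (_ \in _); rewrite ?lexx ?ler01.
have biB j : bdm (iB j) by exact: bdm_indic.
have bu i : bdm (u i).
  by split => //; exists 1 => v; rewrite ger0_norm; have /andP[] := u01 i v.
pose fl (x : I * 'I_d) v : R := u x.2 v * accepts (pk x.1) v * (1 - iB x.1 v).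
pose fh (x : I * 'I_d) v : R :=
  iB x.1 v + (1 - iB x.1 v) * (u x.2 v * accepts_tie (pk x.1) v).
have bfl x : bdm (fl x).
  apply: bdmM; first by apply: bdmM => //; exact: bdm_accepts.
  by apply: bdmB => //; exact: bdm_cst.
have bfh x : bdm (fh x).
  apply: bdmD => //; apply: bdmM; first by apply: bdmB => //; exact: bdm_cst.
  by apply: bdmM => //; exact: bdm_accepts_tie.
have bua i p : bdm (fun v => u i v * accepts p v).
  by apply: bdmM => //; exact: bdm_accepts.
have buat i p : bdm (fun v => u i v * accepts_tie p v).
  by apply: bdmM => //; exact: bdm_accepts_tie.
have ua01 i p v : 0 <= u i v * accepts p v <= 1.
  have /andP[h1 h2] := u01 i v; have /andP[h3 h4] := accepts01 p v.
  by rewrite mulr_ge0// mulr_ile1.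
have uat01 i p v : 0 <= u i v * accepts_tie p v <= 1.
  have /andP[h1 h2] := u01 i v; have /andP[h3 h4] := accepts_tie01 p v.
  by rewrite mulr_ge0// mulr_ile1.
(* [deviation_bound] controls sums from above only; applied to [1 - fl] it gives the lower
   deviation. *)
pose f (x : I * 'I_d * bool) v := if x.2 then 1 - fl x.1 v else fh x.1 v.
have bf x : bdm (f x).
  by rewrite /f; case: x.2 => //; apply: bdmB => //; exact: bdm_cst.
have f01 x v : 0 <= f x v <= 1.
  rewrite /f /fl /fh; have /andP[h1 h2] := iB01 x.1.1 v.
  have /andP[h3 h4] := ua01 x.1.2 (pk x.1.1) v.
  have /andP[h5 h6] := uat01 x.1.2 (pk x.1.1) v.
  by case: x.2; apply/andP; split; nra.
have /choice[bad badP] x := deviation_bound obs k (bf x).1 (f01 x) L0.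
exists (fun om => [exists x, bad x om]).
have mbad x : measurable_fun setT (bad x) by have [] := badP x.
split; first exact: measurable_exists.
- apply: le_trans (expect_exists_le Pr mbad) _.
  apply: (@le_trans _ _ (\sum_(x : I * 'I_d * bool) T%:R * T%:R * expR (- L))).
    by apply: ler_sum => x _; have [] := badP x.
  rewrite sumr_const !card_prod card_ord card_bool -[leLHS]mulr_natl expL.
  rewrite -mulnA muln2 natrM ler_pdivlMr ?exprn_gt0//.
  have TqN : (#|I|)%:R <= T%:R ^+ q :> R by rewrite -natrX ler_nat.
  have Tq0 : 0 < T%:R ^+ q :> R by rewrite exprn_gt0.
  rewrite exprD.
  have -> : #|I|%:R * d.*2%:R * (T%:R * T%:R * (T%:R ^+ q * T%:R ^+ 4)^-1) * T%:R ^+ 2 =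
      (#|I|%:R / T%:R ^+ q) * d.*2%:R :> R.
    by field; rewrite !gt_eqF.
  by rewrite ler_piMl// ler_pdivrMr// mul1r.
move=> om; rewrite negb_exists => /forallP nbad t tT p i N0.
set N := nsel _ _ _; have N0' : 0 < N%:R :> R by rewrite ltr0n.
have [j jP] := net p.
have {}jP v : v \notin B j -> (dot p v.2 < v.1) = (dot (pk j) v.2 < v.1) /\
    (dot p v.2 <= v.1) = (dot (pk j) v.2 <= v.1).
  by move=> vB; apply: jP => Bv; move: vB; rewrite mem_set.
rewrite /= -/L.
set S1 := \sum_(s < t | _) _; set S2 := \sum_(s < t | _) _.
set c := expect (D k) _.
have EB : expect (D k) (iB j) <= T%:R^-1.
  by rewrite expect_indic// -lee_fin fineK ?B_le// fin_num_measure.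
have sqE : Num.sqrt (L * N%:R) = N%:R * Num.sqrt (L / N%:R).
  have -> : L * N%:R = N%:R ^+ 2 * (L / N%:R) by field; rewrite gt_eqF.
  by rewrite sqrtrM ?sqr_ge0// sqrtr_sqr ger0_norm ?ltW.
set e := Num.sqrt _.
have Te : T%:R^-1 <= e.
  have Ti0 : (0 : R) <= T%:R^-1 by rewrite invr_ge0 ltW.
  have sqle : T%:R^-1 ^+ 2 <= L / N%:R.
    rewrite ler_pdivlMr//; apply: le_trans L1.
    rewrite expr2 -mulrA mulr_ile1 ?mulr_ge0 ?ler0n//.
    - by rewrite invf_le1// ler1n (leq_trans _ T_ge2).
    - by rewrite ler_pdivrMl// mulr1 ler_nat (leq_trans (nsel_le _ _ _))// ltnW.
  by have := ler_wsqrtr sqle; rewrite sqrtr_sqr ger0_norm.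
have dev x : \sum_(s < t | theta s om == k) (f x (z s om) - expect (D k) (f x)) <=
    3 * (N%:R * e).
  by have [_ _ /(_ om (nbad x) t tT N0)] := badP x; rewrite -sqE.
have sumc (g : pair_type R d -> R) (a : R) :
    \sum_(s < t | theta s om == k) (g (z s om) - a) =
    \sum_(s < t | theta s om == k) g (z s om) - N%:R * a.
  rewrite sumrB; congr (_ - _); rewrite /N /nsel natr_sum mulr_suml [LHS]big_mkcond/=.
  by apply: eq_bigr => s _; case: eqP => _; rewrite ?mul1r ?mul0r.
split.
- have := dev (j, i, true); rewrite /f/= expectB//; last exact: bdm_cst.
  rewrite expect_cst.
  have cfl : c <= expect (D k) (fl (j, i)) + T%:R^-1.
    apply: le_trans (lerD (lexx _) EB); rewrite -expectD//.
    apply: expect_le => //; first exact: bdmD.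
    move=> v; rewrite /fl/= /iB indicE; case: (boolP (v \in B j)) => vB.
      by rewrite subrr mulr0 add0r; have /andP[] := ua01 i p v.
    rewrite subr0 mulr1 addr0 /accepts.
    by have [-> _] := jP _ vB.
  have S1fl : \sum_(s < t | theta s om == k) fl (j, i) (z s om) <= S1.
    apply: ler_sum => s _; rewrite /fl/= /iB indicE.
    case: (boolP (z s om \in B j)) => vB.
      by rewrite subrr mulr0; have /andP[] := ua01 i p (z s om).
    rewrite subr0 mulr1 /accepts.
    by have [-> _] := jP _ vB.
  rewrite (sumc (fun v => 1 - fl (j, i) v)) sumrB.
  have -> : \sum_(s < t | theta s om == k) (1 : R) = N%:R.
    rewrite /N /nsel natr_sum big_mkcond/=.
    by apply: eq_bigr => s _; case: eqP.
  move=> h; apply: (le_trans cfl).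
  have h' : expect (D k) (fl (j, i)) <= N%:R^-1 * S1 + 3 * e.
    by rewrite -(ler_pM2l N0') mulrDr mulVKf ?gt_eqF//; lra.
  lra.
- have := dev (j, i, false); rewrite /f/= sumc => h.
  have cfh : expect (D k) (fh (j, i)) <= T%:R^-1 + c.
    rewrite /c -expect_accepts_tie//.
    apply: le_trans (lerD EB (lexx _)); rewrite -expectD//.
    apply: expect_le => //; first exact: bdmD.
    move=> v; rewrite /fh/= /iB indicE; case: (boolP (v \in B j)) => vB.
      by rewrite subrr mul0r addr0 lerDl; have /andP[] := uat01 i p v.
    rewrite subr0 mul1r /accepts_tie.
    by have [_ ->] := jP _ vB.
  have S2fh : S2 <= \sum_(s < t | theta s om == k) fh (j, i) (z s om).
    apply: ler_sum => s _; rewrite /fh/= /iB indicE.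
    case: (boolP (z s om \in B j)) => vB.
      by rewrite subrr mul0r addr0; have /andP[] := uat01 i p (z s om).
    rewrite subr0 mul1r add0r /accepts_tie.
    by have [_ ->] := jP _ vB.
  rewrite -(ler_pM2l N0') mulVKf ?gt_eqF// mulrDr.
  have cfh' : N%:R * expect (D k) (fh (j, i)) <= N%:R * T%:R^-1 + N%:R * c.
    by rewrite -mulrDr ler_pM2l.
  have Te' : N%:R * T%:R^-1 <= N%:R * e by rewrite ler_pM2l.
  lra.
Qed.

End UniformAcceptance.

Lemma uniform_acceptance (R : realType) (d : nat) : exists q : nat,
  forall (K T : nat) (disp : measure_display) (Om : measurableType disp)
    (Pr : probability Om R) F (theta : nat -> Om -> 'I_K)
    (z : nat -> Om -> pair_type R d) (D : 'I_K -> probability (pair_type R d) R)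
    (u : 'I_d -> pair_type R d -> R),
  observations Pr F theta z D T -> (2 <= T)%N -> (K <= T)%N ->
  (forall k p, D k [set v | v.1 == dot p v.2] = 0%E) ->
  (forall i, measurable_fun setT (u i)) -> (forall i v, 0 <= u i v <= 1) ->
  exists bad : Om -> bool, [/\ measurable_fun setT bad,
    expect Pr (fun om => (bad om)%:R) <= d.*2%:R / T%:R &
    forall om, ~~ bad om -> forall t k, (t < T)%N ->
      acceptance_close theta z D T u q om t k].
Proof.
have [q qP] := price_net (R := R) (d := d).
exists (q + 4)%N => K T disp Om Pr F theta z D u obs T2 KT no_tie mu u01.
have T0 : (0 : R) < T%:R by rewrite ltr0n (leq_trans _ T2).
have /choice[bad badP] k : exists bad : Om -> bool, [/\ measurable_fun setT bad,
    expect Pr (fun om => (bad om)%:R) <= d.*2%:R / T%:R ^+ 2 &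
    forall om, ~~ bad om -> forall t, (t < T)%N ->
      acceptance_close theta z D T u (q + 4) om t k].
  have [I [pk [B [Ic mB B_le net]]]] := qP (D k) T T2.
  exact: (acceptance_close_single obs T2 no_tie mu u01 Ic mB B_le net).
have mbad k : measurable_fun setT (bad k) by have [] := badP k.
exists (fun om => [exists k, bad k om]); split.
- exact: measurable_exists.
- apply: le_trans (expect_exists_le Pr mbad) _.
  apply: (@le_trans _ _ (\sum_(k < K) d.*2%:R / T%:R ^+ 2)).
    by apply: ler_sum => k _; have [] := badP k.
  rewrite sumr_const card_ord -[leLHS]mulr_natl.
  have -> : K%:R * (d.*2%:R / T%:R ^+ 2) = (K%:R / T%:R) * (d.*2%:R / T%:R) :> R.
    by field; rewrite gt_eqF.
  rewrite ler_piMl//.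
  by rewrite ler_pdivrMr// mul1r ler_nat.
- move=> om; rewrite negb_exists => /forallP nbad t k tT.
  by have [_ _] := badP k; apply.
Qed.

(** * Saddle points and duality *)

Section Clipping.
Context {R : realType} {d : nat} (Rmax Amax : R).
Hypotheses (Rmax_ge0 : 0 <= Rmax) (Amax_ge0 : 0 <= Amax).
Implicit Types (v : pair_type R d) (p : d.-tuple R).

Definition clip (M x : R) : R := Num.min (Num.max x 0) M.

Definition clip_pair v : pair_type R d :=
  (clip Rmax v.1, [tuple clip Amax (tnth v.2 i) | i < d]).

Definition bounded_pair v : Prop :=
  0 <= v.1 <= Rmax /\ forall i, 0 <= tnth v.2 i <= Amax.

Lemma clip_ge0 M x : 0 <= M -> 0 <= clip M x <= M.
Proof. by move=> M0; rewrite /clip le_min M0 andbT ge_min lexx orbT le_max lexx orbT. Qed.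

Lemma clip_id M x : 0 <= x <= M -> clip M x = x.
Proof. by move=> /andP[x0 xM]; rewrite /clip (max_idPl x0) (min_idPl xM). Qed.

Lemma clip_pair_bounded v : bounded_pair (clip_pair v).
Proof. by split => [|i]; rewrite /= ?tnth_mktuple clip_ge0. Qed.

Lemma clip_pair_id v : bounded_pair v -> clip_pair v = v.
Proof.
case: v => r a [/= hr ha]; congr pair; first exact: clip_id.
by apply: eq_from_tnth => i; rewrite tnth_mktuple clip_id.
Qed.

Lemma measurable_clip {disp : measure_display} {T : measurableType disp} (f : T -> R) M :
  measurable_fun setT f -> measurable_fun setT (fun x => clip M (f x)).
Proof.
move=> mf; apply: measurable_minr; last exact: measurable_cst.
by apply: measurable_maxr => //; exact: measurable_cst.
Qed.

Lemma measurable_clip_pair : measurable_fun setT clip_pair.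
Proof.
apply: measurable_fun_pair; first exact: measurable_clip.
apply/measurable_fun_tnthP => i.
rewrite (_ : _ \o _ = fun v => clip Amax (tnth v.2 i)).
  by apply: measurable_clip; exact: measurable_res.
by apply/funext => v /=; rewrite tnth_mktuple.
Qed.

Lemma measurable_bounded_pair : measurable (bounded_pair : set (pair_type R d)).
Proof.
rewrite (_ : bounded_pair = [set v | (0 <= v.1 <= Rmax) &&
    [forall i, (0 <= tnth v.2 i <= Amax)]]).
  apply: measurable_setr; apply: measurable_and.
    by apply: measurable_and; exact: measurable_fun_ler.
  by apply: measurable_forall => i; apply: measurable_and;
    apply: measurable_fun_ler => //; exact: measurable_res.
by apply/seteqP; split => v /=; [move=> [-> /forallP] | move=> /andP[? /forallP]].
Qed.

Lemma expect_bounded_eq (mu : probability (pair_type R d) R) (f h : pair_type R d -> R) :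
  {ae mu, forall v, bounded_pair v} ->
  measurable_fun setT f -> measurable_fun setT h ->
  (forall v, bounded_pair v -> f v = h v) -> expect mu f = expect mu h.
Proof. by move=> bd mf mh fh; apply: ae_eq_expect => //; apply: filterS bd. Qed.

Lemma dot_ge0 p v : (forall i, 0 <= tnth p i) -> bounded_pair v -> 0 <= dot p v.2.
Proof.
move=> p0 [_ a0]; apply: sumr_ge0 => i _; rewrite mulr_ge0//.
by have /andP[] := a0 i.
Qed.

Lemma surplusE p v : surplus p v = (v.1 - dot p v.2) * accepts p v.
Proof.
rewrite /surplus /accepts -subr_gt0; case: ltP => h.
  by rewrite mulr1.
by rewrite mulr0.
Qed.

Lemma measurable_surplus p : measurable_fun setT (surplus p).
Proof.
apply: measurable_maxr; last exact: measurable_cst.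
by apply: measurable_funB => //; exact: measurable_dot.
Qed.

End Clipping.

Lemma finite_pos_lb {R : realType} (I : finType) (P : pred I) (f : I -> R) :
  (forall i, P i -> 0 < f i) ->
  exists2 s : R, 0 < s & s <= 1 /\ forall i, P i -> s <= f i.
Proof.
move=> f0; have [[i Pi fi]|noP] := finite_argmin P f.
  exists (Num.min 1 (f i)); first by rewrite lt_min ltr01 f0.
  split; first by rewrite ge_min lexx.
  by move=> j Pj; rewrite ge_min fi ?orbT.
by exists 1 => //; split => // i Pi; have := noP i; rewrite Pi.
Qed.

(** * First-order conditions at an empirical saddle point *)

Section SaddlePoint.
Context {R : realType} {d K : nat} (Rmax Amax : R).
Hypotheses (Rmax_gt0 : 0 < Rmax) (Amax_gt0 : 0 < Amax).
Variables (th : nat -> 'I_K) (z : nat -> pair_type R d) (t : nat).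
Hypothesis bz : forall s, (s < t)%N -> bounded_pair Rmax Amax (z s).

(** [ghat] is by definition the value at [surplus p], so the saddle property of the algorithm
    applies as it stands. *)
Definition empirical (k : 'I_K) (f : pair_type R d -> R) : R :=
  (maxn (nsel th t k) 1)%:R^-1 * \sum_(s < t | th s == k) f (z s).

Lemma empiricalD k f h :
  empirical k (fun v => f v + h v) = empirical k f + empirical k h.
Proof. by rewrite /empirical big_split/= mulrDr. Qed.

Lemma empiricalZ k (c : R) f : empirical k (fun v => c * f v) = c * empirical k f.
Proof. by rewrite /empirical -mulr_sumr mulrCA. Qed.

Lemma empirical_sum k (I : finType) (f : I -> pair_type R d -> R) :
  empirical k (fun v => \sum_i f i v) = \sum_i empirical k (f i).
Proof. by rewrite /empirical exchange_big/= mulr_sumr. Qed.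

Lemma eq_empirical k f h : (forall s, (s < t)%N -> f (z s) = h (z s)) ->
  empirical k f = empirical k h.
Proof. by move=> fh; congr (_ * _); apply: eq_bigr => s _; exact: fh. Qed.

Lemma empirical_ge0 k f : (forall s, (s < t)%N -> 0 <= f (z s)) -> 0 <= empirical k f.
Proof. by move=> f0; rewrite mulr_ge0 ?invr_ge0// sumr_ge0// => s _; exact: f0. Qed.

Lemma empirical_le k f (M : R) : 0 <= M -> (forall s, (s < t)%N -> f (z s) <= M) ->
  empirical k f <= M.
Proof.
move=> M0 fM; rewrite /empirical.
have n0 : (0 : R) < (maxn (nsel th t k) 1)%:R by rewrite ltr0n leq_max orbT.
rewrite ler_pdivrMl//; apply: (@le_trans _ _ ((nsel th t k)%:R * M)).
  rewrite /nsel natr_sum mulr_suml big_mkcond/=; apply: ler_sum => s _.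
  by case: eqP => _; rewrite ?mul0r ?mul1r//; exact: fM.
by rewrite ler_wpM2r// ler_nat leq_maxl.
Qed.

Variables (bs : d.-tuple R) (beta : 'I_K -> R) (w : 'I_K -> R) (p : d.-tuple R).
Let L (w : 'I_K -> R) (p : d.-tuple R) : R :=
  dot p bs + \sum_(k < K) w k * (empirical k (surplus p) + beta k).
Hypothesis sad : saddle_point L w p.

Let p_ge0 i : 0 <= tnth p i. Proof. by case: sad. Qed.
Let w_ge0 k : 0 <= w k. Proof. by have [[]] := sad. Qed.

(** First-order optimality without derivatives: the surplus is piecewise affine and there are
    finitely many observations, so for a small enough step the change of the objective is exactly
    linear in [s]. *)
Lemma perturbation (p' : d.-tuple R) (s : R) (dd : R) (h : pair_type R d -> R) :
  0 < s -> (forall i, 0 <= tnth p' i) -> dot p' bs = dot p bs + s * dd ->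
  (forall r, (r < t)%N -> surplus p' (z r) = surplus p (z r) + s * h (z r)) ->
  0 <= dd + \sum_(k < K) w k * empirical k h.
Proof.
move=> s0 p'0 dE sE; have [_ _ _ /(_ p' p'0)] := sad.
rewrite /L dE => Lp.
have E : \sum_(k < K) w k * (empirical k (surplus p') + beta k) =
    \sum_(k < K) w k * (empirical k (surplus p) + beta k) +
    s * \sum_(k < K) w k * empirical k h.
  rewrite mulr_sumr -big_split/=; apply: eq_bigr => k _.
  have -> : empirical k (surplus p') = empirical k (fun v => surplus p v + s * h v).
    exact: eq_empirical.
  by rewrite empiricalD empiricalZ; ring.
by rewrite -(pmulr_rge0 _ s0) mulrDr; lra.
Qed.

Lemma empirical_consumption i :
  \sum_(k < K) w k * empirical k (fun v => tnth v.2 i * accepts p v) <= tnth bs i.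
Proof.
(* Price [i] is raised by [s], so little that every accepted pair still has nonnegative surplus.
   Ties drop out on this side, which gives strict acceptance. *)
have [s s0 [_ sle]] := @finite_pos_lb R 'I_t (fun r => dot p (z r).2 < (z r).1)
  (fun r => ((z r).1 - dot p (z r).2) / Amax)
  (fun r h => divr_gt0 (etrans (subr_gt0 _ _) h) Amax_gt0).
have s0' := ltW s0.
pose p' := [tuple tnth p j + s * (j == i)%:R | j < d].
have dotE (a : d.-tuple R) : dot p' a = dot p a + s * tnth a i.
  rewrite /dot [in RHS](bigD1 i)//= [in LHS](bigD1 i)//= !tnth_mktuple eqxx.
  rewrite (eq_bigr (fun j => tnth p j * tnth a j)); first by rewrite mulr1; ring.
  by move=> j /negbTE ji; rewrite tnth_mktuple ji mulr0 addr0.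
have := @perturbation p' s (tnth bs i) (fun v => - (tnth v.2 i * accepts p v)).
have -> : \sum_(k < K) w k * empirical k (fun v => - (tnth v.2 i * accepts p v)) =
    - \sum_(k < K) w k * empirical k (fun v => tnth v.2 i * accepts p v).
  rewrite -sumrN; apply: eq_bigr => k _; rewrite -mulrN; congr (_ * _).
  by rewrite -[RHS]mulN1r -empiricalZ; apply: eq_empirical => r _; rewrite mulN1r.
rewrite subr_ge0; apply => //.
  by move=> j; rewrite tnth_mktuple addr_ge0// mulr_ge0.
move=> r rt; have [_ /(_ i)/andP[a0 aA]] := bz rt.
rewrite /surplus /accepts dotE.
case: (ltP (dot p (z r).2) (z r).1) => h.
  have := sle (Ordinal rt) h; rewrite /= ler_pdivlMr// => h'.
  have h2 : s * tnth (z r).2 i <= s * Amax by rewrite ler_wpM2l.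
  rewrite mulr1 !(max_idPl _) ?subr_ge0; [ring|exact: ltW|lra].
have h2 : 0 <= s * tnth (z r).2 i by rewrite mulr_ge0.
rewrite mulr0 oppr0 mulr0 addr0 !(max_idPr _) ?subr_le0//; lra.
Qed.

(** Scaling all prices by [1 - s] keeps them nonnegative and tests all coordinates at once. The step
    is small enough that no pair with negative [r - <p, a>] becomes acceptable, whereas ties gain
    surplus at once. *)
Lemma empirical_slackness :
  dot p bs <= \sum_(k < K) w k * empirical k (fun v => dot p v.2 * accepts_tie p v).
Proof.
have [s s0 [s1 sle]] := @finite_pos_lb R 'I_t (fun r => (z r).1 < dot p (z r).2)
  (fun r => (dot p (z r).2 - (z r).1) / dot p (z r).2)
  (fun r h => divr_gt0 (etrans (subr_gt0 _ _) h)
     (le_lt_trans (proj1 (andP (bz (ltn_ord r)).1)) h)).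
have s0' := ltW s0.
pose p' : d.-tuple R := [tuple (1 - s) * tnth p j | j < d].
have dotE (a : d.-tuple R) : dot p' a = dot p a - s * dot p a.
  rewrite -[X in X - _]mul1r -mulrBl /dot mulr_sumr.
  by apply: eq_bigr => j _; rewrite tnth_mktuple mulrA.
have := @perturbation p' s (- dot p bs) (fun v => dot p v.2 * accepts_tie p v).
rewrite [X in 0 <= X]addrC subr_ge0; apply => //.
- by move=> j; rewrite tnth_mktuple mulr_ge0// subr_ge0.
- by rewrite dotE mulrN.
move=> r rt; have dp := dot_ge0 p_ge0 (bz rt).
rewrite /surplus /accepts_tie dotE.
case: (leP (dot p (z r).2) (z r).1) => h.
  have h2 : 0 <= s * dot p (z r).2 by rewrite mulr_ge0.
  rewrite mulr1 !(max_idPl _) ?subr_ge0//; [ring|lra].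
have [[r0 _] _] := (bz rt, tt); have /andP[r0' _] := r0.
have := sle (Ordinal rt) h; rewrite /= ler_pdivlMr ?(le_lt_trans r0')// => h'.
rewrite !mulr0 addr0 !(max_idPr _) ?subr_le0//; lra.
Qed.

(** Comparison with the zero price, where the surplus is the reward itself, at most [Rmax]; the
    bonuses [beta k] cancel. *)
Lemma saddle_price_cost : dot p bs <= Rmax.
Proof.
pose p0 : d.-tuple R := [tuple 0 | j < d].
have dot0 (a : d.-tuple R) : dot p0 a = 0.
  by rewrite /dot big1// => j _; rewrite tnth_mktuple mul0r.
have [[_ w1] _ _ /(_ p0)] := sad.
have p00 i : 0 <= tnth p0 i by rewrite tnth_mktuple.
move=> /(_ p00); rewrite /L dot0 add0r => Lp.
have h : \sum_(k < K) w k * (empirical k (surplus p0) + beta k) <=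
    Rmax + \sum_(k < K) w k * (empirical k (surplus p) + beta k).
  rewrite -[X in X + _]mul1r -w1 mulr_suml -big_split/=; apply: ler_sum => k _.
  rewrite -mulrDr ler_wpM2l// addrA lerD2r.
  have e1 : empirical k (surplus p0) <= Rmax.
    apply: empirical_le; first exact: ltW.
    move=> s /bz[/andP[h1 h2] _]; rewrite /surplus dot0 subr0.
    by rewrite (max_idPl h1).
  have e2 : 0 <= empirical k (surplus p).
    by apply: empirical_ge0 => s _; rewrite /surplus le_max lexx orbT.
  lra.
lra.
Qed.

End SaddlePoint.

(** * The mixture benchmark and weak duality *)

Section Benchmark.
Context {R : realType} {d K : nat} (Rmax Amax : R).
Hypotheses (Rmax_gt0 : 0 < Rmax) (Amax_gt0 : 0 < Amax).
Variables (D : 'I_K -> probability (pair_type R d) R) (b : d.-tuple R).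
Hypothesis bD : bounded_laws D Rmax Amax.
Hypothesis K_gt0 : (0 < K)%N.
Hypothesis b_ge0 : forall i, 0 <= tnth b i.

Local Notation clz := (clip_pair Rmax Amax : pair_type R d -> pair_type R d).

Let bdD k : {ae D k, forall v, bounded_pair Rmax Amax v}. Proof. exact: bD. Qed.

Let clzP v : bounded_pair Rmax Amax (clz v).
Proof. by apply: clip_pair_bounded; exact: ltW. Qed.

Lemma bdm_reward : bdm (fun v => (clz v).1).
Proof.
split; first by apply: (measurableT_comp measurable_fst); exact: measurable_clip_pair.
by exists Rmax => v; have [/andP[h1 h2] _] := clzP v; rewrite ger0_norm.
Qed.

Lemma bdm_resource i : bdm (fun v => tnth (clz v).2 i).
Proof.
split; last by exists Amax => v; have [_ /(_ i)/andP[h1 h2]] := clzP v; rewrite ger0_norm.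
exact: (measurableT_comp (measurable_res i) (measurable_clip_pair _ _)).
Qed.

Lemma bdm_dot_clz p : bdm (fun v => dot p (clz v).2).
Proof. by apply: bdm_sum => i _; apply: bdmZ; exact: bdm_resource. Qed.

Let m_reward_x (x : pair_type R d -> R) : measurable_fun setT x ->
  measurable_fun setT (fun v : pair_type R d => v.1 * x v).
Proof. by move=> mx; exact: measurable_funM. Qed.

Let bdm_unit (x : pair_type R d -> R) : measurable_fun setT x ->
  (forall v, 0 <= x v <= 1) -> bdm x.
Proof. by move=> mx x01; split => //; exists 1 => v; rewrite ger0_norm; have /andP[] := x01 v. Qed.

Lemma expect_reward_clip (k : 'I_K) (x : pair_type R d -> R) :
  measurable_fun setT x -> (forall v, 0 <= x v <= 1) ->
  expect (D k) (fun v => v.1 * x v) = expect (D k) (fun v => (clz v).1 * x v).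
Proof.
move=> mx x01; apply: (expect_bounded_eq (bdD k)).
- exact: m_reward_x.
- by apply: measurable_funM => //; case: bdm_reward.
- by move=> v bv; rewrite clip_pair_id.
Qed.

Lemma expect_resource_clip (k : 'I_K) (i : 'I_d) (x : pair_type R d -> R) :
  measurable_fun setT x -> (forall v, 0 <= x v <= 1) ->
  expect (D k) (fun v => tnth v.2 i * x v) = expect (D k) (fun v => tnth (clz v).2 i * x v).
Proof.
move=> mx x01; apply: (expect_bounded_eq (bdD k)).
- by apply: measurable_funM => //; exact: measurable_res.
- by apply: measurable_funM => //; case: (bdm_resource i).
- by move=> v bv; rewrite clip_pair_id.
Qed.

Lemma g_clip k p : g D k p = expect (D k) (fun v => surplus p (clz v)).
Proof.
apply: (expect_bounded_eq (bdD k)).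
- exact: measurable_surplus.
- exact: (measurableT_comp (measurable_surplus p) (measurable_clip_pair _ _)).
- by move=> v bv; rewrite clip_pair_id.
Qed.

Lemma g_ge0 k p : 0 <= g D k p.
Proof. by apply: expect_ge0 => v; rewrite /surplus le_max lexx orbT. Qed.

Lemma bdm_surplus_clz p : bdm (fun v => surplus p (clz v)).
Proof.
have -> : (fun v => surplus p (clz v)) =
    (fun v => ((clz v).1 - dot p (clz v).2) * accepts p (clz v)).
  by apply/funext => v; rewrite surplusE.
apply: bdmM; last exact: (bdm_comp (bdm_accepts p) (measurable_clip_pair _ _)).
by apply: bdmB; [exact: bdm_reward | exact: bdm_dot_clz].
Qed.

(** Pointwise, [r * x] is at most the surplus plus [<p, a> * x]; averaging and feasibility give the
    bound for [b]. Multiplying by [1 - eps] turns [b] into the safe budget, and the nonnegative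
    surplus term may keep its full weight. The mixture is that of the feasible point, which explains
    the later comparison with the maximizing one. *)
Lemma weak_duality v (eps : R) (p : d.-tuple R) : mix_values D b v ->
  0 <= eps <= 1 -> (forall i, 0 <= tnth p i) ->
  exists2 w, simplex w &
    (1 - eps) * v <= dot p (bsafe eps b) + \sum_(k < K) w k * g D k p.
Proof.
move=> [w [x [sw xP feas ->]]] /andP[e0 e1] p0; exists w => //.
have [w0 w1] := sw.
have bx k : bdm (x k) by have [mx x01] := xP k; exact: bdm_unit.
have dual k : expect (D k) (fun v => v.1 * x k v) <=
    g D k p + \sum_i tnth p i * expect (D k) (fun v => tnth v.2 i * x k v).
  have [mx x01] := xP k; rewrite expect_reward_clip// g_clip.
  have bax i : bdm (fun v => tnth (clz v).2 i * x k v).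
    by apply: bdmM => //; exact: bdm_resource.
  have -> : \sum_i tnth p i * expect (D k) (fun v => tnth v.2 i * x k v) =
      \sum_i expect (D k) (fun v => tnth p i * (tnth (clz v).2 i * x k v)).
    by apply: eq_bigr => i _; rewrite expectZ// expect_resource_clip.
  rewrite -expect_sum => [|i _]; last exact: bdmZ.
  have bs : bdm (fun v => \sum_i tnth p i * (tnth (clz v).2 i * x k v)).
    by apply: bdm_sum => i _; exact: bdmZ.
  rewrite -expectD//; last exact: bdm_surplus_clz.
  apply: expect_le => //.
  - by apply: bdmM => //; exact: bdm_reward.
  - by apply: bdmD => //; exact: bdm_surplus_clz.
  - move=> u; have -> : \sum_i tnth p i * (tnth (clz u).2 i * x k u) = dot p (clz u).2 * x k u.
      by rewrite /dot mulr_suml; apply: eq_bigr => i _; rewrite mulrA.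
    have /andP[h1 h2] := x01 u; rewrite -lerBlDr -mulrBl /surplus.
    case: (leP 0 ((clz u).1 - dot p (clz u).2)) => h.
      by rewrite ler_piMr.
    by rewrite mulr_le0_ge0// ltW.
have dotb : dot p (bsafe eps b) = (1 - eps) * dot p b.
  by rewrite /dot mulr_sumr; apply: eq_bigr => i _; rewrite tnth_mktuple mulrCA.
have eps1 : 0 <= 1 - eps by lra.
have G0 : 0 <= \sum_(k < K) w k * g D k p.
  by apply: sumr_ge0 => k _; rewrite mulr_ge0// g_ge0.
have : \sum_(k < K) w k * expect (D k) (fun v => v.1 * x k v) <=
    \sum_(k < K) w k * g D k p + dot p b.
  apply: (@le_trans _ _ (\sum_(k < K) w k * (g D k p +
      \sum_i tnth p i * expect (D k) (fun v => tnth v.2 i * x k v)))).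
    by apply: ler_sum => k _; rewrite ler_wpM2l.
  under eq_bigr do rewrite mulrDr mulr_sumr.
  rewrite big_split/= lerD2l exchange_big/= /dot; apply: ler_sum => i _.
  under eq_bigr do rewrite mulrCA.
  by rewrite -mulr_sumr ler_wpM2l// feas.
rewrite dotb => /(ler_wpM2l eps1); rewrite mulrDr => h.
apply: (le_trans h); rewrite addrC lerD2l ler_piMl//; lra.
Qed.

Lemma mix_values0 : mix_values D b 0.
Proof.
pose k0 := Ordinal K_gt0.
exists (fun k => (k == k0)%:R), (fun _ _ => 0); split.
- split=> [k|]; first exact: ler0n.
  by rewrite (bigD1 k0)//= big1 ?addr0 ?eqxx// => k /negbTE ->.
- by move=> k; split; [exact: measurable_cst | move=> v; rewrite lexx ler01].
- move=> i; rewrite big1// => k _; rewrite (eq_expect _ (h := fun=> 0)).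
    by rewrite expect_cst mulr0.
  by move=> v; rewrite mulr0.
- rewrite big1// => k _; rewrite (eq_expect _ (h := fun=> 0)).
    by rewrite expect_cst mulr0.
  by move=> v; rewrite mulr0.
Qed.

Lemma mix_values_le v : mix_values D b v -> v <= Rmax.
Proof.
move=> [w [x [[w0 w1] xP _ ->]]].
rewrite -[leRHS]mul1r -w1 mulr_suml; apply: ler_sum => k _; rewrite ler_wpM2l//.
have [mx x01] := xP k; rewrite expect_reward_clip//.
rewrite -[leRHS](expect_cst (D k)); apply: expect_le.
- by apply: bdmM; [exact: bdm_reward | exact: bdm_unit].
- exact: bdm_cst.
- move=> u; have [/andP[h1 h2] _] := clzP u; have /andP[h3 h4] := x01 u.
  by rewrite (le_trans _ h2)// ler_piMr.
Qed.

Lemma Vmix_ge0 : 0 <= Vmix D b.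
Proof.
apply: ub_le_sup; last exact: mix_values0.
by exists Rmax => v; exact: mix_values_le.
Qed.

Lemma Vmix_le (M : R) : (forall v, mix_values D b v -> v <= M) -> Vmix D b <= M.
Proof. by move=> vM; apply: ge_sup; [exists 0; exact: mix_values0 | exact: vM]. Qed.

Lemma Vmix_le_Rmax : Vmix D b <= Rmax.
Proof. exact/Vmix_le/mix_values_le. Qed.

End Benchmark.

(** Each new selection costs [1 / sqrt n <= 3 * (sqrt n.+1 - sqrt n)], because
    [sqrt n.+1 <= 2 * sqrt n] for [n >= 1]. The weight uses the count before the selection; the very
    first one costs 1 by the convention [maxn _ 1]. *)
Lemma sum_inv_sqrt_le {R : realType} {K : nat} (th : nat -> 'I_K) (k : 'I_K) t :
  \sum_(s < t) (th s == k)%:R / Num.sqrt (maxn (nsel th s k) 1)%:R <=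
  3 * Num.sqrt (nsel th t k)%:R :> R.
Proof.
elim: t => [|t IH]; first by rewrite big_ord0 mulr_ge0// sqrtr_ge0.
rewrite big_ord_recr/=; have -> : nsel th t.+1 k = (nsel th t k + (th t == k))%N.
  by rewrite /nsel big_ord_recr.
case: eqP => _; last by rewrite mul0r addr0 addn0.
rewrite mul1r addn1; apply: le_trans (lerD IH (lexx _)) _.
case: (nsel th t k) => [|n]; first by rewrite (maxn_idPr _)// sqrtr0 mulr0 add0r !sqrtr1; lra.
rewrite (maxn_idPl _)//.
set x : R := Num.sqrt n.+1%:R; set y : R := Num.sqrt n.+2%:R.
have x1 : 1 <= x by rewrite -sqrtr1 ler_wsqrtr// ler1n.
have xx : x ^+ 2 = n.+1%:R by rewrite sqr_sqrtr.
have yy : y ^+ 2 = n.+2%:R by rewrite sqr_sqrtr.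
have y0 : 0 <= y by exact: sqrtr_ge0.
have yx : y ^+ 2 = x ^+ 2 + 1 by rewrite xx yy natr1.
have y2x : y <= 2 * x by rewrite leNgt; apply/negP => h; nra.
have x0 : 0 < x by lra.
have key : x^-1 * x = 1 by rewrite mulVf// gt_eqF.
have xi0 : 0 < x^-1 by rewrite invr_gt0.
have : (y - x) * (y + x) = 1 by nra.
have : (x^-1) <= 3 * (y - x).
  rewrite -(ler_pM2r x0) key.
  nra.
lra.
Qed.

(** * The run of the algorithm *)

Section OneStep.
Context {R : realType} {d K : nat} {disp : measure_display}
  {Om : measurableType disp}.
Variables (Pr : probability Om R) (F : nat -> set (set Om)).
Variables (theta : nat -> Om -> 'I_K) (z : nat -> Om -> pair_type R d).
Variables (D : 'I_K -> probability (pair_type R d) R) (T : nat).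
Variables (w : nat -> Om -> 'I_K -> R) (p : nat -> Om -> d.-tuple R).

Local Notation GT t := (g_sigma_algebraType (F t)).

(** The saddle property refers to the original observations and is kept out, so that this record
    also holds for the clipped ones. *)
Record run_core : Prop := {
  core_obs : observations Pr F theta z D T ;
  core_w : forall t, (K <= t < T)%N -> forall k (A : set R),
    measurable A -> F t ((fun om => w t om k) @^-1` A) ;
  core_p : forall t, (K <= t < T)%N ->
    forall A, measurable A -> F t (p t @^-1` A) ;
  core_simplex : forall t, (K <= t < T)%N -> forall om, simplex (w t om) ;
  core_draw : forall t, (K <= t < T)%N -> forall E k, F t E ->
    Pr (E `&` theta t @^-1` [set k]) = (\int[Pr]_(om in E) (w t om k)%:E)%E }.

Hypothesis core : run_core.

Let obs := core_obs core.
Let sig t : sigma_algebra setT (F t). Proof. exact: (obs_sigma obs). Qed.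
Let Fm t : F t `<=` measurable. Proof. exact: (obs_measurable obs). Qed.

Lemma simplex_le1 (v : 'I_K -> R) k : simplex v -> 0 <= v k <= 1.
Proof.
move=> [v0 v1]; rewrite v0/= -v1 (bigD1 k)//= lerDl.
by apply: sumr_ge0.
Qed.

Lemma bdm_w t k : (K <= t < T)%N -> @bdm _ (GT t) R (fun om => w t om k).
Proof.
move=> tT; split; first by apply: (measurable_fun_GT (sig t)) => A mA; exact: (core_w core).
exists 1 => om; have /andP[h1 h2] := simplex_le1 k (core_simplex core tT om).
by rewrite ger0_norm.
Qed.

Lemma measurable_p t : (K <= t < T)%N -> measurable_fun setT (p t : GT t -> _).
Proof. by move=> tT; apply: (measurable_fun_GT (sig t)) => A mA; exact: (core_p core). Qed.

(** A version of the conditional expectation of [h (om, z t om)] given [F t]: the configuration is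
    drawn from [w t], then the pair from its law. *)
Definition step_mean t (h : Om * pair_type R d -> R) om : R :=
  \sum_(k < K) w t om k * expect (D k) (fun v => h (om, v)).

Lemma bdm_step_mean t (h : GT t * pair_type R d -> R) : (K <= t < T)%N -> bdm h ->
  @bdm _ (GT t) R (step_mean t h).
Proof.
move=> tT bh; apply: bdm_sum => k _; apply: bdmM; first exact: bdm_w.
exact: bdm_expect_section.
Qed.

Lemma indic_theta t k om : \1_(theta t @^-1` [set k]) om = (theta t om == k)%:R :> R.
Proof. by rewrite indicE; case: eqP => h; [rewrite mem_set | rewrite memNset]. Qed.

Lemma draw_mean t k (Y : Om -> R) : (K <= t < T)%N -> @bdm _ (GT t) R Y ->
  expect Pr (fun om => (theta t om == k)%:R * Y om) = expect Pr (fun om => w t om k * Y om).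
Proof.
move=> tT bY; have /andP[_ tT'] := tT.
rewrite -(draw_expect (sig t) (@Fm t) (measurable_theta obs k tT') (bdm_w k tT) _ _ bY).
- by apply: eq_expect => om; rewrite indic_theta.
- by move=> om; have /andP[] := simplex_le1 k (core_simplex core tT om).
- by move=> E FE; exact: (core_draw core).
Qed.

Lemma bdm_observe t (h : GT t * pair_type R d -> R) : (t < T)%N -> bdm h ->
  @bdm _ (GT t.+1) R (fun om => h (om, z t om)).
Proof.
move=> tT bh.
have mi : measurable_fun setT (idfun : GT t.+1 -> GT t).
  apply: (measurable_fun_GT (sig t.+1)) => A; rewrite (measurable_GTE (sig t)).
  exact: (obs_mono obs (leqnSn t)).
have mz : measurable_fun setT (z t : GT t.+1 -> _).
  by apply: (adapted_z obs); rewrite ltnSn.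
exact: (bdm_comp bh (measurable_fun_pair mi mz)).
Qed.

Lemma expect_step t (h : GT t * pair_type R d -> R) : (K <= t < T)%N -> bdm h ->
  expect Pr (fun om => h (om, z t om)) = expect Pr (step_mean t h).
Proof.
move=> tT bh; have /andP[_ tT'] := tT.
have mth k : measurable (theta t @^-1` [set k]) by exact: (measurable_theta obs).
have bhz := bdm_from_GT (sig t.+1) (@Fm t.+1) (bdm_observe tT' bh).
have bY k := bdm_expect_section (D k) bh.
transitivity (\sum_(k < K) expect Pr (fun om => \1_(theta t @^-1` [set k]) om * h (om, z t om))).
  rewrite -expect_sum => [|k _]; last by apply: bdmM => //; exact: bdm_indic.
  apply: eq_expect => om; rewrite (bigD1 (theta t om))//= big1 ?addr0.
    by rewrite indic_theta eqxx mul1r.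
  by move=> k kt; rewrite indic_theta eq_sym (negbTE kt) mul0r.
transitivity (\sum_(k < K) expect Pr (fun om => w t om k * expect (D k) (fun v => h (om, v)))).
  apply: eq_bigr => k _.
  rewrite (freeze_expect (sig t) (@Fm t) (D := D k) (mth k) (measurable_z obs tT') _ bh).
    rewrite -draw_mean//; by apply: eq_expect => om; rewrite indic_theta.
  by move=> E B FE mB; exact: (obs_law obs).
rewrite -expect_sum// => k _; apply: (bdm_from_GT (sig t) (@Fm t)).
by apply: bdmM; [exact: bdm_w | exact: bY].
Qed.

Lemma bdm_mono s t (f : Om -> R) : (s <= t)%N -> @bdm _ (GT s) R f -> @bdm _ (GT t) R f.
Proof. by move=> st [mf bf]; split => //; exact: (adapted_mono obs st). Qed.

Lemma bdm_Om t (f : Om -> R) : @bdm _ (GT t) R f -> bdm f.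
Proof. by move=> bf; exact: (bdm_from_GT (sig t) (@Fm t)). Qed.

Lemma expect_stepM t (Y : Om -> R) (h : GT t * pair_type R d -> R) :
  (K <= t < T)%N -> @bdm _ (GT t) R Y -> bdm h ->
  expect Pr (fun om => Y om * h (om, z t om)) = expect Pr (fun om => Y om * step_mean t h om).
Proof.
move=> tT bY bh.
have bYh : bdm (fun x : GT t * pair_type R d => Y x.1 * h x).
  by apply: bdmM => //; exact: (bdm_comp bY measurable_fst).
rewrite (expect_step tT bYh); apply: eq_expect => om.
rewrite /step_mean mulr_sumr; apply: eq_bigr => k _.
by rewrite /= (expectZ _ _ (bdm_section om bh)); ring.
Qed.

Lemma step_mean_bounds t (h : GT t * pair_type R d -> R) (B : R) om : (K <= t < T)%N ->
  bdm h -> (forall x, 0 <= h x <= B) -> 0 <= step_mean t h om <= B.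
Proof.
move=> tT bh hB; have [w0 w1] := core_simplex core tT om.
apply/andP; split.
  apply: sumr_ge0 => k _; rewrite mulr_ge0//; apply: expect_ge0 => v.
  by have /andP[] := hB (om, v).
rewrite -[leRHS]mul1r -w1 mulr_suml; apply: ler_sum => k _; rewrite ler_wpM2l//.
rewrite -[leRHS](expect_cst (D k)); apply: expect_le.
- exact: bdm_section.
- exact: bdm_cst.
- by move=> v; have /andP[] := hB (om, v).
Qed.

Section Martingale.
Variables (A : nat -> Om -> R) (h : nat -> Om * pair_type R d -> R) (B : R).
Hypotheses (bA : forall t, (K <= t < T)%N -> @bdm _ (GT t) R (A t))
  (A01 : forall t om, 0 <= A t om <= 1).
Hypotheses (bh : forall t, (K <= t < T)%N -> @bdm _ (GT t * pair_type R d)%type R (h t))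
  (hB : forall t x, 0 <= h t x <= B).

Definition noise t om : R := A t om * (h t (om, z t om) - step_mean t (h t) om).

Definition martingale n om : R := \sum_(t < n | (K <= t)%N) noise t om.

Let bdm_noise t : (K <= t < T)%N -> @bdm _ (GT t.+1) R (noise t).
Proof.
move=> tT; have /andP[_ tT'] := tT.
apply: bdmM; first exact: (bdm_mono (leqnSn t) (bA tT)).
apply: bdmB; first exact: (bdm_observe tT' (bh tT)).
exact: (bdm_mono (leqnSn t) (bdm_step_mean tT (bh tT))).
Qed.

Lemma bdm_martingale n : (n <= T)%N -> @bdm _ (GT n) R (martingale n).
Proof.
move=> nT; apply: bdm_sum => t Kt; have tn := ltn_ord t.
apply: (bdm_mono tn); apply: bdm_noise; rewrite Kt/=; exact: leq_trans nT.
Qed.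

(** Increments are orthogonal, since [martingale n * A n] is known at the start of round [n]. Each
    is at most [B] in absolute value, being a difference of two numbers in [[0, B]] times a factor
    in [[0, 1]]. *)
Lemma martingale_sq n : (n <= T)%N ->
  expect Pr (fun om => martingale n om ^+ 2) <= n%:R * B ^+ 2.
Proof.
elim: n => [|n IH] nT.
  by rewrite (eq_expect _ (h := fun=> 0)) ?expect_cst ?mul0r// => om;
    rewrite /martingale big_ord0 expr0n.
have {}IH := IH (ltnW nT).
have ME om : martingale n.+1 om = martingale n om + (if (K <= n)%N then noise n om else 0).
  by rewrite /martingale big_mkcond big_ord_recr/= -big_mkcond.
have [Kn|nK] := boolP (K <= n)%N; last first.
  rewrite (eq_expect _ (h := fun om => martingale n om ^+ 2)).
    by apply: le_trans IH _; rewrite ler_wpM2r ?sqr_ge0// ler_nat.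
  by move=> om; rewrite ME (negbTE nK) addr0.
have tT : (K <= n < T)%N by rewrite Kn.
have bM := bdm_martingale (ltnW nT).
have bMA : @bdm _ (GT n) R (fun om => martingale n om * A n om) by exact: (bdmM bM (bA tT)).
have bN := bdm_Om (bdm_noise tT).
have bM' := bdm_Om bM.
have bsm := bdm_Om (bdm_step_mean tT (bh tT)).
have bMA' := bdm_Om bMA.
have bho := bdm_Om (bdm_observe nT (bh tT)).
have cross : expect Pr (fun om => martingale n om * noise n om) = 0.
  rewrite (eq_expect _ (h := fun om => martingale n om * A n om * h n (om, z n om) -
     martingale n om * A n om * step_mean n (h n) om)).
    rewrite (expectB _ (bdmM bMA' bho) (bdmM bMA' bsm)).
    by rewrite (expect_stepM tT bMA (bh tT)) subrr.
  by move=> om; rewrite /noise; ring.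
rewrite (eq_expect _ (h := fun om => martingale n om ^+ 2 +
    (2 * (martingale n om * noise n om) + noise n om ^+ 2))); last first.
  by move=> om; rewrite ME Kn; ring.
rewrite expectD; [|exact: bdmX|apply: bdmD; [by apply: bdmZ; exact: bdmM|exact: bdmX]].
rewrite expectD; [|by apply: bdmZ; exact: bdmM|exact: bdmX].
rewrite expectZ ?cross ?mulr0 ?add0r; last exact: bdmM.
rewrite -natr1 mulrDl mul1r; apply: lerD => //.
rewrite -[leRHS](expect_cst Pr); apply: expect_le; [exact: bdmX|exact: bdm_cst|move=> om].
have /andP[h0 hB1] := hB n (om, z n om).
have /andP[s0 sB] := step_mean_bounds om tT (bh tT) (hB n).
have /andP[a0 a1] := A01 n om.
have B0 : 0 <= B by exact: le_trans hB1.
rewrite -[leRHS]ger0_norm ?sqr_ge0// -[leLHS]ger0_norm ?sqr_ge0// !normrX.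
rewrite ler_pXn2r ?nnegrE// /noise normrM (ger0_norm B0) (ger0_norm a0).
apply: le_trans (ler_piMl (normr_ge0 _) a1) _.
rewrite ler_norml; apply/andP; split; lra.
Qed.

Lemma expect_norm_martingale : expect Pr (fun om => `|martingale T om|) <= `|B| * Num.sqrt T%:R.
Proof.
have bM := bdm_Om (bdm_martingale (leqnn T)).
have [->|T0] := posnP T.
  rewrite (eq_expect _ (h := fun=> 0)) ?expect_cst ?mulr_ge0 ?sqrtr_ge0// => om.
  by rewrite /martingale big_ord0 normr0.
have [B0|B0] := eqVneq B 0.
  have M2 := martingale_sq (leqnn T); rewrite B0 normr0 mul0r.
  rewrite (eq_expect _ (h := fun=> 0)) ?expect_cst// => om.
  rewrite /martingale big1 ?normr0// => t Kt; rewrite /noise.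
  have tT : (K <= t < T)%N by rewrite Kt ltn_ord.
  have /andP[h0 hB1] := hB t (om, z t om).
  have /andP[s0 sB] := step_mean_bounds om tT (bh tT) (hB t).
  by rewrite (_ : h t _ - _ = 0) ?mulr0//; lra.
(* With [s ^+ 2] the bound on the second moment, [|m| <= m ^+ 2 / (2 * s) + s / 2] passes from the
   second moment to the first; it needs [s > 0], hence the separate cases above. *)
pose s : R := `|B| * Num.sqrt T%:R.
have s0 : 0 < s by rewrite mulr_gt0 ?normr_gt0// sqrtr_gt0 ltr0n.
have ss : s ^+ 2 = T%:R * B ^+ 2 by rewrite exprMn sqr_sqrtr// real_normK ?num_real// mulrC.
apply: (@le_trans _ _ (expect Pr (fun om => (2 * s)^-1 * martingale T om ^+ 2 + s / 2))).
  apply: expect_le; [exact: bdm_norm| |].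
    by apply: bdmD; [by apply: bdmZ; exact: bdmX | exact: bdm_cst].
  move=> om; have X0 : 0 <= (2 * s)^-1 by rewrite invr_ge0 mulr_ge0// ltW.
  have Xs : (2 * s)^-1 * s = 2^-1 by field; rewrite gt_eqF.
  rewrite -[martingale T om ^+ 2](real_normK (num_real _)).
  set m := `|_|; have := mulr_ge0 X0 (sqr_ge0 (m - s)).
  have -> : (2 * s)^-1 * (m - s) ^+ 2 = (2 * s)^-1 * m ^+ 2
    - 2 * ((2 * s)^-1 * s) * m + (2 * s)^-1 * s * s by ring.
  rewrite Xs; lra.
rewrite expectD; [|by apply: bdmZ; exact: bdmX|exact: bdm_cst].
rewrite (expectZ _ _ (bdmX 2 bM)) expect_cst.
have := martingale_sq (leqnn T); rewrite -ss -/s => h1.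
have s2 : (0 : R) < (2 * s)^-1 by rewrite invr_gt0 mulr_gt0.
have sE : s = (2 * s)^-1 * s ^+ 2 + s / 2 by field; rewrite gt_eqF.
rewrite -/s [leRHS]sE.
by rewrite lerD2r ler_pM2l.
Qed.

End Martingale.

End OneStep.

(** * The budget *)

Lemma bmin_le {R : realType} {d : nat} (b : d.-tuple R) i : bmin b <= tnth b i.
Proof.
apply: ge_inf; last by exists i.
exists (- \sum_(j < d) `|tnth b j|) => _ [j _ <-].
rewrite lerNl (le_trans (ler_norm _))// normrN (bigD1 j)//= lerDl.
by apply: sumr_ge0.
Qed.

Lemma sum_nsel {K : nat} (th : nat -> 'I_K) t : (\sum_(k < K) nsel th t k = t)%N.
Proof.
rewrite /nsel exchange_big/= (eq_bigr (fun=> 1%N)) ?sum_nat_const ?card_ord ?muln1// => s _.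
by rewrite (bigD1 (th s))//= eqxx big1// => k; rewrite eq_sym => /negbTE ->.
Qed.

Lemma sum_sqrt_nsel {R : realType} {K : nat} (th : nat -> 'I_K) t : (0 < t)%N ->
  \sum_(k < K) Num.sqrt (nsel th t k)%:R <= Num.sqrt (K%:R * t%:R) :> R.
Proof.
move=> t0; have K0 : (0 < K)%N by case: K th => // th; case: (th 0%N).
have K0' : (0 : R) < K%:R by rewrite ltr0n.
set x : R := Num.sqrt _.
have x0 : 0 < x by rewrite sqrtr_gt0 mulr_gt0 ?ltr0n.
have xx : x ^+ 2 = K%:R * t%:R by rewrite sqr_sqrtr// mulr_ge0.
(* AM-GM: [2 sqrt n <= n K / x + x / K] *)
apply: (@le_trans _ _ (\sum_(k < K) (K%:R / (2 * x) * (nsel th t k)%:R + x / (2 * K%:R)))).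
  apply: ler_sum => k _; set n : R := (nsel th t k)%:R.
  have nn : Num.sqrt n ^+ 2 = n by rewrite sqr_sqrtr// ler0n.
  rewrite -[X in _ * X + _]nn; move: (Num.sqrt n) => y.
  have c0 : 0 <= (2 * x * K%:R)^-1 by rewrite invr_ge0 !mulr_ge0// ltW.
  have := mulr_ge0 c0 (sqr_ge0 (K%:R * y - x)); rewrite -subr_ge0.
  congr (0 <= _); field; by rewrite !gt_eqF.
rewrite big_split/= -mulr_sumr -natr_sum sum_nsel sumr_const card_ord -[X in _ + X]mulr_natl.
have -> : t%:R = x ^+ 2 / K%:R by rewrite xx mulrC mulKf ?gt_eqF.
by rewrite le_eqVlt; apply/orP; left; apply/eqP; field; rewrite !gt_eqF.
Qed.

Lemma sum_late {R : realType} (K T : nat) :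
  \sum_(t < T | (K <= t)%N) 1 = (T - K)%:R :> R.
Proof.
elim: T => [|T IH]; first by rewrite big_ord0.
rewrite big_mkcond big_ord_recr/= -big_mkcond IH; case: leqP => h.
  by rewrite subSn// natr1.
have /eqP h1 : (T.+1 - K == 0)%N by rewrite subn_eq0.
have /eqP h2 : (T - K == 0)%N by rewrite subn_eq0 ltnW.
by rewrite h1 h2 addr0.
Qed.

Section Budget.
Context {R : realType} {d K : nat} {disp : measure_display}
  {Om : measurableType disp}.
Variables (Pr : probability Om R) (F : nat -> set (set Om)).
Variables (theta : nat -> Om -> 'I_K) (z : nat -> Om -> pair_type R d).
Variables (D : 'I_K -> probability (pair_type R d) R) (T : nat).
Variables (w : nat -> Om -> 'I_K -> R) (p : nat -> Om -> d.-tuple R).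
Hypothesis core : run_core Pr F theta z D T w p.
Variables (Rmax Amax : R) (b : d.-tuple R).
Hypotheses (Rmax_gt0 : 0 < Rmax) (Amax_gt0 : 0 < Amax) (bmin_gt0 : 0 < bmin b).
Hypothesis bz : forall t om, bounded_pair Rmax Amax (z t om).

Local Notation GT t := (g_sigma_algebraType (F t)).
Local Notation clz := (clip_pair Rmax Amax : pair_type R d -> pair_type R d).

Let obs := core_obs core.
Let sig t : sigma_algebra setT (F t). Proof. exact: (obs_sigma obs). Qed.

Definition rem t om : d.-tuple R := remaining K T b (p ^~ om) (z ^~ om) t.

Definition alive t om : bool := [forall i, Amax <= tnth (rem t om) i].

(** Clipping makes this bounded at every pair, as integration over the second component requires; on
    the observations, which are bounded in this section, it has no effect. *)
Definition consumption i t (x : Om * pair_type R d) : R :=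
  tnth (clz x.2).2 i * accepts (p t x.1) x.2.

Definition reward t (x : Om * pair_type R d) : R := (clz x.2).1 * accepts (p t x.1) x.2.

Lemma clz_z t om : clz (z t om) = z t om.
Proof. exact: clip_pair_id. Qed.

Lemma reward_z t om : reward t (om, z t om) = (z t om).1 * accepts (p t om) (z t om).
Proof. by rewrite /reward -[(om, z t om).2]/(z t om) clz_z. Qed.

Lemma consumption_z i t om :
  consumption i t (om, z t om) = tnth (z t om).2 i * accepts (p t om) (z t om).
Proof. by rewrite /consumption -[(om, z t om).2]/(z t om) clz_z. Qed.

Lemma reward_bounds t x : 0 <= reward t x <= Rmax.
Proof.
have [/andP[r0 rR] _] : bounded_pair Rmax Amax (clz x.2).
  by apply: clip_pair_bounded; exact: ltW.
have /andP[a0 a1] := accepts01 (p t x.1) x.2.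
by rewrite mulr_ge0//= (le_trans _ rR)// ler_piMr.
Qed.

Lemma consumption_bounds i t x : 0 <= consumption i t x <= Amax.
Proof.
have [_ /(_ i)/andP[r0 rR]] : bounded_pair Rmax Amax (clz x.2).
  by apply: clip_pair_bounded; exact: ltW.
have /andP[a0 a1] := accepts01 (p t x.1) x.2.
by rewrite mulr_ge0//= (le_trans _ rR)// ler_piMr.
Qed.

Let bdm_accepts_p t : (K <= t < T)%N ->
  bdm (fun x : GT t * pair_type R d => accepts (p t x.1) x.2 : R).
Proof.
move=> tT.
have mp := measurableT_comp (measurable_p core tT) (@measurable_fst _ _ (GT t) (pair_type R d)).
have ma := measurableT_comp measurable_snd (@measurable_snd _ _ (GT t) (pair_type R d)).
apply: bdm_bool; apply: measurable_fun_ltr; first exact: (measurable_dot_pair mp ma).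
exact: (measurableT_comp measurable_fst (@measurable_snd _ _ (GT t) (pair_type R d))).
Qed.

Lemma bdm_reward_step t : (K <= t < T)%N -> bdm (reward t : GT t * pair_type R d -> R).
Proof.
move=> tT; apply: bdmM; last exact: bdm_accepts_p.
exact: (bdm_comp (bdm_reward Rmax_gt0 Amax_gt0) measurable_snd).
Qed.

Lemma bdm_consumption i t : (K <= t < T)%N -> bdm (consumption i t : GT t * pair_type R d -> R).
Proof.
move=> tT; apply: bdmM; last exact: bdm_accepts_p.
exact: (bdm_comp (bdm_resource Rmax_gt0 Amax_gt0 i) measurable_snd).
Qed.

Let bdm_accept_of t : (t < T)%N ->
  (forall i, measurable_fun setT ((fun om => tnth (rem t om) i) : GT t.+1 -> R)) ->
  @bdm _ (GT t.+1) R (fun om => (accept K t (rem t om) (p t om) (z t om))%:R).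
Proof.
move=> tT mr.
have mz : measurable_fun setT (z t : GT t.+1 -> _) by apply: (adapted_z obs); rewrite ltnSn.
have mzi j : measurable_fun setT ((fun om => tnth (z t om).2 j) : GT t.+1 -> R).
  exact: (measurableT_comp (measurable_res j) mz).
have [Kt|Kt] := boolP (K <= t)%N; last first.
  have -> : (fun om => (accept K t (rem t om) (p t om) (z t om))%:R) = (fun=> 0) :> (Om -> R).
    by apply/funext => om; rewrite /accept (negbTE Kt).
  exact: bdm_cst.
have tKT : (K <= t < T)%N by rewrite Kt.
have mp := adapted_mono obs (leqnSn t) (measurable_p core tKT).
apply: bdm_bool; rewrite /accept Kt/=; apply: measurable_and.
  by apply: measurable_forall => j; apply: measurable_fun_ler.
apply: measurable_fun_ltr; last exact: (measurableT_comp measurable_fst mz).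
apply: measurable_dot_pair => //; exact: (measurableT_comp measurable_snd mz).
Qed.

Lemma measurable_rem t i : (t <= T)%N ->
  measurable_fun setT ((fun om => tnth (rem t om) i) : GT t -> R).
Proof.
elim: t i => [|t IH] i tT.
  have -> : (fun om => tnth (rem 0 om) i) = fun=> T%:R * tnth b i.
    by apply/funext => om; rewrite tnth_mktuple.
  exact: measurable_cst.
have mr j := adapted_mono obs (leqnSn t) (IH j (ltnW tT)).
have mz : measurable_fun setT (z t : GT t.+1 -> _) by apply: (adapted_z obs); rewrite ltnSn.
have mzi j : measurable_fun setT ((fun om => tnth (z t om).2 j) : GT t.+1 -> R).
  exact: (measurableT_comp (measurable_res j) mz).
have -> : (fun om => tnth (rem t.+1 om) i) = fun om => tnth (rem t om) i -
    (accept K t (rem t om) (p t om) (z t om))%:R * tnth (z t om).2 i.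
  by apply/funext => om; rewrite /rem/= tnth_mktuple.
apply: measurable_funB => //; apply: measurable_funM => //.
by have [] := bdm_accept_of tT mr.
Qed.

Lemma bdm_accept t : (t < T)%N ->
  @bdm _ (GT t.+1) R (fun om => (accept K t (rem t om) (p t om) (z t om))%:R).
Proof.
move=> tT; apply: bdm_accept_of => // i.
by apply: (adapted_mono obs (leqnSn t)); apply: measurable_rem; exact: ltnW.
Qed.

Lemma bdm_alive t : (t <= T)%N -> @bdm _ (GT t) R (fun om => (alive t om)%:R).
Proof.
move=> tT; apply: bdm_bool; apply: measurable_forall => i.
by apply: measurable_fun_ler; [exact: measurable_cst | exact: measurable_rem].
Qed.

Lemma remS t om i : tnth (rem t.+1 om) i = tnth (rem t om) i -
    (accept K t (rem t om) (p t om) (z t om))%:R * tnth (z t om).2 i.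
Proof. by rewrite /rem/= tnth_mktuple. Qed.

Lemma accept_alive t om : alive t om ->
  (accept K t (rem t om) (p t om) (z t om))%:R =
  (if (K <= t)%N then accepts (p t om) (z t om) else 0) :> R.
Proof.
move=> /forallP al; rewrite /accept; case: (K <= t)%N => //=.
have -> // : [forall i, tnth (z t om).2 i <= tnth (rem t om) i].
apply/forallP => i; apply: le_trans (al i).
by have [_ /(_ i)/andP[]] := bz t om.
Qed.

Lemma alive_mono t om : ~~ alive t om -> ~~ alive t.+1 om.
Proof.
apply: contra => /forallP al; apply/forallP => i; apply: le_trans (al i) _.
rewrite remS lerBlDr lerDl mulr_ge0//.
by have [_ /(_ i)/andP[]] := bz t om.
Qed.

Lemma total_reward_ge om :
  \sum_(t < T | (K <= t)%N) (alive t om)%:R * reward t (om, z t om) <=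
  total_reward K T b (p ^~ om) (z ^~ om).
Proof.
rewrite /total_reward big_mkcond/=; apply: ler_sum => t _.
have [/andP[r0 _] _] := bz t om.
have h0 : 0 <= (z t om).1 * (accept K t (rem t om) (p t om) (z t om))%:R.
  by rewrite mulr_ge0.
case: ifP => Kt //; case: (boolP (alive t om)) => al; last by rewrite mul0r.
by rewrite mul1r reward_z -/(rem t om) accept_alive// Kt.
Qed.

(** The account is exact only while the run is alive, since later rounds may still consume. At death
    some resource has less than [Amax] left; dead rounds add nothing to the sum, so the strict
    inequality for that resource persists. *)
Lemma alive_spent om t :
  (forall s, (s < t)%N -> alive s om) /\
    (forall i, \sum_(s < t | (K <= s)%N) (alive s om)%:R * consumption i s (om, z s om) =
       T%:R * tnth b i - tnth (rem t om) i) \/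
  ~~ alive t om /\ exists i, T%:R * tnth b i - Amax <
    \sum_(s < t | (K <= s)%N) (alive s om)%:R * consumption i s (om, z s om).
Proof.
elim: t => [|t [[al spent]|[nal [i spent]]]].
- by left; split => // i; rewrite big_ord0 tnth_mktuple subrr.
- have SE i : \sum_(s < t.+1 | (K <= s)%N) (alive s om)%:R * consumption i s (om, z s om) =
      T%:R * tnth b i - tnth (rem t om) i +
      (if (K <= t)%N then (alive t om)%:R * consumption i t (om, z t om) else 0).
    by rewrite -spent big_mkcond big_ord_recr/= -big_mkcond.
  have [alt|nal] := boolP (alive t om).
    left; split.
      by move=> s; rewrite ltnS leq_eqVlt => /orP[/eqP -> //|]; exact: al.
    move=> i; rewrite SE remS accept_alive// alt mul1r consumption_z.
    by case: ifP => _; rewrite /=; ring.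
  right; split; first exact: alive_mono.
  move: (nal); rewrite negb_forall => /existsP[i]; rewrite -ltNge => lt.
  exists i; rewrite SE (negbTE nal); case: ifP => _; rewrite ?mul0r addr0; lra.
- right; split; first exact: alive_mono.
  exists i; rewrite big_mkcond big_ord_recr/= -big_mkcond (negbTE nal).
  by case: ifP => _; rewrite ?mul0r addr0.
Qed.

Definition budget_noise i := martingale z D w (fun t om => (alive t om)%:R) (consumption i).

(** For the resource [i] that ran short, alive consumption exceeds [T * b_i - Amax]. It is also
    noise plus conditional means, at most [b_i] per alive round up to the widths. Since alive and
    dead rounds together number at most [T], this bounds [b_i] times the number of dead ones. As [i]
    is random, the noises of all resources are summed. *)
Lemma dead_le (om : Om) (W : nat -> R) (C : R) :
  0 <= C -> (forall t, 0 <= W t) ->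
  (forall t i, (K <= t < T)%N ->
     step_mean D w t (consumption i t) om <= tnth b i + C * W t) ->
  bmin b * \sum_(t < T | (K <= t)%N) (1 - (alive t om)%:R) <=
    Amax + C * (\sum_(t < T | (K <= t)%N) W t) + \sum_i `|budget_noise i T om|.
Proof.
move=> C0 W0 stepb.
have CW0 : 0 <= C * (\sum_(t < T | (K <= t)%N) W t).
  by rewrite mulr_ge0// sumr_ge0.
have [[al _]|[_ [i spent]]] := alive_spent om T.
  rewrite big1 ?mulr0 => [|t _]; last by rewrite al// subrr.
  by apply: addr_ge0; [apply: addr_ge0 => //; exact: ltW | exact: sumr_ge0].
have bi := bmin_le b i.
have noise_le : `|budget_noise i T om| <= \sum_i `|budget_noise i T om|.
  by rewrite (bigD1 i)//= lerDl sumr_ge0.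
have dead0 : 0 <= \sum_(t < T | (K <= t)%N) (1 - (alive t om)%:R) :> R.
  by apply: sumr_ge0 => t _; case: (alive t om); rewrite ?subrr// subr0.
have E1 : \sum_(s < T | (K <= s)%N) (alive s om)%:R * consumption i s (om, z s om) =
    budget_noise i T om +
    \sum_(s < T | (K <= s)%N) (alive s om)%:R * step_mean D w s (consumption i s) om.
  by rewrite -big_split/=; apply: eq_bigr => s _; rewrite /noise; ring.
have E2 : \sum_(s < T | (K <= s)%N) (alive s om)%:R * step_mean D w s (consumption i s) om <=
    tnth b i * (\sum_(s < T | (K <= s)%N) (alive s om)%:R) +
    C * (\sum_(t < T | (K <= t)%N) W t).
  rewrite !mulr_sumr -big_split/=; apply: ler_sum => s Ks.
  have sT : (K <= s < T)%N by rewrite Ks ltn_ord.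
  case: (alive s om); last by rewrite mul0r mulr0 add0r mulr_ge0.
  by rewrite mul1r mulr1; exact: stepb.
have E3 : \sum_(s < T | (K <= s)%N) (alive s om)%:R +
    \sum_(t < T | (K <= t)%N) (1 - (alive t om)%:R) <= T%:R :> R.
  rewrite -big_split/=; apply: (@le_trans _ _ (\sum_(t < T) 1)).
    by rewrite big_mkcond/=; apply: ler_sum => t _; case: ifP => _; rewrite // addrCA subrr addr0.
  by rewrite sumr_const card_ord.
have bi0 : 0 <= tnth b i by apply: le_trans bi; exact: ltW.
have E4 := ler_wpM2r dead0 bi; have E5 := ler_wpM2l bi0 E3.
rewrite mulrDr in E5.
have := ler_norm (budget_noise i T om); lra.
Qed.

Definition width t om : R :=
  \sum_(k < K) w t om k / Num.sqrt (maxn (nsel (theta ^~ om) t k) 1)%:R.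

Let bdm_inv_sqrt t k : (t <= T)%N ->
  @bdm _ (GT t) R (fun om => (Num.sqrt (maxn (nsel (theta ^~ om) t k) 1)%:R)^-1).
Proof.
move=> tT; split; last first.
  exists 1 => om; set n := maxn _ _.
  have n1 : 1 <= Num.sqrt n%:R :> R.
    by have := @ler_wsqrtr R 1 n%:R; rewrite sqrtr1; apply; rewrite ler1n leq_max orbT.
  by rewrite ger0_norm ?invr_ge0 ?sqrtr_ge0// invf_le1// (lt_le_trans ltr01).
apply: measurable_invr.
have mn : measurable_fun setT ((fun om => (nsel (theta ^~ om) t k)%:R) : GT t -> R).
  have -> : (fun om => (nsel (theta ^~ om) t k)%:R) =
      fun om => \sum_(s < t) (theta s om == k)%:R :> R.
    by apply/funext => om; rewrite /nsel natr_sum.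
  apply: measurable_sum => s.
  have [] // : @bdm _ (GT t) R (fun om => (theta s om == k)%:R).
  by apply: bdm_bool; apply: (adapted_theta obs); rewrite ltn_ord.
have -> : (fun om => Num.sqrt (maxn (nsel (theta ^~ om) t k) 1)%:R) =
    fun om => Num.sqrt (Num.max (nsel (theta ^~ om) t k)%:R 1) :> R.
  by apply/funext => om; rewrite natr_max.
apply: (measurableT_comp (continuous_measurable_fun (@sqrt_continuous R))).
by apply: measurable_maxr => //; exact: measurable_cst.
Qed.

Lemma bdm_width t : (K <= t < T)%N -> @bdm _ (GT t) R (width t).
Proof.
move=> tT; have /andP[_ /ltnW tT'] := tT; apply: bdm_sum => k _.
by apply: bdmM; [exact: (bdm_w core) | exact: bdm_inv_sqrt].
Qed.

Lemma width_ge0 t om : (K <= t < T)%N -> 0 <= width t om.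
Proof.
move=> tT; have [w0 _] := core_simplex core tT om.
by apply: sumr_ge0 => k _; rewrite mulr_ge0// invr_ge0 sqrtr_ge0.
Qed.

Lemma expect_sum_width : (0 < T)%N ->
  expect Pr (fun om => \sum_(t < T | (K <= t)%N) width t om) <=
  3 * Num.sqrt (K%:R * T%:R).
Proof.
move=> T0.
pose pull t k om : R := (theta t om == k)%:R / Num.sqrt (maxn (nsel (theta ^~ om) t k) 1)%:R.
have bpull t k : (t < T)%N -> bdm (pull t k).
  move=> tT; apply: bdmM; last exact: (bdm_Om core (bdm_inv_sqrt k (ltnW tT))).
  apply: (bdm_Om core (t := t.+1)); apply: bdm_bool; apply: (adapted_theta obs).
  by rewrite ltnSn.
have tKT (t : 'I_T) : (K <= t)%N -> (K <= t < T)%N by move=> ->; rewrite /= ltn_ord.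
have -> : expect Pr (fun om => \sum_(t < T | (K <= t)%N) width t om) =
    \sum_(t < T | (K <= t)%N) \sum_(k < K) expect Pr (pull t k).
  rewrite expect_sum => [|t Kt]; last exact: (bdm_Om core (bdm_width (tKT t Kt))).
  apply: eq_bigr => t Kt; rewrite expect_sum => [|k _]; last first.
    apply: (bdm_Om core (t := t)); apply: bdmM; first exact: (bdm_w core k (tKT t Kt)).
    by apply: bdm_inv_sqrt; exact: ltnW.
  apply: eq_bigr => k _; rewrite -(draw_mean core) ?tKT//.
  by apply: bdm_inv_sqrt; exact: ltnW.
apply: (@le_trans _ _ (expect Pr (fun om => \sum_(t < T) \sum_(k < K) pull t k om))).
  rewrite expect_sum => [|t _]; last by apply: bdm_sum => k _; exact: bpull.
  rewrite big_mkcond/=; apply: ler_sum => t _.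
  have E : expect Pr (fun om => \sum_(k < K) pull t k om) = \sum_(k < K) expect Pr (pull t k).
    by rewrite expect_sum => // k _; exact: bpull.
  rewrite E; case: ifP => // _; apply: sumr_ge0 => k _; apply: expect_ge0 => om.
  by rewrite mulr_ge0// invr_ge0 sqrtr_ge0.
rewrite -[leRHS](expect_cst Pr); apply: expect_le; [|exact: bdm_cst|].
  by apply: bdm_sum => t _; apply: bdm_sum => k _; exact: bpull.
move=> om; rewrite exchange_big/=.
apply: (@le_trans _ _ (\sum_(k < K) 3 * Num.sqrt (nsel (theta ^~ om) T k)%:R)).
  by apply: ler_sum => k _; exact: sum_inv_sqrt_le.
by rewrite -mulr_sumr ler_pM2l// sum_sqrt_nsel.
Qed.

Lemma bdm_total_reward : bdm (fun om => total_reward K T b (p ^~ om) (z ^~ om)).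
Proof.
apply: bdm_sum => t _; have tT := ltn_ord t.
have mz := measurable_z obs tT.
have bzt : bdm (fun om => (z t om).1).
  split; first exact: (measurableT_comp measurable_fst mz).
  by exists Rmax => om; have [/andP[h1 h2] _] := bz t om; rewrite ger0_norm.
apply: bdmM => //.
exact: (bdm_Om core (bdm_accept tT)).
Qed.

(** The bound is first proved pathwise for [Y], the sum of conditional mean rewards over alive
    rounds. It is affine in the indicator of failure, the total width and the noise, so taking
    expectations is immediate. On failure its left side is nonpositive while [Y >= 0]. *)
Lemma reward_lower_bound (good : Om -> bool) (V C0 C1 : R) :
  (0 < T)%N -> measurable_fun setT good -> 0 <= V -> 0 <= C0 -> 0 <= C1 ->
  (forall om, good om -> forall t, (K <= t < T)%N ->
     (forall i, step_mean D w t (consumption i t) om <= tnth b i + C0 * width t om) /\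
     V - C1 * width t om <= step_mean D w t (reward t) om) ->
  V * ((T - K)%:R * (1 - expect Pr (fun om => (~~ good om)%:R))
       - (Amax + C0 * (3 * Num.sqrt (K%:R * T%:R)) + d%:R * (Amax * Num.sqrt T%:R)) / bmin b)
    - C1 * (3 * Num.sqrt (K%:R * T%:R)) <=
  expect Pr (fun om => total_reward K T b (p ^~ om) (z ^~ om)).
Proof.
move=> T0 mgood V0 C00 C10 round.
have tKT (t : 'I_T) : (K <= t)%N -> (K <= t < T)%N by move=> ->; rewrite /= ltn_ord.
have balive (t : 'I_T) : bdm (fun om => (alive t om)%:R : R).
  by apply: (bdm_Om core (t := t)); apply: bdm_alive; exact: ltnW.
have brew (t : 'I_T) : (K <= t)%N -> bdm (fun om => reward t (om, z t om)).
  move=> Kt; apply: (bdm_Om core (t := t.+1)).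
  exact: (bdm_observe core (ltn_ord t) (bdm_reward_step (tKT t Kt))).
have bmean (t : 'I_T) : (K <= t)%N -> bdm (step_mean D w t (reward t)).
  move=> Kt; apply: (bdm_Om core (t := t)).
  exact: (bdm_step_mean core (tKT t Kt) (bdm_reward_step (tKT t Kt))).
pose Y om : R := \sum_(t < T | (K <= t)%N) (alive t om)%:R * step_mean D w t (reward t) om.
pose SW om : R := \sum_(t < T | (K <= t)%N) width t om.
pose SM om : R := \sum_i `|budget_noise i T om|.
have bY : bdm Y by apply: bdm_sum => t Kt; apply: bdmM => //; exact: bmean.
have bSW : bdm SW by apply: bdm_sum => t Kt; exact: (bdm_Om core (bdm_width (tKT t Kt))).
have bnoise i : bdm (budget_noise i T).
  apply: (bdm_Om core (t := T)); apply: (bdm_martingale core) => // t tT.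
    by apply: bdm_alive; have /andP[_ /ltnW] := tT.
  exact: bdm_consumption.
have bSM : bdm SM by apply: bdm_sum => i _; exact: bdm_norm.
have bbad : bdm (fun om => (~~ good om)%:R : R) by apply: bdm_bool; exact: measurable_neg.
(* Only [alive t], known at the start of round [t], multiplies the reward here. The event [good] is
   not known then, so the passage to conditional means must precede any use of it. *)
have EY : expect Pr Y <= expect Pr (fun om => total_reward K T b (p ^~ om) (z ^~ om)).
  apply: (@le_trans _ _ (expect Pr (fun om =>
      \sum_(t < T | (K <= t)%N) (alive t om)%:R * reward t (om, z t om)))).
    rewrite expect_sum => [|t Kt]; last by apply: bdmM => //; exact: bmean.
    rewrite expect_sum => [|t Kt]; last by apply: bdmM => //; exact: brew.
    apply: ler_sum => t Kt.
    rewrite (expect_stepM core (tKT t Kt) _ (bdm_reward_step (tKT t Kt)))//.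
    by apply: bdm_alive; exact: ltnW.
  apply: expect_le; last exact: total_reward_ge.
    by apply: bdm_sum => t Kt; apply: bdmM => //; exact: brew.
  exact: bdm_total_reward.
apply: le_trans EY.
have ESW : expect Pr SW <= 3 * Num.sqrt (K%:R * T%:R) by exact: expect_sum_width.
have ESM : expect Pr SM <= d%:R * (Amax * Num.sqrt T%:R).
  rewrite expect_sum => [|i _]; last exact: bdm_norm.
  rewrite -[X in X%:R * _]card_ord mulr_natl -sumr_const; apply: ler_sum => i _.
  rewrite -[X in X * _](ger0_norm (ltW Amax_gt0)).
  apply: (expect_norm_martingale core).
  - by move=> t tT; apply: bdm_alive; have /andP[_ /ltnW] := tT.
  - by move=> t om; rewrite ler0n lern1 leq_b1.
  - by move=> t tT; exact: bdm_consumption.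
  - by move=> t x; exact: consumption_bounds.
have pathwise om : V * ((T - K)%:R * (1 - (~~ good om)%:R)
       - (Amax + C0 * SW om + SM om) / bmin b) - C1 * SW om <= Y om.
  have SW0 : 0 <= SW om by apply: sumr_ge0 => t Kt; exact: (width_ge0 om (tKT t Kt)).
  have SM0 : 0 <= SM om by exact: sumr_ge0.
  have Q0 : 0 <= (Amax + C0 * SW om + SM om) / bmin b.
    by rewrite divr_ge0 ?(ltW bmin_gt0)// !addr_ge0 ?mulr_ge0// ltW.
  have Y0 : 0 <= Y om.
    apply: sumr_ge0 => t Kt; rewrite mulr_ge0//.
    have /andP[h _] := step_mean_bounds core om (tKT t Kt)
      (bdm_reward_step (tKT t Kt)) (reward_bounds t).
    exact: h.
  have C1SW := mulr_ge0 C10 SW0.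
  case: (boolP (good om)) => g; last first.
    rewrite subrr mulr0 add0r mulrN; have := mulr_ge0 V0 Q0; lra.
  rewrite subr0 mulr1.
  have dead : bmin b * \sum_(t < T | (K <= t)%N) (1 - (alive t om)%:R) <=
      Amax + C0 * SW om + SM om.
    (* The width is cut off outside the relevant rounds because its nonnegativity is available only
       where [w t] lies in the simplex. *)
    have := @dead_le om (fun t => if (K <= t < T)%N then width t om else 0) C0 C00.
    have -> : \sum_(t < T | (K <= t)%N) (if (K <= t < T)%N then width t om else 0) = SW om.
      by apply: eq_bigr => t Kt; rewrite tKT.
    apply => [t|t i tT]; first by case: ifP => // h; exact: width_ge0.
    by rewrite tT; have [h _] := round om g t tT; exact: h.
  have YE : V * (\sum_(t < T | (K <= t)%N) (alive t om)%:R) - C1 * SW om <= Y om.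
    rewrite !mulr_sumr -sumrB; apply: ler_sum => t Kt.
    have [_ h] := round om g t (tKT t Kt).
    have W0 := width_ge0 om (tKT t Kt).
    case: (alive t om); first by rewrite mulr1 mul1r.
    by rewrite mulr0 mul0r add0r oppr_le0 mulr_ge0.
  apply: le_trans YE; rewrite lerD2r ler_wpM2l//.
  move: dead; rewrite mulrC -ler_pdivlMr// sumrB sum_late; lra.
have : expect Pr (fun om => V * ((T - K)%:R * (1 - (~~ good om)%:R)
       - (Amax + C0 * SW om + SM om) / bmin b) - C1 * SW om) <= expect Pr Y.
  apply: expect_le => //; apply: bdmB; last exact: bdmZ.
  apply/bdmZ/bdmB; first by apply/bdmZ/bdmB => //; exact: bdm_cst.
  apply: bdmM; last exact: bdm_cst.
  by apply: bdmD => //; apply: bdmD; [exact: bdm_cst | exact: bdmZ].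
apply: le_trans; set e := expect Pr (fun om => (~~ good om)%:R).
rewrite (eq_expect _ (h := fun om => (V * ((T - K)%:R - Amax / bmin b)) +
    (- (V * (T - K)%:R) * (~~ good om)%:R + (- (V * C0 / bmin b + C1) * SW om +
     (- (V / bmin b)) * SM om)))); last first.
  by move=> om; move: (T - K)%:R (~~ good om)%:R (SW om) (SM om) => n g x y; ring.
rewrite expectD; [|exact: bdm_cst|by do 2![apply: bdmD; first exact: bdmZ]; exact: bdmZ].
rewrite expectD; [|exact: bdmZ|by apply: bdmD; exact: bdmZ].
rewrite expectD; [|exact: bdmZ|exact: bdmZ].
rewrite expect_cst !expectZ// -/e.
have b0 : 0 <= (bmin b)^-1 by rewrite invr_ge0 ltW.
have c1 : 0 <= V * C0 / bmin b + C1 by rewrite addr_ge0// !mulr_ge0.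
have h1 := ler_wpM2l c1 ESW; have h2 := ler_wpM2l (mulr_ge0 V0 b0) ESM.
move: h1 h2; move: (expect Pr SW) (expect Pr SM) e => x y e.
move: (3 * _) (d%:R * _) (T - K)%:R => x' y' n h1 h2.
have -> : V * (n * (1 - e) - (Amax + C0 * x' + y') / bmin b) - C1 * x' =
  V * (n - Amax / bmin b) + - (V * n) * e - (V * C0 / bmin b + C1) * x' - V / bmin b * y' by ring.
lra.
Qed.

End Budget.

(** * Regret *)

Section RoundBounds.
Context {R : realType} {d K : nat} (Rmax Amax : R).
Hypotheses (Rmax_gt0 : 0 < Rmax) (Amax_gt0 : 0 < Amax).
Variables (D : 'I_K -> probability (pair_type R d) R) (b : d.-tuple R).
Hypotheses (bD : bounded_laws D Rmax Amax) (K_gt0 : (0 < K)%N) (bmin_gt0 : 0 < bmin b).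
Variables (th : nat -> 'I_K) (z : nat -> pair_type R d) (t : nat).
Hypotheses (bz : forall s, (s < t)%N -> bounded_pair Rmax Amax (z s))
  (seen : forall k, (0 < nsel th t k)%N).
Variables (eps : R) (beta w : 'I_K -> R) (p : d.-tuple R).
Hypothesis eps12 : 0 <= eps <= 2^-1.
Hypothesis sad : saddle_point (fun w p => dot p (bsafe eps b) +
  \sum_(k < K) w k * (empirical th z t k (surplus p) + beta k)) w p.
Hypothesis ucb : forall k p', (forall i, 0 <= tnth p' i <= Pmax Rmax b) ->
  `|g D k p' - empirical th z t k (surplus p')| <= beta k.
Variables (L Cb : R).
Hypothesis close : forall k p' (i : 'I_d),
  let N : R := (nsel th t k)%:R in
  let u v := clip Amax (tnth v.2 i) / Amax in
  let c := expect (D k) (fun v => u v * accepts p' v) in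
  let err := 4 * Num.sqrt (L / N) in
  c <= N^-1 * (\sum_(s < t | th s == k) u (z s) * accepts p' (z s)) + err /\
  N^-1 * (\sum_(s < t | th s == k) u (z s) * accepts_tie p' (z s)) <= c + err.
Hypotheses (L_ge0 : 0 <= L) (beta_le : forall k, beta k <= Cb / Num.sqrt (maxn (nsel th t k) 1)%:R).

Local Notation clz := (clip_pair Rmax Amax : pair_type R d -> pair_type R d).

Local Notation C0 := (4 * Amax * Num.sqrt L).
Local Notation e k := ((Num.sqrt (maxn (nsel th t k) 1)%:R)^-1).
Local Notation W := (\sum_(k < K) w k / Num.sqrt (maxn (nsel th t k) 1)%:R).
Local Notation cons k i := (expect (D k) (fun v => tnth (clz v).2 i * accepts p v)).
Local Notation rew k := (expect (D k) (fun v => (clz v).1 * accepts p v)).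

Let b_gt0 i : 0 < tnth b i. Proof. exact: lt_le_trans (bmin_le b i). Qed.
Let p_ge0 i : 0 <= tnth p i. Proof. by case: sad. Qed.
Let w_ge0 k : 0 <= w k. Proof. by have [[]] := sad. Qed.
Let clzP v : bounded_pair Rmax Amax (clz v).
Proof. by apply: clip_pair_bounded; exact: ltW. Qed.
Let C0_ge0 : 0 <= C0. Proof. by rewrite !mulr_ge0 ?sqrtr_ge0// ltW. Qed.
Let e_ge0 k : 0 <= e k :> R. Proof. by rewrite invr_ge0 sqrtr_ge0. Qed.

Let consE k i : cons k i =
  Amax * expect (D k) (fun v => clip Amax (tnth v.2 i) / Amax * accepts p v).
Proof.
rewrite -expectZ; last first.
  apply: bdmM; last exact: bdm_accepts.
  apply: bdmM; last exact: bdm_cst.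
  have := bdm_resource (d := d) Rmax_gt0 Amax_gt0 i.
  by congr bdm; apply/funext => v; rewrite tnth_mktuple.
apply: eq_expect => v; rewrite tnth_mktuple; field; exact: lt0r_neq0.
Qed.

Let errE k : Amax * (4 * Num.sqrt (L / (nsel th t k)%:R)) = C0 * e k.
Proof. by rewrite (maxn_idPl (seen k)) sqrtrM// sqrtrV// ?ler0n//; ring. Qed.

Let empE k i (x : pair_type R d -> R) :
  Amax * ((nsel th t k)%:R^-1 *
    (\sum_(s < t | th s == k) clip Amax (tnth (z s).2 i) / Amax * x (z s))) =
  empirical th z t k (fun v => tnth v.2 i * x v).
Proof.
rewrite /empirical (maxn_idPl (seen k)) mulrCA mulr_sumr; congr (_ * _).
apply: eq_bigr => s _; have [_ /(_ i) h] := bz (ltn_ord s); rewrite clip_id//.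
by field; exact: lt0r_neq0.
Qed.

Let cons_le k i : cons k i <=
  empirical th z t k (fun v => tnth v.2 i * accepts p v) + C0 * e k.
Proof.
have [h _] := close k p i.
by rewrite consE -empE -errE -mulrDr ler_pM2l.
Qed.

Let cons_ge k i :
  empirical th z t k (fun v => tnth v.2 i * accepts_tie p v) <= cons k i + C0 * e k.
Proof.
have [_ h] := close k p i.
by rewrite consE -empE -errE -mulrDr ler_pM2l.
Qed.

Lemma round_consumption i : \sum_(k < K) w k * cons k i <= tnth b i + C0 * W.
Proof.
apply: (@le_trans _ _ (\sum_(k < K) (w k * empirical th z t k (fun v => tnth v.2 i * accepts p v)
    + C0 * (w k * e k)))).
  by apply: ler_sum => k _; have := ler_wpM2l (w_ge0 k) (cons_le k i); lra.
rewrite big_split/= -mulr_sumr lerD2r.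
apply: le_trans (empirical_consumption Amax_gt0 bz sad i) _.
rewrite tnth_mktuple ler_piMl//; first exact: ltW.
by have /andP[h _] := eps12; lra.
Qed.

(** Origin of the factor 2 in [Pmax]: with [eps <= 1/2] the safe budget is at least half of [b], and
    the whole price costs at most [Rmax] against it. The confidence bound thus applies at the saddle
    price. *)
Lemma price_in_box i : 0 <= tnth p i <= Pmax Rmax b.
Proof.
rewrite p_ge0 /Pmax ler_pdivlMr//=.
have := saddle_price_cost Rmax_gt0 bz sad; rewrite /dot (bigD1 i)//= tnth_mktuple.
have /andP[e0 e1] := eps12.
have : 0 <= \sum_(i0 < d | i0 != i) tnth p i0 * tnth (bsafe eps b) i0.
  apply: sumr_ge0 => j _; rewrite tnth_mktuple mulr_ge0// mulr_ge0//; last exact: ltW.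
  by lra.
have h1 := ler_wpM2l (p_ge0 i) (bmin_le b i).
have h2 : 0 <= (2^-1 - eps) * (tnth p i * tnth b i).
  by rewrite mulr_ge0 ?subr_ge0// mulr_ge0// ltW.
lra.
Qed.

Let g_split k : g D k p = rew k - \sum_i tnth p i * cons k i.
Proof.
have br : bdm (fun v => (clz v).1 * accepts p v).
  by apply: bdmM; [exact: bdm_reward | exact: bdm_accepts].
have bc i : bdm (fun v => tnth (clz v).2 i * accepts p v).
  by apply: bdmM; [exact: bdm_resource | exact: bdm_accepts].
have bs : bdm (fun v => \sum_i tnth p i * (tnth (clz v).2 i * accepts p v)).
  by apply: bdm_sum => i _; exact: bdmZ.
rewrite [RHS](_ : _ = expect (D k) (fun v => (clz v).1 * accepts p v -
    \sum_i tnth p i * (tnth (clz v).2 i * accepts p v))); last first.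
  rewrite expectB// expect_sum => [|i _]; last exact: bdmZ.
  by congr (_ - _); apply: eq_bigr => i _; rewrite expectZ.
apply: (expect_bounded_eq (bD k)); first exact: measurable_surplus.
  by have [] := bdmB br bs.
move=> v bv; rewrite clip_pair_id// surplusE mulrBl; congr (_ - _).
by rewrite /dot mulr_suml; apply: eq_bigr => i _; rewrite mulrA.
Qed.

(** By weak duality at [p], [(1 - eps) * V] is at most the cost of the safe budget plus a mixture of
    the [g k]. Optimism replaces [g k] by its upper confidence bound, and maximality of [w] replaces
    the mixture by [w]. Returning to [g k] costs two widths. Finally [g k] is reward minus priced
    consumption, and slackness cancels the latter against the cost of the budget, up to the error of
    the consumption estimate. *)
Lemma round_reward :
  (1 - eps) * Vmix D b - (2 * Cb + d%:R * Pmax Rmax b * C0) * W <= \sum_(k < K) w k * rew k.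
Proof.
have /andP[e0 e1] := eps12.
have eps1 : 0 < 1 - eps by lra.
have P0 : 0 <= Pmax Rmax b by rewrite /Pmax divr_ge0 ?mulr_ge0// ltW.
have cost : dot p (bsafe eps b) <=
    \sum_(k < K) w k * (\sum_i tnth p i * cons k i) + d%:R * Pmax Rmax b * C0 * W.
  apply: le_trans (empirical_slackness bz sad) _.
  rewrite [d%:R * _ * _ * W]mulr_sumr -big_split/=; apply: ler_sum => k _.
  rewrite [X in _ + X]mulrCA -mulrDr ler_wpM2l//.
  apply: (@le_trans _ _ (\sum_i tnth p i *
      empirical th z t k (fun v => tnth v.2 i * accepts_tie p v))).
    rewrite le_eqVlt; apply/orP; left; apply/eqP.
    rewrite -(eq_bigr _ (fun i _ => empiricalZ _ _ _ _ _ _)) -empirical_sum.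
    by apply: eq_empirical => s _; rewrite /dot mulr_suml; apply: eq_bigr => i _; rewrite mulrA.
  apply: (@le_trans _ _ (\sum_i (tnth p i * cons k i + Pmax Rmax b * (C0 * e k)))).
    apply: ler_sum => i _; have /andP[p0 p1] := price_in_box i.
    apply: le_trans (ler_wpM2l p0 (cons_ge k i)) _.
    by rewrite mulrDr lerD2l ler_wpM2r// mulr_ge0.
  by rewrite big_split/= lerD2l sumr_const card_ord -[leLHS]mulr_natl !mulrA.
have emp_le k : empirical th z t k (surplus p) + beta k <= g D k p + 2 * (Cb * e k).
  have := ucb k price_in_box; rewrite ler_norml => /andP[h1 _].
  have := beta_le k; lra.
have le_emp k : g D k p <= empirical th z t k (surplus p) + beta k.
  by have := ucb k price_in_box; rewrite ler_norml => /andP[_ h1]; lra.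
have [sw p0 smax _] := sad.
rewrite lerBlDr -ler_pdivlMl//; apply: (Vmix_le K_gt0 (fun i => ltW (b_gt0 i))) => // v mv.
rewrite ler_pdivlMl//.
have [|w' sw' h] := weak_duality Rmax_gt0 Amax_gt0 bD (eps := eps) mv _ p0.
  by rewrite e0/=; lra.
apply: (le_trans h).
have h1 : \sum_(k < K) w' k * g D k p <=
    \sum_(k < K) w' k * (empirical th z t k (surplus p) + beta k).
  by have [w'0 _] := sw'; apply: ler_sum => k _; rewrite ler_wpM2l.
have h2 := smax w' sw'.
have h3 : \sum_(k < K) w k * (empirical th z t k (surplus p) + beta k) <=
    \sum_(k < K) w k * rew k - \sum_(k < K) w k * (\sum_i tnth p i * cons k i) + 2 * Cb * W.
  rewrite [2 * Cb * _]mulr_sumr -sumrB -big_split/=; apply: ler_sum => k _.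
  have := ler_wpM2l (w_ge0 k) (emp_le k); rewrite g_split; lra.
rewrite /= in h2; lra.
Qed.

End RoundBounds.

Lemma measurable_mem {disp : measure_display} {T : measurableType disp} (A : set T) :
  measurable A -> measurable_fun setT (fun x => x \in A).
Proof.
move=> mA; apply: (measurable_fun_bool true); rewrite setTI.
by rewrite (_ : _ @^-1` _ = A)//; apply/seteqP; split => x /= xA; [exact: set_mem | exact: mem_set].
Qed.

Lemma eq_remaining {R : realType} {d : nat} (K T t : nat) (b : d.-tuple R) p
    (z z' : nat -> pair_type R d) : (forall s, (s < t)%N -> z s = z' s) ->
  remaining K T b p z t = remaining K T b p z' t.
Proof.
elim: t => //= t IH zz'; rewrite IH => [|s st]; last by apply: zz'; exact: ltnW.
by rewrite zz'.
Qed.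

(** * Reduction to bounded observations *)

Section Clipped.
Context {R : realType} {d K : nat} {disp : measure_display}
  {Om : measurableType disp}.
Variables (c_g c_0 Rmax Amax : R) (b : d.-tuple R).
Hypotheses (Rmax_gt0 : 0 < Rmax) (Amax_gt0 : 0 < Amax) (bmin_gt0 : 0 < bmin b).
Variables (D : 'I_K -> probability (pair_type R d) R) (T : nat).
Variables (eps delta alpha : R) (Pr : probability Om R) (F : nat -> set (set Om)).
Variables (theta : nat -> Om -> 'I_K) (z : nat -> Om -> pair_type R d).
Variables (w : nat -> Om -> 'I_K -> R) (p : nat -> Om -> d.-tuple R).
Hypotheses (K_gt0 : (0 < K)%N) (T_gt0 : (0 < T)%N) (bD : bounded_laws D Rmax Amax).
Hypothesis run : sp_ucb_olp c_g c_0 Rmax Amax b D T eps delta alpha Pr F theta z w p.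

Local Notation clz := (clip_pair Rmax Amax : pair_type R d -> pair_type R d).
Local Notation B := (bounded_pair Rmax Amax : set (pair_type R d)).
Let z' t om := clz (z t om).

Let mB : measurable B. Proof. exact: measurable_bounded_pair. Qed.

Let mclz : measurable_fun setT clz. Proof. exact: measurable_clip_pair. Qed.

Let obs : observations Pr F theta z D T.
Proof. by split; [exact: run_filtration run|exact: run_theta_adapted run|
  exact: run_z_adapted run|exact: run_observe run]. Qed.

Let law_clz k A : measurable A -> D k (clz @^-1` A) = D k A.
Proof.
move=> mA; have mcA : measurable (clz @^-1` A) by rewrite -[X in measurable X]setTI; exact: mclz.
rewrite -[LHS]fineK ?fin_num_measure// -[RHS]fineK ?fin_num_measure//; congr _%:E.
rewrite -!expect_indic//; apply: (expect_bounded_eq (bD k)); [exact: measurable_indic..|].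
by move=> v bv; rewrite -[LHS]/(\1_A (clz v)) clip_pair_id.
Qed.

Let core_of (y : nat -> Om -> pair_type R d) : observations Pr F theta y D T ->
  run_core Pr F theta y D T w p.
Proof.
move=> oy; split => //.
- exact: (run_w_predictable run).
- exact: (run_p_predictable run).
- by move=> t tT om; have [] := run_saddle run tT om.
- exact: (run_draw run).
Qed.

Lemma clipped_core : run_core Pr F theta z' D T w p.
Proof.
apply: core_of; split; [exact: run_filtration run|exact: run_theta_adapted run| |].
  move=> t tT A mA; rewrite /z' -[X in F _ X]/(z t @^-1` (clz @^-1` A)).
  by apply: (run_z_adapted run) => //; rewrite -[X in measurable X]setTI; exact: mclz.
move=> t tT E k A FE mA; rewrite -[X in Pr (_ `&` X)]/(z t @^-1` (clz @^-1` A)).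
by rewrite (run_observe run)// ?law_clz// -[X in measurable X]setTI; exact: mclz.
Qed.

Let bz' t om : bounded_pair Rmax Amax (z' t om).
Proof. by apply: clip_pair_bounded; exact: ltW. Qed.

Definition unbounded (om : Om) : bool := [exists s : 'I_T, z s om \notin B].

Let m_unbounded_at (s : 'I_T) : measurable_fun setT (fun om => z s om \notin B).
Proof.
apply: measurable_neg.
exact: (measurableT_comp (measurable_mem mB) (measurable_z obs (ltn_ord s))).
Qed.

Lemma measurable_unbounded : measurable_fun setT unbounded.
Proof. exact: measurable_exists. Qed.

Lemma expect_unbounded : expect Pr (fun om => (unbounded om)%:R) = 0.
Proof.
apply/eqP; rewrite eq_le expect_ge0// andbT.
apply: le_trans (expect_exists_le Pr m_unbounded_at) _; rewrite big1// => s _.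
have mz := measurable_z obs (ltn_ord s).
have D0 k : D k (~` B) = 0%E.
  have [N [mN N0 BN]] := bD k; apply/eqP; rewrite eq_le measure_ge0 andbT -N0.
  by apply: le_measure => //; rewrite inE//; exact: measurableC.
have mzB : measurable (z s @^-1` (~` B)).
  by rewrite -[X in measurable X]setTI; apply: mz => //; exact: measurableC.
have mth k := measurable_theta obs k (ltn_ord s).
have -> : expect Pr (fun om => (z s om \notin B)%:R) =
    expect Pr (fun om => \sum_(k < K) \1_(theta s @^-1` [set k] `&` z s @^-1` (~` B)) om).
  apply: eq_expect => om; rewrite (bigD1 (theta s om))//= big1 ?addr0.
    rewrite indicE; case: (boolP (z s om \in B)) => h.
      by rewrite memNset// => -[_]; apply; exact: set_mem.
    by rewrite mem_set//; split => // zB; move/negP: h; apply; exact: mem_set.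
  by move=> k /eqP kt; rewrite indicE memNset// => -[/= h _]; exact/kt/esym.
rewrite expect_sum => [|k _]; last by apply: bdm_indic; exact: measurableI.
rewrite big1// => k _; rewrite expect_indic; last exact: measurableI.
have FT : F s setT by rewrite -(measurable_GTE (obs_sigma obs s)); exact: measurableT.
by rewrite -(setTI (theta s @^-1` _)) (obs_law obs)// ?D0 ?mule0//; exact: measurableC.
Qed.

Let z'E om : ~~ unbounded om -> forall s, (s < T)%N -> z' s om = z s om.
Proof.
rewrite negb_exists => /forallP h s sT; apply: clip_pair_id.
by have := h (Ordinal sT); rewrite negbK inE.
Qed.

Let total_reward_z' om : ~~ unbounded om ->
  total_reward K T b (p ^~ om) (z ^~ om) = total_reward K T b (p ^~ om) (z' ^~ om).
Proof.
move=> /z'E E; apply: eq_bigr => t _; rewrite E//.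
rewrite (@eq_remaining _ _ _ _ _ _ _ (z' ^~ om) (z ^~ om))// => s st.
by rewrite E// (ltn_trans st).
Qed.

Lemma expect_total_reward_clipped :
  expect Pr (fun om => total_reward K T b (p ^~ om) (z ^~ om)) =
  expect Pr (fun om => total_reward K T b (p ^~ om) (z' ^~ om)).
Proof.
apply: ae_eq_expect.
- apply: measurable_sum => t; have tT := ltn_ord t; apply: measurable_funM.
    exact: (measurableT_comp measurable_fst (measurable_z obs tT)).
  by have [] := bdm_Om (core_of obs) (bdm_accept (core_of obs) b tT).
- by have [] := bdm_total_reward clipped_core b bz'.
- exists [set om | unbounded om]; split.
  + exact: measurable_setr measurable_unbounded.
  + have := expect_unbounded; rewrite expect_bool; last exact: measurable_unbounded.
    have fU := fin_num_measure Pr _ (measurable_setr measurable_unbounded).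
    by move=> U0; rewrite -(fineK fU) U0.
  + by move=> om /=; apply: contra_notT; exact: total_reward_z'.
Qed.

(** This settles the degenerate cases [T < K], [T = 1] and [eps > 1/2]. *)
Lemma mix_regret_le_T : mix_regret b D T Pr z p <= T%:R * Rmax.
Proof.
rewrite /mix_regret expect_total_reward_clipped.
have V := Vmix_le_Rmax Rmax_gt0 Amax_gt0 bD K_gt0
  (fun i => ltW (lt_le_trans bmin_gt0 (bmin_le b i))).
have : 0 <= expect Pr (fun om => total_reward K T b (p ^~ om) (z' ^~ om)).
  apply: expect_ge0 => om; apply: sumr_ge0 => t _; rewrite mulr_ge0//.
  by have [/andP[]] := bz' t om.
have := ler_wpM2l (ler0n R T) V; lra.
Qed.

End Clipped.

(** * Assembling the regret bound *)

Section Regret.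
Context {R : realType} {d K : nat} {disp : measure_display}
  {Om : measurableType disp}.
Variables (c_g c_0 Rmax Amax : R) (b : d.-tuple R).
Hypotheses (Rmax_gt0 : 0 < Rmax) (Amax_gt0 : 0 < Amax) (bmin_gt0 : 0 < bmin b).
Variables (D : 'I_K -> probability (pair_type R d) R) (T : nat).
Variables (eps delta alpha : R) (Pr : probability Om R) (F : nat -> set (set Om)).
Variables (theta : nat -> Om -> 'I_K) (z : nat -> Om -> pair_type R d).
Variables (w : nat -> Om -> 'I_K -> R) (p : nat -> Om -> d.-tuple R).
Hypotheses (K_gt0 : (0 < K)%N) (T_gt0 : (0 < T)%N) (bD : bounded_laws D Rmax Amax).
Hypothesis run : sp_ucb_olp c_g c_0 Rmax Amax b D T eps delta alpha Pr F theta z w p.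
Hypothesis ucb : ucb_concentration c_g c_0 Rmax Amax b D T delta alpha Pr theta z.
Hypotheses (KT : (K <= T)%N) (eps12 : 0 <= eps <= 2^-1).

Local Notation z' := (fun t om => clip_pair Rmax Amax (z t om)).

Lemma explored om t k : (K <= t <= T)%N -> (0 < nsel (theta ^~ om) t k)%N.
Proof.
move=> /andP[Kt tT]; have kt : (k < t)%N := leq_trans (ltn_ord k) Kt.
rewrite /nsel (bigD1 (Ordinal kt))//= addn_gt0; apply/orP; left.
rewrite (_ : theta k om == k)//; apply/eqP/val_inj.
exact: (run_explore run (leq_trans kt tT) (ltn_ord k)).
Qed.

Local Notation C0 q := (4 * Amax * Num.sqrt (q%:R * ln T%:R)).
Local Notation S := (3 * Num.sqrt (K%:R * T%:R)).

(** The first line collects the shrunken budget, the exploration rounds and the failure of the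
    estimates; the second, the rounds lost after the run is no longer alive; the third, optimism and
    consumption error in the alive rounds. *)
Lemma mix_regret_le_width (q : nat) (bad : Om -> bool) (p_bad Cb : R) :
  measurable_fun setT bad -> expect Pr (fun om => (bad om)%:R) <= p_bad ->
  (forall om, ~~ bad om -> forall t k, (t < T)%N ->
     acceptance_close theta z' D T
       (fun i v => clip Amax (tnth v.2 i) / Amax) q om t k) ->
  0 <= Cb -> 0 <= ln T%:R :> R ->
  (forall om t k, beta c_g c_0 Rmax Amax b T delta alpha (theta ^~ om) t k <=
     Cb / Num.sqrt (maxn (nsel (theta ^~ om) t k) 1)%:R) ->
  mix_regret b D T Pr z p <=
    Rmax * (T%:R * eps + K%:R + T%:R * (p_bad + delta))
    + Rmax * ((Amax + C0 q * S + d%:R * (Amax * Num.sqrt T%:R)) / bmin b)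
    + (2 * Cb + d%:R * Pmax Rmax b * C0 q) * S.
Proof.
move=> mbad bad_le close Cb0 ln0 beta_le.
set C0 := C0 q; set S := S.
have [E [mE PE ucbE]] := ucb.
have core := clipped_core bD run.
have bz' t om : bounded_pair Rmax Amax (z' t om).
  by apply: clip_pair_bounded; exact: ltW.
have munb := measurable_unbounded run.
pose good om := [&& ~~ bad om, om \in E & ~~ unbounded Rmax Amax T z om].
have mgood : measurable_fun setT good.
  apply: measurable_and; first exact: measurable_neg.
  by apply: measurable_and; [exact: measurable_mem | exact: measurable_neg].
have L0 : 0 <= q%:R * ln T%:R :> R by rewrite mulr_ge0.
have C00 : 0 <= C0 by rewrite !mulr_ge0 ?sqrtr_ge0// ltW.
have S0 : 0 <= S by rewrite mulr_ge0 ?sqrtr_ge0.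
have P0 : 0 <= Pmax Rmax b by rewrite /Pmax divr_ge0 ?mulr_ge0// ltW.
have b0 i : 0 <= tnth b i by exact: ltW (lt_le_trans bmin_gt0 (bmin_le b i)).
have V0 := Vmix_ge0 (b := b) Rmax_gt0 Amax_gt0 bD K_gt0 b0.
have VR := Vmix_le_Rmax (b := b) Rmax_gt0 Amax_gt0 bD K_gt0 b0.
have /andP[e0 e1] := eps12.
have V'0 : 0 <= (1 - eps) * Vmix D b by rewrite mulr_ge0//; lra.
set C1 := 2 * Cb + d%:R * Pmax Rmax b * C0.
have C10 : 0 <= C1 by apply: addr_ge0; [exact: mulr_ge0 | apply: mulr_ge0 => //; exact: mulr_ge0].
have := reward_lower_bound core Rmax_gt0 Amax_gt0 bmin_gt0 bz' T_gt0 mgood V'0 C00 C10.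
rewrite -(expect_total_reward_clipped Rmax_gt0 Amax_gt0 bD run) -/S.
set LHS := (X in (_ -> X <= _) -> _) => LB;
have {}LB : LHS <=
    expect Pr (fun om => total_reward K T b (p ^~ om) (z ^~ om)).
  apply: LB.
  move=> om /and3P[nbad omE nunb] t tKT; have /andP[Kt tT] := tKT.
  have z'E s : (s < T)%N -> clip_pair Rmax Amax (z s om) = z s om.
    move=> sT; apply: clip_pair_id; move: nunb; rewrite negb_exists => /forallP/(_ (Ordinal sT)).
    by rewrite negbK inE.
  have bz s : (s < t)%N -> bounded_pair Rmax Amax (z s om).
    by move=> st; rewrite -z'E ?(ltn_trans st)//; exact: bz'.
  have seen k : (0 < nsel (theta ^~ om) t k)%N by apply: explored; rewrite Kt ltnW.
  have sad := run_saddle run tKT om.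
  have cl k p' (i : 'I_d) : let N : R := (nsel (theta ^~ om) t k)%:R in
      let u (v : pair_type R d) := clip Amax (tnth v.2 i) / Amax in
      let c := expect (D k) (fun v => u v * accepts p' v) in
      let err := 4 * Num.sqrt ((q%:R * ln T%:R) / N) in
      c <= N^-1 * (\sum_(s < t | theta s om == k) u (z s om) * accepts p' (z s om)) + err /\
      N^-1 * (\sum_(s < t | theta s om == k) u (z s om) * accepts_tie p' (z s om)) <= c + err.
    have zE f : \sum_(s < t | theta s om == k) f (clip_pair Rmax Amax (z s om)) =
        \sum_(s < t | theta s om == k) f (z s om) :> R.
      by apply: eq_bigr => s _; rewrite z'E// (ltn_trans (ltn_ord s)).
    move=> N u c err; rewrite -(zE (fun v => u v * accepts p' v)).
    rewrite -(zE (fun v => u v * accepts_tie p' v)).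
    exact: (close om nbad t k tT p' i (seen k)).
  split.
    move=> i; exact: (round_consumption Rmax_gt0 Amax_gt0 bmin_gt0 bz seen eps12 sad cl L0 i).
  apply: (round_reward Rmax_gt0 Amax_gt0 bD K_gt0 bmin_gt0 bz seen eps12 sad _ cl L0
    (beta_le om t)).
  by move=> k p' p'P; exact: (ucbE om (set_mem omE) t k tT p' p'P).
have Pgood : expect Pr (fun om => (~~ good om)%:R) <= p_bad + delta.
  have bb := bdm_bool (R := R) mbad.
  have bE := bdm_bool (R := R) (measurable_neg (measurable_mem mE)).
  have bU := bdm_bool (R := R) munb.
  apply: (@le_trans _ _ (expect Pr (fun om => (bad om)%:R + ((om \notin E)%:R
      + (unbounded Rmax Amax T z om)%:R)))).
    apply: expect_le; [exact: bdm_bool (measurable_neg mgood)|by apply: bdmD => //; exact: bdmD|].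
    move=> om; rewrite /good; case: (bad om); case: (om \in E);
      case: (unbounded _ _ _ _ _) => /=; lra.
  rewrite expectD//; last exact: bdmD.
  rewrite expectD// (expect_unbounded bD run) addr0 lerD//.
  rewrite (eq_expect _ (h := fun om => 1 - \1_E om)); last first.
    by move=> om; rewrite indicE; case: (om \in E); rewrite /= ?subrr ?subr0.
  rewrite expectB; [|exact: bdm_cst|exact: bdm_indic].
  rewrite expect_cst expect_indic//.
  have : 1 - delta <= fine (Pr E) by rewrite -lee_fin fineK// fin_num_measure.
  lra.
rewrite /mix_regret.
have bad0 : 0 <= expect Pr (fun om => (~~ good om)%:R) by exact: expect_ge0.
move: LB Pgood bad0; set e := expect Pr (fun om => (~~ good om)%:R).
rewrite /LHS natrB// -/e.
set TR := expect Pr (fun om => total_reward _ _ _ _ _).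
set Q := (Amax + C0 * S + d%:R * (Amax * Num.sqrt T%:R)) / bmin b.
have Q0 : 0 <= Q by rewrite divr_ge0 ?(ltW bmin_gt0)// !addr_ge0 ?mulr_ge0 ?sqrtr_ge0// ltW.
have TK : K%:R <= T%:R :> R by rewrite ler_nat.
have K0 : 0 <= K%:R :> R by exact: ler0n.
move: (Vmix D b) V0 VR V'0 T%:R K%:R TK K0 => V V0 VR V'0 t k tk k0 LB eP e0'.
have h1 : (1 - eps) * V * Q <= Rmax * Q.
  rewrite ler_wpM2r//; apply: le_trans VR; rewrite ler_piMl//; lra.
have t0 : 0 <= t by exact: le_trans tk.
have h2 : V * (t * eps + k + t * e) <= Rmax * (t * eps + k + t * (p_bad + delta)).
  apply: ler_pM => //; first by rewrite !addr_ge0 ?mulr_ge0.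
  by rewrite lerD2l ler_wpM2l.
(* These are the cross terms from expanding the product of [1 - eps], [t - k] and [1 - e]; they only
   help and are dropped. *)
have h3 : 0 <= V * (k * eps + k * e * (1 - eps) + t * e * eps).
  by rewrite mulr_ge0// !addr_ge0 ?mulr_ge0//; lra.
rewrite -/C1; lra.
Qed.

End Regret.

(** With [delta = T ^- 2] and [K <= T], the second logarithm is at most [4 * ln T], and together
    with [d * ln T] this gives the 5, as [d >= 1]. The term [4 * |ln c|] comes from [1 <= 4 * ln T],
    valid for [T >= 2]. *)
Lemma beta_le {R : realType} {d K : nat} (c_g c_0 Rmax Amax alpha : R) (b : d.-tuple R) (T : nat)
    (th : nat -> 'I_K) (t : nat) (k : 'I_K) :
  0 <= c_g -> 0 < c_0 -> (0 < d)%N -> 0 < Rmax -> 0 < Amax -> 0 < bmin b -> 0 <= alpha ->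
  (2 <= T)%N -> (K <= T)%N ->
  beta c_g c_0 Rmax Amax b T (T%:R ^- 2) alpha th t k <=
  alpha * c_g * Rmax *
    Num.sqrt ((5 + 4 * `|ln (c_0 * d%:R * Pmax Rmax b * Amax / Rmax)|) * (d%:R * ln T%:R))
  / Num.sqrt (maxn (nsel th t k) 1)%:R.
Proof.
move=> cg0 c00 d0 R0 A0 b0 a0 T2 KT; rewrite /beta -[leRHS]mulrA ler_wpM2l//.
  by rewrite !mulr_ge0// ltW.
set n : R := (maxn _ _)%:R; set c := c_0 * d%:R * Pmax Rmax b * Amax / Rmax.
have n0 : 0 < n by rewrite ltr0n leq_max orbT.
have T0 : (0 : R) < T%:R by rewrite ltr0n (leq_trans _ T2).
have K0 : (0 : R) < K%:R by rewrite ltr0n (leq_trans _ (ltn_ord k)).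
have d1 : 1 <= d%:R :> R by rewrite ler1n.
have l4 := ln_nat_ge (R := R) T2.
have c0 : 0 < c by rewrite divr_gt0// !mulr_gt0 ?invr_gt0// ltr0n.
have -> : c_0 * d%:R * Pmax Rmax b * Amax * T%:R / Rmax = c * T%:R.
  by rewrite /c; field; rewrite gt_eqF.
have -> : K%:R * T%:R / T%:R ^- 2 = K%:R * T%:R ^+ 3 :> R.
  by rewrite invrK -mulrA -exprS.
have -> : ln (c * T%:R) = ln c + ln T%:R by rewrite lnM.
have -> : ln (K%:R * T%:R ^+ 3) = ln K%:R + 3 * ln T%:R :> R.
  by rewrite lnM ?posrE ?exprn_gt0// lnXn// mulr_natl.
have lnK : ln K%:R <= ln T%:R :> R by rewrite ler_ln ?posrE// ler_nat.
rewrite -(sqrtrV (ltW n0)) -sqrtrM; last first.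
  by rewrite mulr_ge0 ?addr_ge0 ?mulr_ge0//; lra.
rewrite ler_wsqrtr// ler_pM2r ?invr_gt0//.
have h1 : ln c <= `|ln c| by exact: ler_norm.
have h2 : 0 <= `|ln c| by exact: normr_ge0.
move: h1 h2 lnK l4 d1; set m : R := `|ln c|; set lc : R := ln c.
set l : R := ln T%:R; set lk : R := ln K%:R; set dd : R := d%:R => h1 h2 h3 h4 h5.
have dd0 : 0 <= dd by lra.
have h6 : 0 <= dd * m * (l - 4^-1) by apply: mulr_ge0; [exact: mulr_ge0 | lra].
have h7 : 0 <= (dd - 1) * l by apply: mulr_ge0; lra.
have h8 : dd * lc <= dd * m by rewrite ler_wpM2l.
lra.
Qed.
(** Here [s], [sT], [sl], [sd], [sq] are the square roots of [K T], [T], [ln T], [d] and [q]; [ib]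
    is the inverse of [bmin b], and [tp] is [T] times the failure probability. Lower-order terms are
    absorbed into [sqrt (T ln T)], which is at least [1/2] and at least [sqrt T / 2]. *)
Lemma regret_constants {R : realType} (Rx A ib P cg sC sq n sd al k s sT sl tp : R) :
  0 <= Rx -> 0 <= A -> 0 <= ib -> 0 <= P -> 0 <= sq -> 0 <= n -> 0 <= s -> 0 <= sT -> 0 <= sl ->
  1 <= sd -> 1 <= al -> 1 <= 2 * (sT * sl) -> sT <= 2 * (sT * sl) -> tp <= 2 * n + 1 ->
  Rx * (sT * sl + k + tp)
    + Rx * ((A + 4 * A * (sq * sl) * (3 * s) + n * (A * sT)) * ib)
    + (2 * (al * cg * Rx * sC * (sd * sl)) + n * P * (4 * A * (sq * sl))) * (3 * s) <=
  (12 * A * sq * (Rx * ib + n * P) + 6 * cg * Rx * sC + 1) * al * (s * (sd * sl))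
    + Rx * (4 * n + 5 + 2 * (A + n * A) * ib) * (sT * sl) + k * Rx.
Proof.
move=> Rx0 A0 ib0 P0 sq0 n0 s0 sT0 sl0 sd1 al1 G1 GT tpn.
have G1' : 0 <= 2 * (sT * sl) - 1 by rewrite subr_ge0.
have GT' : 0 <= 2 * (sT * sl) - sT by rewrite subr_ge0.
have ads : 0 <= al * sd - 1.
  by rewrite subr_ge0 (le_trans al1)// ler_peMr//; lra.
have a1 := ler_wpM2l Rx0 tpn.
have a2 : 0 <= Rx * (2 * n + 1) * (2 * (sT * sl) - 1).
  by rewrite !mulr_ge0// addr_ge0// mulr_ge0.
have a3 : 0 <= Rx * ib * A * (2 * (sT * sl) - 1) by rewrite !mulr_ge0.
have a4 : 0 <= Rx * ib * (n * A) * (2 * (sT * sl) - sT) by rewrite !mulr_ge0.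
have a5 : 0 <= 12 * A * sq * (Rx * ib + n * P) * (s * sl) * (al * sd - 1).
  by rewrite !mulr_ge0// addr_ge0// mulr_ge0.
have a6 : 0 <= al * (s * (sd * sl)) by rewrite !mulr_ge0//; lra.
have a7 : 0 <= Rx * (sT * sl) by rewrite !mulr_ge0.
lra.
Qed.

(** All three terms are brought under [alpha * sqrt (K T) * ln T]; the number [m] of exploration
    rounds may not exceed [sqrt (K T)]. *)
Lemma log_constants {R : realType} (C1 C2 Rx al sd s sT sl l m : R) :
  0 <= C1 -> 0 <= C2 -> 0 <= Rx -> 0 <= sd -> 0 <= s -> 0 <= sT -> 0 <= sl ->
  1 <= al -> 4^-1 <= l -> sl <= 2 * l -> sT <= s -> m <= s ->
  C1 * al * (s * (sd * sl)) + C2 * (sT * sl) + m * Rx <=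
  (2 * C1 * sd + 2 * C2 + 4 * Rx) * al * s * l.
Proof.
move=> C10 C20 Rx0 sd0 s0 sT0 sl0 al1 l4 sl2 sTs ms.
have l0 : 0 <= l by lra.
have al0 : 0 <= al by lra.
have b2 : sT * sl <= s * (2 * l) by exact: ler_pM.
have b1 : 0 <= (al - 1) * (s * l) by rewrite !mulr_ge0//; lra.
have b3 : 0 <= C2 * (s * (2 * l) - sT * sl) by rewrite mulr_ge0// subr_ge0.
have b4 : 0 <= C2 * ((al - 1) * (s * l)) by rewrite mulr_ge0.
have b5 : 0 <= Rx * ((al - 1) * (s * l)) by rewrite mulr_ge0.
have b6 : 0 <= C1 * al * sd * s * (2 * l - sl) by rewrite !mulr_ge0// subr_ge0.
have b7 : 0 <= Rx * (s * (4 * l - 1)) by rewrite !mulr_ge0//; lra.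
have b8 : 0 <= Rx * (s - m) by rewrite mulr_ge0// subr_ge0.
lra.
Qed.

Theorem theorem9 (R : realType) (c_g c_0 : R) (d : nat) (Rmax Amax : R)
    (b : d.-tuple R)
    (c_g_gt0 : 0 < c_g) (c_0_gt0 : 0 < c_0) (d_gt0 : (0 < d)%N)
    (Rmax_gt0 : 0 < Rmax) (Amax_gt0 : 0 < Amax) (bmin_gt0 : 0 < bmin b) :
  exists (C1 C2 C3 : R) (m : nat),
  [/\ 0 < C1, 0 < C2, 0 < C3 &
    forall (K T : nat) (D : 'I_K -> probability (pair_type R d) R) (alpha : R)
      (disp : measure_display) (Om : measurableType disp)
      (Pr : probability Om R) (F : nat -> set (set Om))
      (theta : nat -> Om -> 'I_K) (z : nat -> Om -> pair_type R d)
      (w : nat -> Om -> 'I_K -> R) (p : nat -> Om -> d.-tuple R),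
    let eps := Num.sqrt (ln T%:R / T%:R) in
    let delta := T%:R ^- 2 in
    (0 < K)%N -> (0 < T)%N -> 1 <= alpha ->
    bounded_laws D Rmax Amax ->
    continuous_valuation D ->
    sp_ucb_olp c_g c_0 Rmax Amax b D T eps delta alpha Pr F theta z w p ->
    ucb_concentration c_g c_0 Rmax Amax b D T delta alpha Pr theta z ->
    mix_regret b D T Pr z p <=
      C1 * alpha * Num.sqrt (K%:R * T%:R * (d%:R * ln T%:R))
      + C2 * Num.sqrt (T%:R * ln T%:R) + K%:R * Rmax /\
    ((2 <= T)%N ->
     mix_regret b D T Pr z p <=
       C3 * alpha * Num.sqrt (K%:R * T%:R) * ln T%:R ^+ m)].
Proof.
have [q qP] := uniform_acceptance R d.
pose P := Pmax Rmax b.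
pose Cl : R := 5 + 4 * `|ln (c_0 * d%:R * P * Amax / Rmax)|.
pose C1 : R := 12 * Amax * Num.sqrt q%:R * (Rmax / bmin b + d%:R * P)
  + 6 * c_g * Rmax * Num.sqrt Cl + 1.
pose C2 : R := Rmax * (4 * d%:R + 5 + 2 * (Amax + d%:R * Amax) / bmin b).
pose C3 : R := 2 * C1 * Num.sqrt d%:R + 2 * C2 + 4 * Rmax.
have d0 : (0 : R) < d%:R by rewrite ltr0n.
have d1 : 1 <= d%:R :> R by rewrite ler1n.
have R0 := ltW Rmax_gt0; have A0 := ltW Amax_gt0; have cg0 := ltW c_g_gt0.
have ib0 : 0 <= (bmin b)^-1 by rewrite invr_ge0 ltW.
have P0 : 0 <= P by rewrite /P /Pmax divr_ge0 ?mulr_ge0// ltW.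
have Cl0 : 0 <= Cl by rewrite addr_ge0 ?mulr_ge0.
have C1_gt0 : 0 < C1.
  apply: ltr_wpDl => //; apply: addr_ge0.
    by rewrite !mulr_ge0 ?sqrtr_ge0// addr_ge0 ?mulr_ge0.
  by rewrite !mulr_ge0 ?sqrtr_ge0.
have Q0 : 0 <= 2 * (Amax + d%:R * Amax) / bmin b.
  by apply: mulr_ge0 => //; apply: mulr_ge0 => //; rewrite addr_ge0// mulr_ge0.
have C2_gt0 : 0 < C2 by apply: mulr_gt0 => //; lra.
have C3_gt0 : 0 < C3.
  have h1 : 0 < 2 * C1 * Num.sqrt d%:R.
    by apply: mulr_gt0; [exact: mulr_gt0 | rewrite sqrtr_gt0].
  have h2 : 0 < 2 * C2 by exact: mulr_gt0.
  by rewrite /C3; lra.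
(* One power of the logarithm suffices, since [sqrt (ln T) <= 2 * ln T] for [T >= 2]. *)
exists C1, C2, C3, 1%N; split => //.
move=> K T D alpha disp Om Pr F theta z w p eps delta K_gt0 T_gt0 alpha1 bD cD run ucb.
have le_T := mix_regret_le_T Rmax_gt0 Amax_gt0 bmin_gt0 K_gt0 bD run.
have T0 : (0 : R) < T%:R by rewrite ltr0n.
have K0 : (0 : R) < K%:R by rewrite ltr0n.
have ln0 : 0 <= ln T%:R :> R by rewrite ln_ge0// ler1n.
pose sT : R := Num.sqrt T%:R; pose sl : R := Num.sqrt (ln T%:R).
pose s : R := Num.sqrt (K%:R * T%:R); pose sd : R := Num.sqrt d%:R.
have sT0 : 0 <= sT by exact: sqrtr_ge0.
have sl0 : 0 <= sl by exact: sqrtr_ge0.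
have s0 : 0 <= s by exact: sqrtr_ge0.
have sd1 : 1 <= sd by have := ler_wsqrtr d1; rewrite sqrtr1.
have sT1 : 1 <= sT by have := @ler_wsqrtr R 1 T%:R; rewrite sqrtr1; apply; rewrite ler1n.
have sll : sl ^+ 2 = ln T%:R by rewrite sqr_sqrtr.
have sl2 : (2 <= T)%N -> 2^-1 <= sl.
  move=> T2; have := ler_wsqrtr (ln_nat_ge (R := R) T2).
  by rewrite (_ : 4^-1 = 2^-1 ^+ 2 :> R) ?sqrtr_sqr ?ger0_norm//; field.
have sTs : sT <= s by rewrite ler_wsqrtr// ler_peMl ?ler1n// ltW.
have sXl x : 0 <= x -> Num.sqrt (x * ln T%:R) = Num.sqrt x * sl by move=> x0; rewrite sqrtrM.
have sE1 : Num.sqrt (K%:R * T%:R * (d%:R * ln T%:R)) = s * (sd * sl) :> R.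
  by rewrite sqrtrM ?sXl// ?mulr_ge0// ltW.
have epsT : T%:R * eps = sT * sl.
  rewrite /eps sqrtrM// sqrtrV ?(ltW T0)// -/sT -/sl -[X in X * _](sqr_sqrtr (ltW T0)) -/sT.
  by field; rewrite gt_eqF// sqrtr_gt0.
have min_le : (minn K T)%:R <= s.
  rewrite -[leLHS]ger0_norm// -sqrtr_sqr ler_wsqrtr// expr2.
  by rewrite ler_pM// ler_nat ?geq_minl ?geq_minr.
have eps0 : 0 <= eps by exact: sqrtr_ge0.
have X0 : 0 <= C1 * alpha * (s * (sd * sl)).
  have h1 : 0 <= C1 * alpha by apply: mulr_ge0; [exact: ltW | lra].
  by apply: (mulr_ge0 h1); apply: mulr_ge0 => //; apply: mulr_ge0 => //; lra.
have G0 : 0 <= C2 * (sT * sl) by apply: mulr_ge0; [exact: ltW | exact: mulr_ge0].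
(* The minimum of [K] and [T], rather than [K], keeps the last term below [sqrt (K T)] even when
   [K > T], as the second claim requires. *)
have main : mix_regret b D T Pr z p <=
    C1 * alpha * (s * (sd * sl)) + C2 * (sT * sl) + (minn K T)%:R * Rmax.
  have [KT|TK] := leqP K T; last by lra.
  have [T2|T1] := leqP 2 T; last first.
    have TK : T%:R * Rmax <= K%:R * Rmax.
      by apply: ler_wpM2r => //; rewrite ler_nat; apply: leq_trans K_gt0.
    lra.
  (* If [eps > 1/2], then [T < 2 * sqrt (T ln T)], so the trivial bound [T * Rmax] is covered by the
     second term. *)
  have [eps12|eps12] := leP eps 2^-1; last first.
    have h1 : T%:R <= 2 * (sT * sl).
      have : T%:R * 2^-1 <= T%:R * eps by rewrite ler_pM2l// ltW.
      rewrite epsT; lra.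
    have h2 : Rmax * 2 * (sT * sl) <= C2 * (sT * sl).
      by apply: ler_wpM2r; [exact: mulr_ge0 | rewrite ler_pM2l//; lra].
    have h3 := ler_wpM2r R0 h1.
    have h4 : 0 <= K%:R * Rmax by rewrite mulr_ge0.
    lra.
  have no_tie := continuous_valuation_no_tie cD.
  have mu i : measurable_fun setT (fun v : pair_type R d => clip Amax (tnth v.2 i) / Amax).
    by apply: measurable_funM => //; apply: measurable_clip; exact: measurable_res.
  have u01 i (v : pair_type R d) : 0 <= clip Amax (tnth v.2 i) / Amax <= 1.
    have /andP[h1 h2] := clip_ge0 (tnth v.2 i) A0.
    by rewrite divr_ge0//= ler_pdivrMr// mul1r.
  have core := clipped_core bD run.
  have [bad [mbad bad_le close]] := qP _ _ _ _ _ _ _ _ _ _ (core_obs core) T2 KT no_tie mu u01.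
  pose Cb := alpha * c_g * Rmax * Num.sqrt (Cl * (d%:R * ln T%:R)).
  have Cb0 : 0 <= Cb.
    apply: mulr_ge0; last exact: sqrtr_ge0.
    by apply: mulr_ge0 => //; apply: mulr_ge0 => //; lra.
  have e01 : 0 <= eps <= 2^-1 by rewrite eps0.
  have bl om t k : beta c_g c_0 Rmax Amax b T delta alpha (theta ^~ om) t k <=
      Cb / Num.sqrt (maxn (nsel (theta ^~ om) t k) 1)%:R.
    by apply: beta_le => //; lra.
  apply: le_trans (mix_regret_le_width Rmax_gt0 Amax_gt0 bmin_gt0 K_gt0 T_gt0 bD run ucb KT e01
    mbad bad_le close Cb0 ln0 bl) _.
  have -> : Cb = alpha * c_g * Rmax * Num.sqrt Cl * (sd * sl).
    by rewrite /Cb sqrtrM// sXl ?mulrA// ltW.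
  rewrite sXl// epsT.
  have sl_2 := sl2 T2.
  have TD : T%:R * (d.*2%:R / T%:R + delta) <= 2 * d%:R + 1.
    rewrite mulrDr mulrCA divff ?gt_eqF// mulr1 -mul2n natrM lerD2l.
    by rewrite /delta ler_pdivrMr ?exprn_gt0// mul1r expr2 ler_peMl ?ler1n// ltW.
  have GT : sT <= 2 * (sT * sl) by rewrite mulrCA ler_peMr//; lra.
  have G1 : 1 <= 2 * (sT * sl) by exact: le_trans GT.
  exact: (regret_constants c_g (Num.sqrt Cl) K%:R R0 A0 ib0 P0 (sqrtr_ge0 q%:R) (ltW d0)
    s0 sT0 sl0 sd1 alpha1 G1 GT TD).
split.
  rewrite sE1 (sXl _ (ltW T0)); apply: le_trans main _.
  by rewrite lerD2l ler_wpM2r// ler_nat geq_minl.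
move=> T2; rewrite expr1; apply: le_trans main _.
have sl_2 := sl2 T2.
have sl_l : sl <= 2 * ln T%:R by rewrite -sll; nra.
apply: log_constants => //; [exact: ltW|exact: ltW|lra|exact: ln_nat_ge].
Qed.
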